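(* Let $\Omega=(0,w)\cup(w+\rho,1+\rho)$ with $0<w<1$, $\rho>0$ (a union of two intervals with $|\Omega|=1$). Then $\Omega$ is spectral if and only if one of the following two conditions holds: (i) $\rho$ is an integer and $w\ne\frac12$. In this case the only spectrum that contains $0$ is $\Lambda=\mathbb{Z}$, $\Omega$ is $\mathbb{Z}$-translation congruent to $(0,1)$ and it tiles $\mathbb{R}$ by $\mathbb{Z}$. The spectral unitary matrix associated to $\Lambda$ is $B=\begin{pmatrix}0&1\\ 1&0\end{pmatrix}$. For (a.e.) $x\in\mathbb{R}$ denote by $x\bmod\Omega$ the unique point in $\Omega$ such that $x-(x\bmod\Omega)\in\mathbb{Z}$. Then the group of local translations $U_\Lambda$ is $$(U_\Lambda(t)f)(x)=f((x+t)\bmod\Omega),\qquad x\in\Omega,\ f\in L^2(\Omega),\ t\in\mathbb{R}.$$ (ii) $w=\frac12$, $w+\rho=\frac l2\in\frac12\mathbb{Z}$ (with $l\in\mathbb{Z}$), $1+\rho=\frac{l+1}2$. In this case, any spectrum that contains $0$ is of the form $$\Lambda=\left\{0,\tfrac{2k+1}l\right\}+2\mathbb{Z}$$ for some $k\in\{0,\dots,l-1\}$. The associated spectral unitary matrix is $$B=\begin{pmatrix}\frac{1+\xi}2&\frac{1-\xi}2\\ \frac{1-\xi}2&\frac{1+\xi}2\end{pmatrix},\qquad \xi=e^{\pi \mathrm{i}\frac{2k+1}l}.$$ For $x\in\mathbb{R}$ let $a(x)$ be the unique integer such that $x\in[\frac{a(x)}2,\frac{a(x)+1}2)$ and let $[x]_2=x-\frac{a(x)}2\in[0,\frac12)$.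 The group of local translations is, for $f\in L^2(\Omega)$, $t\in\mathbb{R}$ and (a.e.) $x\in[0,\frac12)$, $$(U_\Lambda(t)f)(x)=\tfrac{1+\xi^{a(x+t)}}2f([x+t]_2)+\tfrac{1-\xi^{a(x+t)}}2f([x+t]_2+\tfrac l2),$$ $$(U_\Lambda(t)f)(x+\tfrac l2)=\tfrac{1-\xi^{a(x+t)}}2f([x+t]_2)+\tfrac{1+\xi^{a(x+t)}}2f([x+t]_2+\tfrac l2),$$ or, in shorter form, $$\begin{pmatrix}(U_\Lambda(t)f)(x)\\ (U_\Lambda(t)f)(x+\frac l2)\end{pmatrix}=B^{a(x+t)}\begin{pmatrix}f([x+t]_2)\\ f([x+t]_2+\frac l2)\end{pmatrix}.$$
   Context: $e_\lambda(x)=e^{2\pi \mathrm{i}\lambda x}$; $|\Omega|$ is Lebesgue measure. $\Omega$ is spectral with spectrum $\Lambda\subset\mathbb{R}$ if $\{|\Omega|^{-1/2}e_\lambda:\lambda\in\Lambda\}$ is an orthonormal basis of $L^2(\Omega)$. $\Omega$ tiles $\mathbb{R}$ by $\mathbb{Z}$ if $(\Omega+k)_{k\in\mathbb{Z}}$ is a partition of $\mathbb{R}$ up to Lebesgue measure zero. $\Omega$ is $\mathbb{Z}$-translation congruent to $(0,1)$ if, up to measure zero, $\Omega$ can be partitioned into measurable pieces whose translates by suitable integers partition $(0,1)$. The group of local translations associated to $\Lambda$ is the strongly continuous one-parameter unitary group $U_\Lambda$ on $L^2(\Omega)$ determined by $U_\Lambda(t)e_\lambda=e^{2\pi \mathrm{i}\lambda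 t}e_\lambda$, $\lambda\in\Lambda$. The spectral unitary matrix associated to a spectrum $\Lambda$: write $\Omega=(\alpha_1,\beta_1)\cup(\alpha_2,\beta_2)$ with $\alpha_1=0,\beta_1=w,\alpha_2=w+\rho,\beta_2=1+\rho$. Let $A$ be the self-adjoint operator on $L^2(\Omega)$, diagonal in the basis $\{e_\lambda\}_{\lambda\in\Lambda}$, with $Ae_\lambda=\lambda e_\lambda$; it is a self-adjoint extension of $\frac1{2\pi \mathrm{i}}\frac d{dx}$ on $C_c^\infty(\Omega)$. $B$ is the unique $2\times2$ unitary matrix such that $\operatorname{domain}(A)=\{f\in\mathcal{D}_{\max}:B(f(\alpha_1),f(\alpha_2))^t=(f(\beta_1),f(\beta_2))^t\}$, where $\mathcal{D}_{\max}=\{f\in L^2(\Omega):f$ absolutely continuous on each interval, $f'\in L^2(\Omega)\}$ and endpoint values are one-sided limits from inside the intervals. *)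

(* Defs.v *)
From HB Require Import structures.
From mathcomp Require Import all_boot all_order all_algebra.
From mathcomp Require Import all_classical all_reals all_analysis.
From mathcomp Require Import complex spectral.

Set Implicit Arguments.
Unset Strict Implicit.
Unset Printing Implicit Defensive.

Import Order.TTheory GRing.Theory Num.Theory.
Import numFieldNormedType.Exports.
Import ComplexField.Normc.

Local Open Scope classical_set_scope.
Local Open Scope ring_scope.
Local Open Scope complex_scope.

(* not the Re and Im of numClosedFieldType, which are R[i]-valued *)
Local Notation Re := complex.Re.
Local Notation Im := complex.Im.

(* Elements of L^2(Omega) are represented by functions R -> R[i]; only their
   values on Omega matter, and equality is [f = g %[ae mu in Omega]].  Since
   the measurable sets of R are the Borel sets, a function that is a.e. equal to
   an element of [L2 Omega] need not itself be in [L2 Omega]. *)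
Section L2.
Variable R : realType.
Local Notation mu := (@lebesgue_measure R).
Implicit Types (Omega Lambda : set R) (f g h u v : R -> R[i]).

Definition normsq Omega f : \bar R :=
  (\int[mu]_(x in Omega) ((normc (f x)) ^+ 2)%:E)%E.

Definition L2 Omega f : Prop :=
  [/\ measurable_fun Omega (fun x => Re (f x)),
      measurable_fun Omega (fun x => Im (f x)) &
      (normsq Omega f < +oo)%E].

Definition cintegral Omega f : R[i] :=
  Rintegral mu Omega (fun x => Re (f x)) +i*
  Rintegral mu Omega (fun x => Im (f x)).

(* linear in the first argument *)
Definition inner Omega f g : R[i] := cintegral Omega (fun x => f x * (g x)^*).

Definition orthonormal_basis Omega (J : set R) (phi : R -> R -> R[i]) : Prop :=
  [/\ forall j, J j -> L2 Omega (phi j),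
      forall j k, J j -> J k -> inner Omega (phi j) (phi k) = (j == k)%:R &
      forall f, L2 Omega f -> forall eps : R, 0 < eps ->
        exists s : seq R, exists c : R -> R[i],
          (forall j, j \in s -> J j) /\
          (normsq Omega (fun x => (f x - \sum_(j <- s) c j * phi j x)%R)
             < eps%:E)%E].

Definition expi (theta : R) : R[i] := cos theta +i* sin theta.

Definition e_ (lambda x : R) : R[i] := expi (2 * pi * lambda * x).

Definition is_spectrum Omega Lambda : Prop :=
  orthonormal_basis Omega Lambda
    (fun lambda x => ((Num.sqrt (fine (mu Omega)))^-1)%:C * e_ lambda x).

Definition spectral Omega : Prop := exists Lambda, is_spectrum Omega Lambda.

(* [P] is a partition of [X] up to measure zero *)
Definition ae_partition (I : Type) (P : I -> set R) (X : set R) : Prop :=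
  [/\ forall i, measurable (P i),
      forall i j, i <> j -> mu (P i `&` P j) = 0%E,
      mu (\bigcup_i P i `\` X) = 0%E &
      mu (X `\` \bigcup_i P i) = 0%E].

Definition translate (A : set R) (c : R) : set R := [set x + c | x in A].

Definition tiles_by_Z Omega : Prop :=
  ae_partition (fun k : int => translate Omega k%:~R) setT.

Definition Z_congruent_to_unit_interval Omega : Prop :=
  exists (P : nat -> set R) (n : nat -> int),
    ae_partition P Omega /\
    ae_partition (fun i => translate (P i) (n i)%:~R) `]0, 1[.

Definition unitary_operator Omega (V : (R -> R[i]) -> (R -> R[i])) : Prop :=
  [/\ forall f, L2 Omega f -> L2 Omega (V f),
      forall (a : R[i]) f g, L2 Omega f -> L2 Omega g ->
        V (fun x => a * f x + g x) = (fun x => a * V f x + V g x)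
          %[ae mu in Omega],
      forall f g, L2 Omega f -> L2 Omega g ->
        inner Omega (V f) (V g) = inner Omega f g &
      forall g, L2 Omega g ->
        exists f, L2 Omega f /\ V f = g %[ae mu in Omega]].

Definition unitary_group Omega (U : R -> (R -> R[i]) -> (R -> R[i])) : Prop :=
  [/\ forall t, unitary_operator Omega (U t),
      forall f, L2 Omega f -> U 0 f = f %[ae mu in Omega],
      forall s t f, L2 Omega f ->
        U (s + t) f = U s (U t f) %[ae mu in Omega] &
      forall f (t0 : R), L2 Omega f ->
        normsq Omega (fun x => U t f x - U t0 f x) @[t --> t0] --> 0%E].

Definition local_translations Omega Lambda
    (U : R -> (R -> R[i]) -> (R -> R[i])) : Prop :=
  unitary_group Omega U /\
  forall lambda t, Lambda lambda ->
    U t (e_ lambda) = (fun x => e_ lambda t * e_ lambda x) %[ae mu in Omega].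

(* Unbounded operators are given by their graph: [A f g] means that [f] is in
   the domain of [A] and [A f = g]. *)
Definition densely_defined_operator Omega (A : (R -> R[i]) -> (R -> R[i]) -> Prop) :
    Prop :=
  [/\ forall f g, A f g -> L2 Omega f /\ L2 Omega g,
      forall f1 f2 g1 g2, L2 Omega f2 -> L2 Omega g2 ->
        f1 = f2 %[ae mu in Omega] -> g1 = g2 %[ae mu in Omega] ->
        A f1 g1 -> A f2 g2,
      forall f g1 g2, A f g1 -> A f g2 -> g1 = g2 %[ae mu in Omega],
      forall (a : R[i]) f1 f2 g1 g2, A f1 g1 -> A f2 g2 ->
        A (fun x => a * f1 x + f2 x) (fun x => a * g1 x + g2 x) &
      forall f, L2 Omega f -> forall eps : R, 0 < eps ->
        exists u v, A u v /\ (normsq Omega (fun x => (f x - u x)%R) < eps%:E)%E].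

Definition adjoint Omega (A : (R -> R[i]) -> (R -> R[i]) -> Prop) f g : Prop :=
  [/\ L2 Omega f, L2 Omega g &
      forall u v, A u v -> inner Omega v f = inner Omega u g].

Definition self_adjoint Omega (A : (R -> R[i]) -> (R -> R[i]) -> Prop) : Prop :=
  densely_defined_operator Omega A /\
  forall f g, A f g <-> adjoint Omega A f g.

(* The eigenvector condition determines [A] when [Lambda] is a spectrum:
   testing [A = adjoint A] against the basis shows that [A] is contained in the
   maximal diagonal operator, which is itself self-adjoint. *)
Definition spectral_operator Omega Lambda
    (A : (R -> R[i]) -> (R -> R[i]) -> Prop) : Prop :=
  self_adjoint Omega A /\
  forall lambda, Lambda lambda ->
    A (e_ lambda) (fun x => lambda%:C * e_ lambda x).

Definition absolutely_continuous_on (a b : R) f : Prop :=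
  forall eps : R, 0 < eps -> exists2 delta : R, 0 < delta &
    forall (n : nat) (p q : 'I_n -> R),
      (forall i, [/\ a < p i, p i <= q i & q i < b]) ->
      trivIset setT (fun i => `]p i, q i[%classic) ->
      \sum_(i < n) (q i - p i) < delta ->
      \sum_(i < n) normc (f (q i) - f (p i)) < eps.

Definition is_derivative f (x : R) (d : R[i]) : Prop :=
  is_derive x (1 : R) (fun y => Re (f y) : R^o) (Re d) /\
  is_derive x (1 : R) (fun y => Im (f y) : R^o) (Im d).

Definition right_limit f (x : R) (l : R[i]) : Prop :=
  (Re (f y) @[y --> x^'+] --> Re l) /\ (Im (f y) @[y --> x^'+] --> Im l).

Definition left_limit f (x : R) (l : R[i]) : Prop :=
  (Re (f y) @[y --> x^'-] --> Re l) /\ (Im (f y) @[y --> x^'-] --> Im l).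

Definition mx2 (a b c d : R[i]) : 'M[R[i]]_2 :=
  \matrix_(i, j) if i == 0 then (if j == 0 then a else b)
                 else (if j == 0 then c else d).

Definition col2 (a b : R[i]) : 'cV[R[i]]_2 :=
  \col_i if i == 0 then a else b.

Definition two_intervals (w rho : R) : set R :=
  `]0, w[ `|` `]w + rho, 1 + rho[.

Definition Dmax (w rho : R) f : Prop :=
  [/\ L2 (two_intervals w rho) f,
      absolutely_continuous_on 0 w f,
      absolutely_continuous_on (w + rho) (1 + rho) f &
      exists2 g, L2 (two_intervals w rho) g &
        {ae mu, forall x, two_intervals w rho x -> is_derivative f x (g x)}].

Definition boundary_condition (w rho : R) (B : 'M[R[i]]_2) f : Prop :=
  exists fa1 fa2 fb1 fb2 : R[i],
    [/\ right_limit f 0 fa1, right_limit f (w + rho) fa2,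
        left_limit f w fb1, left_limit f (1 + rho) fb2 &
        B *m col2 fa1 fa2 = col2 fb1 fb2].

(* The domain of [A] consists of a.e. classes, [Dmax] of their continuous
   representatives. *)
Definition spectral_matrix (w rho : R) Lambda (B : 'M[R[i]]_2) : Prop :=
  B \is unitarymx /\
  exists A, spectral_operator (two_intervals w rho) Lambda A /\
    forall f, (exists g, A f g) <->
      L2 (two_intervals w rho) f /\
      exists h, [/\ f = h %[ae mu in two_intervals w rho],
                    Dmax w rho h & boundary_condition w rho B h].

(* arbitrary (namely 0) when no point of Omega is congruent to x *)
Definition mod_set Omega (x : R) : R :=
  xget 0 [set y | Omega y /\ x - y \is a Num.int].

Definition half_index (x : R) : int := Num.floor (2 * x).

Definition half_rem (x : R) : R := x - (half_index x)%:~R / 2.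

End L2.

(* Main.v *)
Require Import Defs.
From HB Require Import structures.
From mathcomp Require Import all_boot all_order all_algebra.
From mathcomp Require Import all_classical all_reals all_analysis.
From mathcomp Require Import measurable_realfun complex spectral ring lra.

(* Two exponentials of frequencies differing by [k <> 0] are orthogonal on Omega
   exactly when [e_k(w) + e_k(1 + rho) = 1 + e_k(w + rho)], an equality of two
   sums of two unit complex numbers, which splits into three arithmetic
   alternatives.  If all frequencies are integers and rho is not, two small cells
   of Omega differ by an integer translation, and the difference of their
   indicators is orthogonal to the spectrum.  If some frequency l0 is not an
   integer, the spectrum lies in the union of G and l0 + G, where G is the group
   of the k with k, k w and k rho all integers; unless w = 1/2 and 2 rho is an
   integer, Omega contains three cells whose mutual translations pair integrally
   with G, and two linear equations in the three heights leave a nonzero step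
   function orthogonal to the spectrum.  Conversely, the sets Z and
   {0, r} + 2 Z are spectra by completeness of Fourier series on (0, 1) and
   (0, 1/2); in the second case one splits a function into its components even
   and odd under the translation by l/2.

   The spectral matrix maps the left boundary values of each e_lambda to the
   right ones, and two frequencies determine it.  That the domain of the diagonal
   operator is given by such a matrix follows by passing to the limit in partial
   Fourier sums, which converge in the graph norm and so uniformly.  Finally an
   isometry is determined by its values on the basis, so it suffices to check
   that the explicit formulas define isometries (by invariance under translation
   of the integral of a periodic function over a period) and that they multiply
   e_lambda by e_lambda(t). *)

Set Implicit Arguments.
Unset Strict Implicit.
Unset Printing Implicit Defensive.

Import Order.TTheory GRing.Theory Num.Theory.
Import numFieldNormedType.Exports.
Import ComplexField.Normc.

Local Open Scope classical_set_scope.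
Local Open Scope ring_scope.
Local Open Scope complex_scope.

Local Notation Re := complex.Re.
Local Notation Im := complex.Im.

(** Everything is estimated with squared norms: the triangle inequality then costs a factor 2,
    constants such as 4 and 16 accumulate, and [le_eps_eq0] absorbs them because it accepts any
    bound linear in the error. Functions are representatives, so an operator may only be linear up
    to null sets; compatibility with a.e. equality is a consequence of being isometric.

    For the explicit formulas surjectivity is not checked by hand. A family of isometries
    multiplying each basis exponential by its value at [t] automatically satisfies the group law, so
    [V (- t)] inverts [V t].

    In the classification it is enough to include the given spectrum in a known one: a spectrum is a
    maximal orthogonal set of frequencies, so inclusion forces equality. The overlap w = 1/2 with
    rho an integer belongs to case (ii): there l = 2 rho + 1, and Z is the member of the family with
    k = rho, since then (2 k + 1) / l = 1. This is why case (i) excludes w = 1/2. *)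

Section AlmostEverywhere.
Variable R : realType.
Local Notation mu := (@lebesgue_measure R).

Lemma ae_imp (P Q : R -> Prop) : (forall x, P x -> Q x) ->
  {ae mu, forall x, P x} -> {ae mu, forall x, Q x}.
Proof. by move=> PQ; apply: (@filterS _ _ (ae_filter_ringOfSetsType mu)). Qed.

Lemma ae_and (P Q : R -> Prop) : {ae mu, forall x, P x} ->
  {ae mu, forall x, Q x} -> {ae mu, forall x, P x /\ Q x}.
Proof. exact: (@filterI _ _ (ae_filter_ringOfSetsType mu)). Qed.

Lemma ae_imp2 (P Q S : R -> Prop) : (forall x, P x -> Q x -> S x) ->
  {ae mu, forall x, P x} -> {ae mu, forall x, Q x} -> {ae mu, forall x, S x}.
Proof. by move=> PQS p q; apply: ae_imp (ae_and p q) => x []; exact: PQS. Qed.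

Lemma ae_all (P : R -> Prop) : (forall x, P x) -> {ae mu, forall x, P x}.
Proof. by move=> p; exact: aeW. Qed.

Lemma ae_finite (I : finType) (P : I -> R -> Prop) :
  (forall i, {ae mu, forall x, P i x}) -> {ae mu, forall x, forall i, P i x}.
Proof.
move=> p; have : forall s : seq I, {ae mu, forall x, forall i, i \in s -> P i x}.
  elim=> [|i s ih]; first exact: ae_all.
  apply: (ae_imp2 _ (p i) ih) => x pi ps j.
  by rewrite inE => /predU1P[->//|/ps].
move=> /(_ (enum I)); apply: ae_imp => x h i; apply: h.
by rewrite mem_enum.
Qed.

End AlmostEverywhere.

(** * Square-integrable complex functions *)

Section ComplexParts.
Variable R : realType.
Implicit Types (z a b : R[i]) (f g : R -> R[i]).

Lemma normc_sqr z : normc z ^+ 2 = Re z ^+ 2 + Im z ^+ 2.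
Proof. by case: z => x y /=; rewrite sqr_sqrtr// addr_ge0// sqr_ge0. Qed.

Lemma normc_ge0 z : 0 <= normc z.
Proof. by case: z => x y /=; rewrite sqrtr_ge0. Qed.

Lemma ReD a b : Re (a + b) = Re a + Re b. Proof. by case: a b => ? ? [? ?]. Qed.
Lemma ImD a b : Im (a + b) = Im a + Im b. Proof. by case: a b => ? ? [? ?]. Qed.
Lemma ReN a : Re (- a) = - Re a. Proof. by case: a. Qed.
Lemma ImN a : Im (- a) = - Im a. Proof. by case: a. Qed.
Lemma ReM a b : Re (a * b) = Re a * Re b - Im a * Im b.
Proof. by case: a b => ? ? [? ?]. Qed.
Lemma ImM a b : Im (a * b) = Re a * Im b + Im a * Re b.
Proof. by case: a b => ? ? [? ?]. Qed.
Lemma ReJ a : Re (Num.conj a) = Re a. Proof. by case: a. Qed.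
Lemma ImJ a : Im (Num.conj a) = - Im a. Proof. by case: a. Qed.
Lemma eqReIm a b : Re a = Re b -> Im a = Im b -> a = b.
Proof. by case: a b => ? ? [? ?] /= -> ->. Qed.

Definition ReImE := (ReD, ImD, ReN, ImN, ReM, ImM, ReJ, ImJ).

Lemma mulcJ z : z * Num.conj z = (normc z ^+ 2)%:C.
Proof. by rewrite normc_sqr; apply: eqReIm; rewrite !ReImE /=; ring. Qed.

Lemma normc_eq0 z : (normc z == 0) = (z == 0).
Proof. by apply/eqP/eqP => [/eq0_normc //|->]; rewrite normc0. Qed.

Lemma normcN z : normc (- z) = normc z.
Proof. by case: z => x y /=; rewrite !sqrrN. Qed.

Lemma normc_real (x : R) : normc x%:C = `|x|.
Proof. by rewrite /= expr0n addr0 sqrtr_sqr. Qed.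

Lemma normcD a b : normc (a + b) <= normc a + normc b.
Proof.
have : `|a + b| <= `|a| + `|b| by exact: ler_normD.
by rewrite -[X in X <= _]/((normc (a + b))%:C) -[X in _ <= X]/(_%:C + _%:C)
  -rmorphD /= lecR.
Qed.

Lemma normc_sqrB_le a b : normc (a - b) ^+ 2 <= (normc a ^+ 2 + normc b ^+ 2) *+ 2.
Proof.
rewrite !normc_sqr !ReImE.
have := sqr_ge0 (Re a + Re b); have := sqr_ge0 (Im a + Im b); rewrite !expr2; lra.
Qed.

End ComplexParts.

Section L2Theory.
Variables (R : realType) (D : set R) (mD : measurable D).
Local Notation mu := (@lebesgue_measure R).
Implicit Types (u v : R -> R) (f g h : R -> R[i]).

Definition Rintegrable u : Prop := mu.-integrable D (EFin \o u).

Let mD' : measurable (D : set (measurableTypeR R)) := mD.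

Lemma RintegrableD u v : Rintegrable u -> Rintegrable v ->
  Rintegrable (fun x => u x + v x).
Proof. exact: (integrableD mD'). Qed.

Lemma RintegrableZ (a : R) u : Rintegrable u -> Rintegrable (fun x => a * u x).
Proof. exact: (integrableZl mD'). Qed.

Lemma RintegrableN u : Rintegrable u -> Rintegrable (fun x => - u x).
Proof. by move=> /(RintegrableZ (-1)); under eq_fun do rewrite mulN1r. Qed.

Definition sqintegrable u :=
  measurable_fun D u /\ Rintegrable (fun x => u x ^+ 2).

Lemma Rintegrable_le u v : measurable_fun D u -> Rintegrable v ->
  (forall x, D x -> `|u x| <= v x) -> Rintegrable u.
Proof.
move=> mu1 iv uv; apply: (@le_integrable _ _ _ mu _ mD _ (EFin \o v)) => //.
  exact/measurable_EFinP.
by move=> x Dx /=; rewrite lee_fin (le_trans (uv x Dx))// ler_norm.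
Qed.

Lemma sqintegrableM u v : sqintegrable u -> sqintegrable v ->
  Rintegrable (fun x => u x * v x).
Proof.
move=> [mu1 iu] [mv iv].
apply: (@Rintegrable_le _ (fun x => u x ^+ 2 + v x ^+ 2)).
- exact: measurable_funM.
- exact: RintegrableD.
by move=> x Dx; rewrite ler_norml; apply/andP; split; nra.
Qed.

Lemma sqintegrable_lin (a : R) u v : sqintegrable u -> sqintegrable v ->
  sqintegrable (fun x => a * u x + v x).
Proof.
move=> su sv; have iuv := sqintegrableM su sv; case: su sv => mu1 iu [mv iv].
split; first by apply: measurable_funD => //; exact: measurable_funM.
rewrite (_ : (fun x => _) = fun x => a ^+ 2 * u x ^+ 2 +
    (a *+ 2 * (u x * v x) + v x ^+ 2)); last by apply/funext => x /=; ring.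
by do 2?[apply: RintegrableD => //]; exact: RintegrableZ.
Qed.

Lemma sqintegrable0 : sqintegrable (cst 0).
Proof.
split; first exact: measurable_cst.
rewrite /Rintegrable (_ : _ \o _ = cst 0%E); first exact: integrable0.
by apply/funext => x /=; rewrite expr0n.
Qed.

Lemma sqintegrableZ (a : R) u : sqintegrable u -> sqintegrable (fun x => a * u x).
Proof.
move=> su; have := sqintegrable_lin a su sqintegrable0.
by congr sqintegrable; apply/funext => x; rewrite addr0.
Qed.

Lemma sqintegrable_le (M : R) u v : measurable_fun D u -> sqintegrable v ->
  (forall x, D x -> `|u x| <= M * `|v x|) -> sqintegrable u.
Proof.
move=> mu1 [mv iv] uv; split=> //.
apply: (@Rintegrable_le _ (fun x => M ^+ 2 * v x ^+ 2)).
- exact: measurable_funX.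
- exact: RintegrableZ.
move=> x Dx; rewrite normrX -(real_normK (num_real (v x))) -exprMn.
rewrite lerXn2r ?nnegrE//; last exact: uv.
exact: le_trans (uv _ Dx).
Qed.

Lemma measurable_normc_sqr f : measurable_fun D (fun x => Re (f x)) ->
  measurable_fun D (fun x => Im (f x)) ->
  measurable_fun D (fun x => ((normc (f x)) ^+ 2)%:E).
Proof.
move=> mr mi; apply/measurable_EFinP.
rewrite (_ : (fun x => _) = fun x => Re (f x) ^+ 2 + Im (f x) ^+ 2).
  by apply: measurable_funD; exact: measurable_funX.
by apply/funext => x; rewrite normc_sqr.
Qed.

Lemma L2P f : L2 D f <-> sqintegrable (fun x => Re (f x)) /\ sqintegrable (fun x => Im (f x)).
Proof.
split=> [[mr mi fin]|[[mr ir] [mi ii]]].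
  have inf : Rintegrable (fun x => (normc (f x)) ^+ 2).
    apply/integrableP; split; first exact: measurable_normc_sqr.
    rewrite (_ : integral _ _ _ = normsq D f)//.
    by apply: eq_integral => x _ /=; rewrite ger0_norm// sqr_ge0.
  by split; split => //; (apply: (Rintegrable_le _ inf);
    [exact: measurable_funX|
     move=> x Dx; rewrite normc_sqr ger0_norm ?sqr_ge0//;
       rewrite ?lerDl ?lerDr sqr_ge0]).
split=> //; rewrite /normsq.
have /integrableP[_] := RintegrableD ir ii.
apply: le_lt_trans; apply: ge0_le_integral => //.
- by move=> x _; rewrite lee_fin sqr_ge0.
- exact: measurable_normc_sqr.
- apply/measurableT_comp => //; apply/measurable_EFinP.
  by apply: measurable_funD; exact: measurable_funX.
- move=> x _ /=; rewrite lee_fin normc_sqr ger0_norm//.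
  by rewrite addr_ge0// sqr_ge0.
Qed.

Lemma L2_lin (a : R[i]) f g : L2 D f -> L2 D g -> L2 D (fun x => a * f x + g x).
Proof.
move=> /L2P[rf jf] /L2P[rg jg]; apply/L2P; split.
  rewrite (_ : (fun x => _) = fun x => Re a * Re (f x) + (- Im a * Im (f x) + Re (g x))).
    by do 2?[apply: sqintegrable_lin => //].
  by apply/funext => x; rewrite !ReImE; ring.
rewrite (_ : (fun x => _) = fun x => Re a * Im (f x) + (Im a * Re (f x) + Im (g x))).
  by do 2?[apply: sqintegrable_lin => //].
by apply/funext => x; rewrite !ReImE; ring.
Qed.

Lemma L2_0 : L2 D (fun=> 0).
Proof. by apply/L2P; split; exact: sqintegrable0. Qed.

Lemma L2Z (a : R[i]) f : L2 D f -> L2 D (fun x => a * f x).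
Proof.
move=> Lf; have := L2_lin a Lf L2_0.
by congr (L2 D); apply/funext => x; rewrite addr0.
Qed.

Lemma L2D f g : L2 D f -> L2 D g -> L2 D (fun x => f x + g x).
Proof.
move=> Lf Lg; have := L2_lin 1 Lf Lg.
by congr (L2 D); apply/funext => x; rewrite mul1r.
Qed.

Lemma L2B f g : L2 D f -> L2 D g -> L2 D (fun x => f x - g x).
Proof.
move=> Lf Lg; have := L2_lin (-1) Lg Lf.
by congr (L2 D); apply/funext => x; rewrite mulN1r addrC.
Qed.

Lemma L2_sum (I : eqType) (s : seq I) (F : I -> R -> R[i]) :
  (forall i, i \in s -> L2 D (F i)) -> L2 D (fun x => \sum_(i <- s) F i x).
Proof.
elim: s => [_|i s ih Fs].
  by rewrite (_ : (fun x => _) = fun=> 0);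
    [exact: L2_0|apply/funext => x; rewrite big_nil].
rewrite (_ : (fun x => _) = fun x => F i x + \sum_(j <- s) F j x); last first.
  by apply/funext => x; rewrite big_cons.
apply: L2D; first by apply: Fs; rewrite mem_head.
by apply: ih => j js; apply: Fs; rewrite inE js orbT.
Qed.

Lemma eq_L2 f g : (forall x, D x -> f x = g x) -> L2 D f -> L2 D g.
Proof.
move=> fg [mr mi fin]; split.
- by apply: eq_measurable_fun mr => x /set_mem Dx; rewrite fg.
- by apply: eq_measurable_fun mi => x /set_mem Dx; rewrite fg.
- rewrite (_ : normsq D g = normsq D f)//.
  by apply: eq_integral => x /set_mem Dx; rewrite fg.
Qed.

Definition cmeasurable f :=
  measurable_fun D (fun x => Re (f x)) /\ measurable_fun D (fun x => Im (f x)).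

Lemma cmeasurableM f g : cmeasurable f -> cmeasurable g ->
  cmeasurable (fun x => f x * g x).
Proof.
move=> [a b] [c d]; split.
  rewrite (_ : (fun x => _) = fun x => Re (f x) * Re (g x) - Im (f x) * Im (g x)).
    by apply: measurable_funB; exact: measurable_funM.
  by apply/funext => x; rewrite ReM.
rewrite (_ : (fun x => _) = fun x => Re (f x) * Im (g x) + Im (f x) * Re (g x)).
  by apply: measurable_funD; exact: measurable_funM.
by apply/funext => x; rewrite ImM.
Qed.

Lemma Re_le_normc (z : R[i]) : `|Re z| <= normc z.
Proof.
by case: z => x y /=; rewrite -[X in X <= _]sqrtr_sqr ler_wsqrtr// lerDl sqr_ge0.
Qed.

Lemma Im_le_normc (z : R[i]) : `|Im z| <= normc z.
Proof.
by case: z => x y /=; rewrite -[X in X <= _]sqrtr_sqr ler_wsqrtr// lerDr sqr_ge0.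
Qed.

Lemma L2_cmeasurable f : L2 D f -> cmeasurable f. Proof. by case. Qed.

Lemma sqintegrable_normc f : L2 D f -> sqintegrable (fun x => normc (f x)).
Proof.
move=> /L2P[[mr ir] [mi ii]]; split; last first.
  rewrite (_ : (fun x => _) = fun x => Re (f x) ^+ 2 + Im (f x) ^+ 2).
    exact: RintegrableD.
  by apply/funext => x /=; rewrite normc_sqr.
rewrite (_ : (fun x => _) = fun x => Num.sqrt (Re (f x) ^+ 2 + Im (f x) ^+ 2)).
  apply: (measurableT_comp (f := @Num.sqrt R)).
    by apply: continuous_measurable_fun; exact: sqrt_continuous.
  by apply: measurable_funD; exact: measurable_funX.
by apply/funext => x /=; case: (f x).
Qed.

Lemma L2_dom (M : R) f g : cmeasurable f -> L2 D g ->
  (forall x, D x -> normc (f x) <= M * normc (g x)) -> L2 D f.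
Proof.
move=> [mr mi] /sqintegrable_normc ng fg; apply/L2P; split.
  apply: (sqintegrable_le (M := M) mr ng) => x Dx.
  rewrite [X in _ <= M * X]ger0_norm ?normc_ge0//.
  exact: le_trans (Re_le_normc _) (fg _ Dx).
apply: (sqintegrable_le (M := M) mi ng) => x Dx.
rewrite [X in _ <= M * X]ger0_norm ?normc_ge0//.
exact: le_trans (Im_le_normc _) (fg _ Dx).
Qed.

Lemma L2M (M : R) f g : cmeasurable f -> (forall x, D x -> normc (f x) <= M) ->
  L2 D g -> L2 D (fun x => f x * g x).
Proof.
move=> mf fM Lg; apply: (L2_dom (M := M) _ Lg).
  by apply: cmeasurableM mf _; exact: L2_cmeasurable.
by move=> x Dx; rewrite normcM ler_wpM2r ?normc_ge0// fM.
Qed.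

Lemma L2_bounded (M : R) f : (mu D < +oo)%E -> cmeasurable f ->
  (forall x, D x -> normc (f x) <= M) -> L2 D f.
Proof.
move=> finD mf fM.
have L1 : L2 D (fun=> 1).
  split; try exact: measurable_cst.
  by rewrite /normsq [normc 1]normc1 expr1n integral_cst// mul1e.
apply: (L2_dom (M := M) mf L1) => x Dx.
by rewrite normc1 mulr1 fM.
Qed.

End L2Theory.

(** * Inner product, squared norm and almost everywhere equality *)

Section Inner.
Variables (R : realType) (D : set R) (mD : measurable D).
Local Notation mu := (@lebesgue_measure R).
Implicit Types (u v : R -> R) (f g h : R -> R[i]).

Lemma RintD u v : Rintegrable D u -> Rintegrable D v ->
  Rintegral mu D (fun x => u x + v x) = Rintegral mu D u + Rintegral mu D v.
Proof. exact: RintegralD. Qed.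

Lemma RintZ (a : R) u : Rintegrable D u ->
  Rintegral mu D (fun x => a * u x) = a * Rintegral mu D u.
Proof. exact: RintegralZl. Qed.

Lemma RintN u : Rintegrable D u ->
  Rintegral mu D (fun x => - u x) = - Rintegral mu D u.
Proof. by move=> iu; under eq_fun do rewrite -mulN1r; rewrite RintZ// mulN1r. Qed.

Definition cintegrable f :=
  Rintegrable D (fun x => Re (f x)) /\ Rintegrable D (fun x => Im (f x)).

Lemma cintegral_lin (a : R[i]) f g : cintegrable f -> cintegrable g ->
  cintegral D (fun x => a * f x + g x) = a * cintegral D f + cintegral D g.
Proof.
move=> [rf jf] [rg jg]; apply: eqReIm; rewrite !ReImE /=.
  rewrite -(RintZ _ rf) -(RintZ _ jf) -RintN; last exact: RintegrableZ.
  rewrite -RintD; [|exact: RintegrableZ|apply: RintegrableN => //; exact: RintegrableZ].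
  rewrite -RintD//; last first.
    by apply: RintegrableD => //; [exact: RintegrableZ|apply: RintegrableN => //; exact: RintegrableZ].
  by congr (Rintegral _ _ _); apply/funext => x; rewrite !ReImE.
rewrite -(RintZ _ rf) -(RintZ _ jf).
rewrite -RintD; [|exact: RintegrableZ|exact: RintegrableZ].
rewrite -RintD//; last by apply: RintegrableD => //; exact: RintegrableZ.
by congr (Rintegral _ _ _); apply/funext => x; rewrite !ReImE.
Qed.

Lemma L2_cintegrableM f g : L2 D f -> L2 D g ->
  cintegrable (fun x => f x * Num.conj (g x)).
Proof.
move=> /L2P-/(_ mD)[rf jf] /L2P-/(_ mD)[rg jg]; split.
  under eq_fun do rewrite !ReImE mulrN opprK.
  by apply: RintegrableD => //; exact: sqintegrableM.
under eq_fun do rewrite !ReImE mulrN.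
by apply: RintegrableD => //; [apply: RintegrableN => //|]; exact: sqintegrableM.
Qed.

Lemma inner_linl (a : R[i]) f g h : L2 D f -> L2 D g -> L2 D h ->
  inner D (fun x => a * f x + g x) h = a * inner D f h + inner D g h.
Proof.
move=> Lf Lg Lh; rewrite /inner -cintegral_lin; try exact: L2_cintegrableM.
by congr cintegral; apply/funext => x; rewrite mulrDl mulrA.
Qed.

Lemma cintegralJ f : cintegrable f ->
  Num.conj (cintegral D f) = cintegral D (fun x => Num.conj (f x)).
Proof.
move=> [rf jf]; apply: eqReIm; rewrite !ReImE /=.
  by congr (Rintegral _ _ _); apply/funext => x; rewrite !ReImE.
rewrite -RintN//.
by congr (Rintegral _ _ _); apply/funext => x; rewrite !ReImE.
Qed.

Lemma innerC f g : L2 D f -> L2 D g -> inner D g f = Num.conj (inner D f g).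
Proof.
move=> Lf Lg; rewrite /inner cintegralJ; last exact: L2_cintegrableM.
congr cintegral; apply/funext => x.
by rewrite rmorphM /= conjCK mulrC.
Qed.

Lemma inner0l h : inner D (fun=> 0) h = 0.
Proof.
rewrite /inner /cintegral.
under [X in Rintegral _ _ X]eq_fun do rewrite mul0r.
under [X in _ +i* Rintegral _ _ X]eq_fun do rewrite mul0r.
by rewrite /= /Rintegral !integral0.
Qed.

Lemma innerZl (a : R[i]) f h : L2 D f -> L2 D h ->
  inner D (fun x => a * f x) h = a * inner D f h.
Proof.
move=> Lf Lh; have := inner_linl a Lf (L2_0 mD) Lh.
by rewrite inner0l addr0; under eq_fun do rewrite addr0.
Qed.

Lemma innerDl f g h : L2 D f -> L2 D g -> L2 D h ->
  inner D (fun x => f x + g x) h = inner D f h + inner D g h.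
Proof.
move=> Lf Lg Lh; have := inner_linl 1 Lf Lg Lh.
by rewrite mul1r; under eq_fun do rewrite mul1r.
Qed.

Lemma innerBl f g h : L2 D f -> L2 D g -> L2 D h ->
  inner D (fun x => f x - g x) h = inner D f h - inner D g h.
Proof.
move=> Lf Lg Lh; have := inner_linl (-1) Lg Lf Lh.
by rewrite mulN1r addrC; under eq_fun do rewrite mulN1r addrC.
Qed.

Lemma innerZr (a : R[i]) f h : L2 D f -> L2 D h ->
  inner D f (fun x => a * h x) = Num.conj a * inner D f h.
Proof.
move=> Lf Lh; rewrite innerC//; last exact: L2Z.
by rewrite innerZl// rmorphM /= -innerC.
Qed.

Lemma innerDr f g h : L2 D f -> L2 D g -> L2 D h ->
  inner D h (fun x => f x + g x) = inner D h f + inner D h g.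
Proof.
move=> Lf Lg Lh; rewrite innerC//; last exact: L2D.
by rewrite innerDl// rmorphD /= -!innerC.
Qed.

Lemma innerBr f g h : L2 D f -> L2 D g -> L2 D h ->
  inner D h (fun x => f x - g x) = inner D h f - inner D h g.
Proof.
move=> Lf Lg Lh; rewrite innerC//; last exact: L2B.
by rewrite innerBl// rmorphB /= -!innerC.
Qed.

Lemma inner_suml (I : eqType) (s : seq I) (F : I -> R -> R[i]) h :
  (forall i, i \in s -> L2 D (F i)) -> L2 D h ->
  inner D (fun x => \sum_(i <- s) F i x) h = \sum_(i <- s) inner D (F i) h.
Proof.
move=> LF Lh; elim: s LF => [_|i s ih LF].
  transitivity (inner D (fun=> 0) h); last by rewrite inner0l big_nil.
  by congr (inner D _ h); apply/funext => x; rewrite big_nil.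
have Ls : forall j, j \in s -> L2 D (F j) by move=> j js; apply: LF; rewrite inE js orbT.
rewrite big_cons -ih// -innerDl//; last exact: L2_sum.
  by congr inner; apply/funext => x; rewrite big_cons.
by apply: LF; rewrite mem_head.
Qed.

Lemma inner_sumr (I : eqType) (s : seq I) (F : I -> R -> R[i]) h :
  (forall i, i \in s -> L2 D (F i)) -> L2 D h ->
  inner D h (fun x => \sum_(i <- s) F i x) = \sum_(i <- s) inner D h (F i).
Proof.
move=> LF Lh; rewrite innerC//; last exact: L2_sum.
rewrite inner_suml// rmorph_sum /=; rewrite [LHS]big_seq [RHS]big_seq.
by apply: eq_bigr => i si; rewrite -innerC//; exact: LF.
Qed.

Definition nsq f : R := fine (normsq D f).

Lemma normsq_ge0 f : (0 <= normsq D f)%E.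
Proof. by apply: integral_ge0 => x _; rewrite lee_fin sqr_ge0. Qed.

Lemma nsq_ge0 f : 0 <= nsq f.
Proof. by apply: fine_ge0; exact: normsq_ge0. Qed.

Lemma nsqE f : L2 D f -> normsq D f = (nsq f)%:E.
Proof. by move=> [_ _ fin]; rewrite fineK// ge0_fin_numE// normsq_ge0. Qed.

Lemma inner_nsq f : inner D f f = (nsq f)%:C.
Proof.
apply: eqReIm; rewrite /=.
  rewrite /nsq /normsq /Rintegral; congr fine; apply: eq_integral => x _.
  by congr EFin; rewrite mulcJ.
under [X in Rintegral _ _ X]eq_fun do rewrite mulcJ /=.
by rewrite /Rintegral integral0.
Qed.

Lemma nsqZ (a : R[i]) f : L2 D f -> nsq (fun x => a * f x) = normc a ^+ 2 * nsq f.
Proof.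
move=> Lf; apply: (@complexI R); rewrite -inner_nsq.
by rewrite innerZl ?innerZr// ?inner_nsq ?mulrA ?mulcJ -?rmorphM//; exact: L2Z.
Qed.

Lemma nsqD_expand f g : L2 D f -> L2 D g ->
  nsq (fun x => f x + g x) = nsq f + nsq g + Re (inner D f g) *+ 2.
Proof.
move=> Lf Lg; apply: (@complexI R); rewrite -inner_nsq.
rewrite innerDl ?innerDr//; last exact: L2D.
rewrite (innerC Lf Lg) !inner_nsq.
by apply: eqReIm; rewrite !ReImE /=; ring.
Qed.

Lemma nsqN f : nsq (fun x => - f x) = nsq f.
Proof. by rewrite /nsq /normsq; under eq_integral do rewrite normcN. Qed.

Lemma nsqB_expand f g : L2 D f -> L2 D g ->
  nsq (fun x => f x - g x) = nsq f + nsq g - Re (inner D f g) *+ 2.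
Proof.
move=> Lf Lg; have Lg' : L2 D (fun x => - 1 * g x) by exact: L2Z.
have := nsqD_expand Lf Lg'; under eq_fun do rewrite mulN1r; move=> ->.
rewrite nsqZ// normcN normc1 expr1n mul1r innerZr// rmorphN rmorph1.
by rewrite !ReImE /=; ring.
Qed.

Lemma nsqD_le f g : L2 D f -> L2 D g ->
  nsq (fun x => f x + g x) <= (nsq f + nsq g) *+ 2.
Proof.
move=> Lf Lg; rewrite nsqD_expand//.
have := nsq_ge0 (fun x => f x - g x); rewrite nsqB_expand//; lra.
Qed.

Lemma nsqB_le f g : L2 D f -> L2 D g ->
  nsq (fun x => f x - g x) <= (nsq f + nsq g) *+ 2.
Proof.
move=> Lf Lg; rewrite nsqB_expand//.
have := nsq_ge0 (fun x => f x + g x); rewrite nsqD_expand//; lra.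
Qed.

Lemma nsqBC f g : nsq (fun x => f x - g x) = nsq (fun x => g x - f x).
Proof. by rewrite -nsqN; congr nsq; apply/funext => x; rewrite opprB. Qed.

(** The squared norm of f - t z g is nonnegative for every real t. Putting the inner product z
    itself into the coefficient makes the cross term real, which leaves a real quadratic in t. *)
Lemma cauchy_schwarz f g : L2 D f -> L2 D g ->
  normc (inner D f g) ^+ 2 <= nsq f * nsq g.
Proof.
move=> Lf Lg; set z := inner D f g.
have key (t : R) : 0 <= nsq f + normc z ^+ 2 * (t ^+ 2 * nsq g - t *+ 2).
  have Lzg : L2 D (fun x => (t%:C * z) * g x) by exact: L2Z.
  have := nsq_ge0 (fun x => f x - (t%:C * z) * g x); rewrite nsqB_expand//.
  rewrite nsqZ// innerZr// -/z normcM normc_real.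
  have -> : Re (Num.conj (t%:C * z) * z) = t * normc z ^+ 2.
    by rewrite normc_sqr !ReImE /=; ring.
  by rewrite exprMn real_normK ?num_real//; lra.
have := nsq_ge0 f; have := nsq_ge0 g; rewrite le_eqVlt => /predU1P[g0|g0] f0.
  rewrite -g0 mulr0; rewrite leNgt; apply/negP => z0.
  (* When g has norm zero the expression is affine in t, and this t gives it the negative value -
     nsq f - 2. *)
  have := key ((nsq f + 1) / (normc z ^+ 2)).
  rewrite -g0 mulr0 sub0r => k.
  suff : nsq f + normc z ^+ 2 * - ((nsq f + 1) / normc z ^+ 2 *+ 2) = - (nsq f) - 2 by lra.
  by field; apply: contraTneq z0 => ->; rewrite expr0n ltxx.
have := key (nsq g)^-1.
have -> : nsq f + normc z ^+ 2 * ((nsq g)^-1 ^+ 2 * nsq g - (nsq g)^-1 *+ 2) =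
   (nsq f * nsq g - normc z ^+ 2) / nsq g by field; rewrite gt_eqF.
by rewrite pmulr_lge0 ?invr_gt0// subr_ge0.
Qed.

Lemma normsq_eq0 f : cmeasurable D f -> normsq D f = 0%E -> f = (fun=> 0) %[ae mu in D].
Proof.
move=> [mr mi] f0.
have mf := measurable_normc_sqr mr mi.
have /(ae_eq_integral_abs _ (mD : measurable (D : set (measurableTypeR R))) mf) :
    (\int[mu]_(x in D) `|(normc (f x) ^+ 2)%:E| = 0)%E.
  rewrite -[RHS]f0; apply: eq_integral => x _ /=.
  by rewrite ger0_norm// sqr_ge0.
apply: ae_imp => x /= + Dx => /(_ Dx)[] /eqP.
by rewrite sqrf_eq0 normc_eq0 => /eqP.
Qed.

Lemma nsq_eq0 f : L2 D f -> nsq f = 0 -> f = (fun=> 0) %[ae mu in D].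
Proof.
move=> Lf f0; apply: normsq_eq0; first exact: L2_cmeasurable Lf.
by rewrite nsqE// f0.
Qed.

Lemma ae_nsq_eq0 f : cmeasurable D f -> f = (fun=> 0) %[ae mu in D] -> normsq D f = 0%E.
Proof.
move=> [mr mi] f0.
have mf := measurable_normc_sqr mr mi.
rewrite /normsq (ae_eq_integral (cst 0%E))//; first exact: integral0.
by apply: ae_imp f0 => x /= f0 Dx; rewrite f0// normc0 expr0n.
Qed.

Lemma nsqB_eq0P f g : L2 D f -> L2 D g ->
  nsq (fun x => f x - g x) = 0 <-> f = g %[ae mu in D].
Proof.
move=> Lf Lg; split=> [/(nsq_eq0 (L2B mD Lf Lg))|fg].
  by apply: ae_imp => x /= + Dx => /(_ Dx) /eqP; rewrite subr_eq0 => /eqP.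
rewrite /nsq ae_nsq_eq0//; first exact: L2_cmeasurable (L2B mD Lf Lg).
by apply: ae_imp fg => x /= fg Dx; rewrite fg// subrr.
Qed.

(** The difference f - g has norm zero, so Cauchy-Schwarz kills its inner product with h. *)
Lemma inner_aeql f g h : L2 D f -> L2 D g -> L2 D h -> f = g %[ae mu in D] ->
  inner D f h = inner D g h.
Proof.
move=> Lf Lg Lh fg; apply/eqP; rewrite -subr_eq0 -innerBl//.
have := cauchy_schwarz (L2B mD Lf Lg) Lh.
rewrite (nsqB_eq0P Lf Lg).2// mul0r -normc_eq0 => h0.
by rewrite -sqrf_eq0 eq_le h0 sqr_ge0.
Qed.

Lemma inner_aeqr f g h : L2 D f -> L2 D g -> L2 D h -> f = g %[ae mu in D] ->
  inner D h f = inner D h g.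
Proof.
by move=> Lf Lg Lh fg; rewrite (innerC Lf Lh) (innerC Lg Lh) (inner_aeql Lf Lg Lh fg).
Qed.

Lemma nsq_aeq f g : L2 D f -> L2 D g -> f = g %[ae mu in D] -> nsq f = nsq g.
Proof.
move=> Lf Lg fg; apply: (@complexI R); rewrite -!inner_nsq.
by rewrite (inner_aeql Lf Lg Lf fg) (inner_aeqr Lf Lg Lg fg).
Qed.

(** Polarization: the norms of f + g and f + i g determine the real and imaginary parts. It turns
    preservation of norms into preservation of inner products. *)
Lemma inner_nsq_polar f g : L2 D f -> L2 D g ->
  inner D f g = ((nsq (fun x => f x + g x) - nsq f - nsq g) / 2) +i*
    ((nsq (fun x => f x + 'i%C * g x) - nsq f - nsq g) / 2).
Proof.
move=> Lf Lg; apply: eqReIm => /=.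
  rewrite nsqD_expand// -[LHS]/(Re (inner D f g)); lra.
have Lig : L2 D (fun x => 'i%C * g x) by exact: L2Z.
rewrite nsqD_expand// nsqZ// innerZr//.
have -> : normc ('i%C : R[i]) = 1 by rewrite /= expr0n add0r expr1n sqrtr1.
rewrite -[LHS]/(Im (inner D f g)) !ReImE /=; lra.
Qed.

End Inner.

(** * Orthonormal bases and isometries *)

Lemma le_eps_eq0 (R : realType) (x M : R) : 0 <= x ->
  (forall e, 0 < e -> x <= M * e) -> x = 0.
Proof.
move=> x0 xe; apply/eqP; rewrite eq_le x0 andbT; apply/ler_addgt0Pl => e e0.
(* The sign of [M] is unknown, hence division by [|M| + 1]. *)
rewrite addr0; have M1 : 0 < `|M| + 1 by rewrite ltr_wpDl.
apply: (le_trans (xe (e / (`|M| + 1)) _)); first by rewrite divr_gt0.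
rewrite mulrA ler_pdivrMr// mulrC ler_pM2l//.
by rewrite (le_trans (ler_norm _))// lerDl.
Qed.

Section OrthonormalBasis.
Variables (R : realType) (D : set R) (mD : measurable D).
Variables (J : set R) (phi : R -> R -> R[i]).
Hypothesis onb : orthonormal_basis D J phi.
Local Notation mu := (@lebesgue_measure R).
Local Notation nsq := (nsq D).
Implicit Types (f g h : R -> R[i]) (s t : seq R).

Let L2phi j : J j -> L2 D (phi j). Proof. by case: onb => + _ _; apply. Qed.

Definition fourier_sum s f x := \sum_(j <- s) inner D f (phi j) * phi j x.

Let L2comb s (c : R -> R[i]) : (forall j, j \in s -> J j) ->
  L2 D (fun x => \sum_(j <- s) c j * phi j x).
Proof. by move=> sJ; apply: L2_sum => // j /sJ /L2phi; exact: L2Z. Qed.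

Lemma L2_fourier_sum s f : (forall j, j \in s -> J j) -> L2 D (fourier_sum s f).
Proof. exact: L2comb. Qed.

Lemma inner_fourier_sum s f h : (forall j, j \in s -> J j) -> L2 D f -> L2 D h ->
  inner D (fourier_sum s f) h =
  \sum_(j <- s) inner D f (phi j) * Num.conj (inner D h (phi j)).
Proof.
move=> sJ Lf Lh; rewrite /fourier_sum inner_suml//; last first.
  by move=> j /sJ /L2phi Lj; exact: L2Z.
rewrite big_seq [RHS]big_seq; apply: eq_bigr => j /sJ /L2phi Lj.
by rewrite innerZl// (innerC mD Lh Lj).
Qed.

Lemma inner_fourier_sum_phi s f j : uniq s -> (forall k, k \in s -> J k) ->
  L2 D f -> j \in s -> inner D (fourier_sum s f) (phi j) = inner D f (phi j).
Proof.
move=> us sJ Lf js; have Jj := sJ _ js; rewrite inner_fourier_sum//; last exact: L2phi.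
have [_ orth _] := onb.
rewrite (bigD1_seq j)//= orth// eqxx rmorph1 mulr1 big_seq_cond big1 ?addr0//.
move=> k /andP[ks kj]; rewrite orth//; last exact: sJ.
by rewrite -[_ == _]/(j == k) eq_sym (negbTE kj) rmorph0 mulr0.
Qed.

(* The partial Fourier sum is the orthogonal projection on the span. *)
Lemma fourier_sum_best s t f (c : R -> R[i]) : uniq s -> (forall k, k \in s -> J k) ->
  {subset t <= s} -> L2 D f ->
  nsq (fun x => f x - fourier_sum s f x) <= nsq (fun x => f x - \sum_(j <- t) c j * phi j x).
Proof.
move=> us sJ ts Lf; have tJ j : j \in t -> J j by move/ts; exact: sJ.
set q := fun x => \sum_(j <- t) c j * phi j x.
have Lq : L2 D q by exact: L2comb.
have Lp := L2_fourier_sum f sJ.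
have Lr := L2B mD Lf Lp.
have orth0 j : j \in s -> inner D (fun x => f x - fourier_sum s f x) (phi j) = 0.
  move=> js; rewrite innerBl//; last exact/L2phi/sJ.
  by rewrite inner_fourier_sum_phi// subrr.
have -> : (fun x => f x - q x) =
    fun x => (f x - fourier_sum s f x) + (fourier_sum s f x - q x).
  by apply/funext => x; rewrite addrA subrK.
rewrite [X in _ <= X]nsqD_expand//; last exact: (L2B mD Lp Lq).
rewrite innerBr// {1}/fourier_sum /q !inner_sumr//; first last.
- by move=> j /sJ /L2phi Lj; exact: L2Z.
- by move=> j /tJ /L2phi Lj; exact: L2Z.
rewrite big_seq big1 => [|j js]; last by rewrite innerZr ?orth0 ?mulr0//; exact/L2phi/sJ.
rewrite big_seq big1 => [|j js]; last by rewrite innerZr ?orth0 ?mulr0//; [exact: ts|exact/L2phi/tJ].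
by rewrite subrr /= mul0rn addr0 lerDl nsq_ge0.
Qed.

(** The best approximation property makes the bound persist for every larger set of frequencies. Two
    functions can therefore share one finite set, as the next lemma needs. *)
Lemma fourier_sum_approx f e : L2 D f -> 0 < e ->
  exists2 s, uniq s /\ (forall j, j \in s -> J j) &
    forall s', uniq s' -> (forall j, j \in s' -> J j) -> {subset s <= s'} ->
      nsq (fun x => f x - fourier_sum s' f x) < e.
Proof.
move=> Lf e0; have [_ _ /(_ _ Lf _ e0)[t [c [tJ fe]]]] := onb.
exists (undup t); first by split; [exact: undup_uniq|move=> j; rewrite mem_undup; exact: tJ].
move=> s' us s'J sub; apply: le_lt_trans (@fourier_sum_best s' t f c us s'J _ Lf) _.
  by move=> j jt; apply: sub; rewrite mem_undup.
by rewrite -lte_fin -nsqE//; apply: L2B => //; exact: L2comb.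
Qed.

Lemma fourier_sum_approx2 f g e : L2 D f -> L2 D g -> 0 < e ->
  exists2 s, uniq s /\ (forall j, j \in s -> J j) &
    nsq (fun x => f x - fourier_sum s f x) < e /\
    nsq (fun x => g x - fourier_sum s g x) < e.
Proof.
move=> Lf Lg e0.
have [s [us sJ] sf] := fourier_sum_approx Lf e0.
have [t [ut tJ] tg] := fourier_sum_approx Lg e0.
have uJ j : j \in undup (s ++ t) -> J j.
  by rewrite mem_undup mem_cat => /orP[/sJ|/tJ].
exists (undup (s ++ t)); first by rewrite undup_uniq.
split; [apply: sf|apply: tg]; rewrite ?undup_uniq// => j js;
  by rewrite mem_undup mem_cat js ?orbT.
Qed.

Lemma onb_orth0 f : L2 D f -> (forall j, J j -> inner D f (phi j) = 0) -> nsq f = 0.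
Proof.
move=> Lf f0; apply: (le_eps_eq0 (M := 1)); first exact: nsq_ge0.
move=> e e0; have [s [us sJ] /(_ s us sJ)] := fourier_sum_approx Lf e0.
move=> /(_ (fun _ => id)); rewrite mul1r.
have -> : (fun x => f x - fourier_sum s f x) = f; last exact: ltW.
apply/funext => x; rewrite /fourier_sum big_seq big1 ?subr0// => j /sJ /f0 ->.
by rewrite mul0r.
Qed.

(** A form of Parseval's identity. Subtracting Fourier sums of [f] and [u] over a common set changes
    both inner products by the same amount, term by term, and leaves remainders that Cauchy-Schwarz
    makes small. *)
Lemma onb_inner_eq f g u v : L2 D f -> L2 D g -> L2 D u -> L2 D v ->
  (forall j, J j -> inner D f (phi j) * Num.conj (inner D g (phi j)) =
     inner D u (phi j) * Num.conj (inner D v (phi j))) ->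
  inner D f g = inner D u v.
Proof.
move=> Lf Lg Lu Lv fguv; apply/eqP; rewrite -subr_eq0 -normc_eq0 -sqrf_eq0.
apply/eqP; apply: (le_eps_eq0 (M := (nsq g + nsq v) *+ 2)); first exact: sqr_ge0.
move=> e e0; have [s [us sJ] [fs us']] := fourier_sum_approx2 Lf Lu e0.
have Lps h := L2_fourier_sum h sJ.
have -> : inner D f g - inner D u v =
  inner D (fun x => f x - fourier_sum s f x) g -
  inner D (fun x => u x - fourier_sum s u x) v.
  rewrite !innerBl// !inner_fourier_sum//.
  rewrite [X in _ - X - _](_ : _ = \sum_(j <- s) inner D u (phi j) * Num.conj (inner D v (phi j))).
    by ring.
  by rewrite big_seq [RHS]big_seq; apply: eq_bigr => j /sJ; exact: fguv.
apply: (le_trans (normc_sqrB_le _ _)).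
have ag := cauchy_schwarz mD (L2B mD Lf (Lps f)) Lg.
have bv := cauchy_schwarz mD (L2B mD Lu (Lps u)) Lv.
rewrite mulrnAl lerMn2r /= mulrDl ![_ * e]mulrC; apply: (le_trans (lerD ag bv)).
exact: (lerD (ler_wpM2r (nsq_ge0 D g) (ltW fs)) (ler_wpM2r (nsq_ge0 D v) (ltW us'))).
Qed.

(** Weaker on its face than [unitary_operator]: norms in place of inner products, and no
    surjectivity. This is all that can be verified pointwise for the explicit formulas; the rest
    follows from the action on the basis. *)
Definition isometry (V : (R -> R[i]) -> (R -> R[i])) :=
  [/\ forall f, L2 D f -> L2 D (V f),
      forall (a : R[i]) f g, L2 D f -> L2 D g ->
        V (fun x => a * f x + g x) = (fun x => a * V f x + V g x) %[ae mu in D] &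
      forall f, L2 D f -> nsq (V f) = nsq f].

Lemma isometry_nsqB V f g : isometry V -> L2 D f -> L2 D g ->
  nsq (fun x => V f x - V g x) = nsq (fun x => f x - g x).
Proof.
move=> [VL Vlin Vn] Lf Lg; rewrite -(Vn _ (L2B mD Lf Lg)).
have LV := VL _ (L2B mD Lf Lg).
apply: nsq_aeq => //; first by apply: L2B => //; exact: VL.
have := Vlin (-1) g f Lg Lf.
rewrite (_ : (fun x => -1 * g x + f x) = fun x => f x - g x); last first.
  by apply/funext => x; rewrite mulN1r addrC.
by apply: ae_imp => x h Dx; rewrite h// mulN1r addrC.
Qed.

(** [V f - V g] has the norm of [f - g], which is zero. *)
Lemma isometry_ae V f g : isometry V -> L2 D f -> L2 D g ->
  f = g %[ae mu in D] -> V f = V g %[ae mu in D].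
Proof.
move=> VI Lf Lg fg; have [VL _ _] := VI.
apply/(nsqB_eq0P mD (VL _ Lf) (VL _ Lg)); rewrite isometry_nsqB//.
exact/(nsqB_eq0P mD Lf Lg).
Qed.

Lemma isometry_comp V W : isometry V -> isometry W -> isometry (V \o W).
Proof.
move=> VI WI; have [VL Vlin Vn] := VI; have [WL Wlin Wn] := WI; split => /=.
- by move=> f /WL /VL.
- move=> a f g Lf Lg; have LWf := WL _ Lf; have LWg := WL _ Lg.
  apply: (ae_imp2 _ _ (Vlin a _ _ LWf LWg)); last first.
    apply: (isometry_ae VI _ _ (Wlin a f g Lf Lg)); first by apply: WL; exact: L2_lin.
    exact: L2_lin.
  by move=> x h1 h2 Dx; rewrite h1// h2.
- by move=> f Lf; rewrite Vn ?Wn//; exact: WL.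
Qed.

Lemma isometry_id : isometry id.
Proof. by split => // a f g _ _; apply: ae_all. Qed.

Lemma isometry_comb V s (c : R -> R[i]) : isometry V -> (forall j, j \in s -> J j) ->
  V (fun x => \sum_(j <- s) c j * phi j x) =
    (fun x => \sum_(j <- s) c j * V (phi j) x) %[ae mu in D].
Proof.
move=> [VL Vlin Vn]; elim: s => [_|i s ih sJ].
  (* For the empty combination, [V] of zero vanishes almost everywhere because its norm is zero. *)
  have := nsq_eq0 mD (VL _ (L2_0 mD)).
  rewrite Vn; last exact: L2_0.
  have -> : nsq (fun=> 0) = 0.
    by apply: (@complexI R); rewrite -inner_nsq inner0l rmorph0.
  move=> /(_ erefl); rewrite (_ : (fun x => \sum_(j <- [::]) c j * phi j x) = fun=> 0).
    by apply: ae_imp => x h Dx; rewrite h// big_nil.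
  by apply/funext => x; rewrite big_nil.
have {}ih := ih (fun j js => sJ j (mem_behead (s := i :: s) js)).
have LS : L2 D (fun x => \sum_(j <- s) c j * phi j x).
  by apply: L2comb => j js; apply: sJ; rewrite inE js orbT.
rewrite (_ : (fun x => \sum_(j <- i :: s) c j * phi j x) =
    fun x => c i * phi i x + \sum_(j <- s) c j * phi j x); last first.
  by apply/funext => x; rewrite big_cons.
apply: (ae_imp2 _ ih (Vlin (c i) (phi i) _ _ LS)).
  by move=> x h1 h2 Dx; rewrite h2// h1// big_cons.
by apply/L2phi/sJ; rewrite mem_head.
Qed.

Lemma isometry_unique V W : isometry V -> isometry W ->
  (forall j, J j -> V (phi j) = W (phi j) %[ae mu in D]) ->
  forall f, L2 D f -> V f = W f %[ae mu in D].
Proof.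
move=> VI WI VW f Lf; have [VL _ _] := VI; have [WL _ _] := WI.
apply/(nsqB_eq0P mD (VL _ Lf) (WL _ Lf)).
(* With V q = W q for a combination q near f, the difference is (V f - V q) - (W f - W q), of
   squared norm at most 2 (e + e). *)
apply: (le_eps_eq0 (M := 4%:R)); first exact: nsq_ge0.
move=> e e0; have [_ _ /(_ _ Lf _ e0)[t [c [tJ fe]]]] := onb.
set q := fun x => \sum_(j <- t) c j * phi j x.
have Lq : L2 D q by exact: L2comb.
have {}fe : nsq (fun x => f x - q x) < e by rewrite -lte_fin -nsqE//; exact: L2B.
have VWq : V q = W q %[ae mu in D].
  have := isometry_comb c VI tJ; have := isometry_comb c WI tJ.
  have : {ae mu, forall x, forall j : 'I_(size t), D x ->
      V (phi (tnth (in_tuple t) j)) x = W (phi (tnth (in_tuple t) j)) x}.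
    by apply: ae_finite => j; apply: VW; apply: tJ; exact: mem_tnth.
  move=> h1 h2 h3; apply: ae_imp (ae_and h1 (ae_and h2 h3)) => x [a1 [a2 a3]] Dx.
  rewrite (a2 Dx) (a3 Dx) [LHS]big_tnth [RHS]big_tnth; apply: eq_bigr => j _.
  by rewrite (a1 j Dx).
have -> : nsq (fun x => V f x - W f x) =
    nsq (fun x => (V f x - V q x) - (W f x - W q x)).
  apply: nsq_aeq => //; try (apply: L2B => //; try (apply: L2B => //); by [apply: VL|apply: WL]).
  by apply: ae_imp VWq => x h Dx; rewrite h//; ring.
apply: le_trans (nsqB_le mD _ _) _; try (apply: L2B => //; by [apply: VL|apply: WL]).
rewrite !isometry_nsqB//; move: fe; lra.
Qed.

Lemma isometry_inner V f g : isometry V -> L2 D f -> L2 D g ->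
  inner D (V f) (V g) = inner D f g.
Proof.
move=> [VL Vlin Vn] Lf Lg.
have LVf := VL _ Lf; have LVg := VL _ Lg.
have key (a : R[i]) : nsq (fun x => V f x + a * V g x) = nsq (fun x => f x + a * g x).
  rewrite -[RHS]Vn; last by apply: L2D => //; exact: L2Z.
  apply: nsq_aeq => //; first by apply: L2D => //; exact: L2Z.
    by apply: VL; apply: L2D => //; exact: L2Z.
  have := Vlin a _ _ Lg Lf.
  rewrite (_ : (fun x => a * g x + f x) = fun x => f x + a * g x).
    by apply: ae_imp => x h Dx; rewrite h// addrC.
  by apply/funext => x; rewrite addrC.
rewrite !inner_nsq_polar// !Vn// key.
by have := key 1; under eq_fun do rewrite mul1r; under [in RHS]eq_fun do rewrite mul1r; move=> ->.
Qed.

End OrthonormalBasis.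

(** * Exponentials *)

Section Exponentials.
Variable R : realType.
Implicit Types (x y a b : R) (n : int).
Local Notation mu := (@lebesgue_measure R).

Lemma expi0 : expi (0 : R) = 1.
Proof. by rewrite /expi cos0 sin0. Qed.

Lemma expiD x y : expi (x + y) = expi x * expi y.
Proof. by rewrite /expi cosD sinD; apply: eqReIm; rewrite !ReImE /=; ring. Qed.

Lemma expiN x : expi (- x) = Num.conj (expi x).
Proof. by rewrite /expi cosN sinN. Qed.

Lemma normc_expi x : normc (expi x) = 1.
Proof. by rewrite /expi /= cos2Dsin2 sqrtr1. Qed.

Lemma expiJ x : expi x * Num.conj (expi x) = 1.
Proof. by rewrite mulcJ normc_expi expr1n. Qed.

Lemma expi_neq0 x : expi x != 0.
Proof. by rewrite -normc_eq0 normc_expi oner_neq0. Qed.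

Lemma expipi : expi (pi : R) = -1.
Proof. by rewrite /expi cospi sinpi; apply: eqReIm => //=; rewrite oppr0. Qed.

Lemma expi2pi : expi (2 * pi : R) = 1.
Proof. by rewrite mulrC mulr_natr mulr2n expiD expipi mulrNN mulr1. Qed.

Lemma expi2pin n : expi (2 * pi * n%:~R : R) = 1.
Proof.
have posn (m : nat) : expi (2 * pi * m%:R : R) = 1.
  elim: m => [|m ih]; first by rewrite mulr0 expi0.
  by rewrite -[m.+1%:R]natr1 mulrDr mulr1 expiD ih expi2pi mulr1.
by case: n => m; rewrite ?NegzE ?mulrNz ?mulrN ?expiN -pmulrn posn ?rmorph1.
Qed.

(** By periodicity x is replaced by its fractional part y. If y > 0 then sin (pi y) > 0, while cos
    (2 pi y) = 1 - 2 sin^2 (pi y) = 1 forces it to vanish. *)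
Lemma expi2pi_eq1 x : expi (2 * pi * x) = 1 <-> x \is a Num.int.
Proof.
split=> [|/intrP[n ->]]; last exact: expi2pin.
have [fx0 fx1] : 0 <= x - (Num.floor x)%:~R /\ x - (Num.floor x)%:~R < 1.
  by rewrite subr_ge0 floor_le_tmp ltrBlDl -[X in _ + X]/(1%:~R) -intrD floorD1_gt.
have -> : expi (2 * pi * x) = expi (2 * pi * (x - (Num.floor x)%:~R)).
  rewrite (_ : _ * (_ - _) = 2 * pi * x + 2 * pi * (- Num.floor x)%:~R).
    by rewrite expiD expi2pin mulr1.
  by rewrite intrN; ring.
set y := x - _ in fx0 fx1 * => ey.
suff y0 : y = 0 by rewrite -(subrK (Num.floor x)%:~R x) -/y y0 add0r intr_int.
move: fx0; rewrite le_eqVlt => /predU1P[<-//|y0].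
have : 0 < sin (pi * y).
  by apply: sin_gt0_pi; rewrite mulr_gt0 ?pi_gt0//= -[X in _ < X]mulr1 ltr_pM2l ?pi_gt0.
have : cos (2 * pi * y) = 1 by move: ey => [].
rewrite (_ : 2 * pi * y = (pi * y) *+ 2); last by ring.
rewrite cos_mulr2n cos2sin2 => h1 h2.
have : 0 < sin (pi * y) ^+ 2 by rewrite exprn_gt0.
lra.
Qed.

Lemma e_D a b x : e_ (a + b) x = e_ a x * e_ b x.
Proof. by rewrite /e_ -expiD; congr expi; ring. Qed.

Lemma e_DR a x y : e_ a (x + y) = e_ a x * e_ a y.
Proof. by rewrite /e_ -expiD; congr expi; ring. Qed.

Lemma e_N a x : e_ (- a) x = Num.conj (e_ a x).
Proof. by rewrite /e_ -expiN; congr expi; ring. Qed.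

Lemma e_B a b x : e_ (a - b) x = e_ a x * Num.conj (e_ b x).
Proof. by rewrite e_D e_N. Qed.

Lemma e_0 x : e_ 0 x = 1.
Proof. by rewrite /e_ mulr0 mul0r expi0. Qed.

Lemma e_x0 a : e_ a 0 = 1.
Proof. by rewrite /e_ mulr0 expi0. Qed.

Lemma normc_e a x : normc (e_ a x) = 1.
Proof. exact: normc_expi. Qed.

Lemma e_neq0 a x : e_ a x != 0.
Proof. exact: expi_neq0. Qed.

Lemma e_J a x : e_ a x * Num.conj (e_ a x) = 1.
Proof. exact: expiJ. Qed.

Lemma e_eq1 a x : e_ a x = 1 <-> a * x \is a Num.int.
Proof. by rewrite /e_ -mulrA; exact: expi2pi_eq1. Qed.

Lemma e_half : e_ (1 / 2 : R) 1 = -1.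
Proof. by rewrite /e_ -expipi; congr expi; field. Qed.

Lemma e_mulx a x : e_ a x = e_ (a * x) 1.
Proof. by rewrite /e_ mulr1 mulrA. Qed.

Lemma e_eqN1 a x : e_ a x = -1 <-> a * x - 1 / 2 \is a Num.int.
Proof.
rewrite -[a * x - _]mulr1 -e_eq1 e_B -e_mulx e_half; split=> [->|].
  by rewrite rmorphN rmorph1 mulrNN mulr1.
by rewrite rmorphN rmorph1 mulrN mulr1 => <-; rewrite opprK.
Qed.

Lemma continuous_Re_e a : continuous (fun x => Re (e_ a x)).
Proof.
move=> x; apply: (@continuous_comp _ _ _ (fun x => 2 * pi * a * x) cos).
  by apply: cvgMr; exact: cvg_id.
exact: continuous_cos.
Qed.

Lemma continuous_Im_e a : continuous (fun x => Im (e_ a x)).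
Proof.
move=> x; apply: (@continuous_comp _ _ _ (fun x => 2 * pi * a * x) sin).
  by apply: cvgMr; exact: cvg_id.
exact: continuous_sin.
Qed.

Lemma cmeasurable_e (D : set R) a : cmeasurable D (e_ a).
Proof.
split; apply: (measurable_funS measurableT) => //; apply: continuous_measurable_fun.
  exact: continuous_Re_e.
exact: continuous_Im_e.
Qed.

Lemma L2_e (D : set R) a : measurable D -> (mu D < +oo)%E -> L2 D (e_ a).
Proof.
move=> mD finD; apply: (@L2_bounded _ D mD 1) => //; first exact: cmeasurable_e.
by move=> x _; rewrite normc_e.
Qed.

Lemma L2_eM (D : set R) a f : measurable D -> L2 D f -> L2 D (fun x => e_ a x * f x).
Proof.
move=> mD Lf; apply: (@L2M _ D mD 1) => //; first exact: cmeasurable_e.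
by move=> x _; rewrite normc_e.
Qed.

Lemma is_derive_Re_e a x :
  is_derive x (1 : R) (fun y => Re (e_ a y) : R^o) (Re ((2 * pi * a)%:C * 'i%C * e_ a x)).
Proof.
have h : is_derive x (1 : R) (fun y : R => 2 * pi * a * y : R^o) (2 * pi * a).
  have := @is_deriveZ R R^o R^o id (2 * pi * a) x 1 1 (is_derive_id x 1).
  by rewrite /GRing.scale /= mulr1.
have := @is_derive1_comp R cos (fun y : R => 2 * pi * a * y) x _ _ (is_derive_cos _) h.
by move=> /is_derive_eq; apply; rewrite !ReImE /=; ring.
Qed.

Lemma is_derive_Im_e a x :
  is_derive x (1 : R) (fun y => Im (e_ a y) : R^o) (Im ((2 * pi * a)%:C * 'i%C * e_ a x)).
Proof.
have h : is_derive x (1 : R) (fun y : R => 2 * pi * a * y : R^o) (2 * pi * a).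
  have := @is_deriveZ R R^o R^o id (2 * pi * a) x 1 1 (is_derive_id x 1).
  by rewrite /GRing.scale /= mulr1.
have := @is_derive1_comp R sin (fun y : R => 2 * pi * a * y) x _ _ (is_derive_sin _) h.
by move=> /is_derive_eq; apply; rewrite !ReImE /=; ring.
Qed.

Lemma is_derivative_e a x : is_derivative (e_ a) x ((2 * pi * a)%:C * 'i%C * e_ a x).
Proof. by split; [exact: is_derive_Re_e|exact: is_derive_Im_e]. Qed.

End Exponentials.

(** * Diagonal operators and unitary groups *)

Section SpectralOperators.
Variables (R : realType) (D : set R) (mD : measurable D).
Local Notation mu := (@lebesgue_measure R).
Hypothesis finD : (mu D < +oo)%E.
Variable Lambda : set R.
Hypothesis onb : orthonormal_basis D Lambda (@e_ R).
Implicit Types (f g h : R -> R[i]).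

Let Le a : L2 D (e_ a). Proof. exact: L2_e. Qed.

(** The maximal multiplication operator on Fourier coefficients, as a graph: membership of f in the
    domain is the existence of such a g in L2. *)
Definition diagonal_operator f g : Prop :=
  [/\ L2 D f, L2 D g &
      forall l, Lambda l -> inner D g (e_ l) = l%:C * inner D f (e_ l)].

Lemma diagonal_operator_e l : Lambda l ->
  diagonal_operator (e_ l) (fun x => l%:C * e_ l x).
Proof.
move=> Ll; split; [exact: Le|exact: L2Z|move=> k Lk].
rewrite innerZl//; have [_ orth _] := onb; rewrite orth//.
by case: eqVneq => [->//|_]; rewrite !mulr0.
Qed.

Lemma diagonal_operator_lin (a : R[i]) f1 f2 g1 g2 :
  diagonal_operator f1 g1 -> diagonal_operator f2 g2 ->
  diagonal_operator (fun x => a * f1 x + f2 x) (fun x => a * g1 x + g2 x).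
Proof.
move=> [Lf1 Lg1 fg1] [Lf2 Lg2 fg2]; split; try exact: L2_lin.
move=> l Ll; rewrite !inner_linl// fg1// fg2//; ring.
Qed.

Lemma diagonal_operator_ae f1 f2 g1 g2 : L2 D f2 -> L2 D g2 ->
  f1 = f2 %[ae mu in D] -> g1 = g2 %[ae mu in D] ->
  diagonal_operator f1 g1 -> diagonal_operator f2 g2.
Proof.
move=> Lf2 Lg2 f12 g12 [Lf1 Lg1 fg1]; split=> // l Ll.
by rewrite -(inner_aeql mD Lf1 Lf2 (Le l) f12) -(inner_aeql mD Lg1 Lg2 (Le l) g12) fg1.
Qed.

Lemma diagonal_operator_comb (s : seq R) (c : R -> R[i]) :
  (forall l, l \in s -> Lambda l) ->
  diagonal_operator (fun x => \sum_(l <- s) c l * e_ l x)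
    (fun x => \sum_(l <- s) c l * (l%:C * e_ l x)).
Proof.
elim: s => [_|i s ih sL].
  under [fun x => _]eq_fun do rewrite big_nil.
  under [X in diagonal_operator _ X]eq_fun do rewrite big_nil.
  split; try exact: L2_0.
  by move=> l _; rewrite inner0l mulr0.
under [fun x => _]eq_fun do rewrite big_cons.
under [X in diagonal_operator _ X]eq_fun do rewrite big_cons.
apply: diagonal_operator_lin; first by apply/diagonal_operator_e/sL; rewrite mem_head.
by apply: ih => j js; apply: sL; rewrite inE js orbT.
Qed.

(** Symmetry holds coefficient by coefficient because the frequencies are real. Conversely, testing
    an element of the adjoint against the eigenvectors yields exactly the relation between
    coefficients that defines the operator. *)
Lemma diagonal_operator_self_adjoint : self_adjoint D diagonal_operator.
Proof.
split.
  split.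
  - by move=> f g [].
  - exact: diagonal_operator_ae.
  - move=> f g1 g2 [Lf Lg1 fg1] [_ Lg2 fg2]; apply/(nsqB_eq0P mD Lg1 Lg2).
    apply: (onb_orth0 mD onb); first exact: L2B.
    by move=> l Ll; rewrite innerBl// fg1// fg2// subrr.
  - exact: diagonal_operator_lin.
  - move=> f Lf e e0; have [_ _ /(_ _ Lf _ e0)[s [c [sL fe]]]] := onb.
    by do 2!eexists; split; [exact: (diagonal_operator_comb c sL)|].
move=> f g; split=> [[Lf Lg fg]|[Lf Lg adj]].
  split=> // u v [Lu Lv uv]; apply: (onb_inner_eq mD onb) => // l Ll.
  rewrite uv// fg// rmorphM /= (_ : Num.conj l%:C = l%:C); first by ring.
  by apply: eqReIm; rewrite !ReImE //= oppr0.
split=> // l Ll; have := adj _ _ (diagonal_operator_e Ll).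
rewrite innerZl// => /(congr1 Num.conj); rewrite rmorphM /= -!innerC// => <-.
by congr (_ * _); apply: eqReIm; rewrite !ReImE //= oppr0.
Qed.

Lemma spectral_operator_diagonal : spectral_operator D Lambda diagonal_operator.
Proof.
by split; [exact: diagonal_operator_self_adjoint|exact: diagonal_operator_e].
Qed.

Lemma unitary_isometry V : unitary_operator D V -> isometry D V.
Proof.
move=> [VL Vlin Vin _]; split=> // f Lf.
by apply: (@complexI R); rewrite -!inner_nsq Vin.
Qed.

(** Strong continuity on finite combinations, where the group multiplies the coefficient of [e_ l]
    by [e_ l t]. Density extends it in [isometry_group_cvg]. *)
Lemma nsq_translate_cvg (s : seq R) (c : R -> R[i]) (t0 : R) :
  nsq D (fun x => \sum_(l <- s) c l * (e_ l t - e_ l t0) * e_ l x) @[t --> t0] --> 0.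
Proof.
elim: s => [|i s ih].
  rewrite (_ : (fun t => _) = fun=> 0); first exact: cvg_cst.
  apply/funext => t; under [X in nsq _ X]eq_fun do rewrite big_nil.
  by apply: (@complexI R); rewrite -inner_nsq inner0l rmorph0.
have Ls t : L2 D (fun x => \sum_(l <- s) c l * (e_ l t - e_ l t0) * e_ l x).
  by apply: L2_sum => // l _; exact: L2Z.
pose n1 (t : R) := (nsq D (fun x => c i * (e_ i t - e_ i t0) * e_ i x) +
  nsq D (fun x => \sum_(l <- s) c l * (e_ l t - e_ l t0) * e_ l x)) *+ 2.
apply: (@squeeze_cvgr _ _ _ _ (fun=> 0) n1).
- near=> t; rewrite nsq_ge0/=.
  under [X in nsq _ X]eq_fun do rewrite big_cons.
  by apply: nsqD_le => //; exact: L2Z.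
- exact: cvg_cst.
rewrite -[X in _ --> X](mul0rn _ 2) -[X in _ --> X *+ _](addr0 0); apply: cvgMn.
apply: cvgD => //.
have -> : (fun t => nsq D (fun x => c i * (e_ i t - e_ i t0) * e_ i x)) =
  fun t => normc (c i) ^+ 2 * nsq D (e_ i) *
    ((Re (e_ i t) - Re (e_ i t0)) ^+ 2 + (Im (e_ i t) - Im (e_ i t0)) ^+ 2).
  apply/funext => t; rewrite nsqZ// normcM exprMn (normc_sqr (e_ i t - e_ i t0)) !ReImE.
  by ring.
rewrite -[X in _ --> X](mulr0 (normc (c i) ^+ 2 * nsq D (e_ i))).
apply: cvgMr; rewrite -[X in _ --> X](addr0 0).
have sq0 (u : R -> R) : {for t0, continuous u} -> (u t - u t0) ^+ 2 @[t --> t0] --> 0.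
  move=> cu; rewrite -[X in _ --> X](mulr0 0); under eq_fun do rewrite expr2.
  by apply: cvgM; rewrite -[X in _ --> X](subrr (u t0)); apply: cvgB => //; exact: cvg_cst.
apply: cvgD; apply: sq0; [exact: continuous_Re_e|exact: continuous_Im_e].
Unshelve. all: by end_near. Qed.

Section LocalTranslations.
Variable V : R -> (R -> R[i]) -> (R -> R[i]).
Hypothesis Viso : forall t, isometry D (V t).
Hypothesis Ve : forall l t, Lambda l ->
  V t (e_ l) = (fun x => e_ l t * e_ l x) %[ae mu in D].

Let VL t f : L2 D f -> L2 D (V t f).
Proof. by move=> Lf; have [+ _ _] := Viso t; apply. Qed.

Lemma isometry_group_0 f : L2 D f -> V 0 f = f %[ae mu in D].
Proof.
move=> Lf; apply: (isometry_unique mD onb (Viso 0) (isometry_id D) _ Lf) => l Ll.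
by apply: ae_imp (Ve 0 Ll) => x h Dx; rewrite h// e_x0 mul1r.
Qed.

(** Both sides are isometric in f and agree on the basis, since [e_ l (s + t)] is
    [e_ l s * e_ l t]. *)
Lemma isometry_group_D s t f : L2 D f -> V (s + t) f = V s (V t f) %[ae mu in D].
Proof.
move=> Lf; have VI := isometry_comp mD (Viso s) (Viso t).
apply: (isometry_unique mD onb (Viso _) VI _ Lf) => l Ll /=.
have [_ Vlin _] := Viso s.
have h1 := isometry_ae mD (Viso s) (VL _ (Le l)) (L2Z mD _ (Le l)) (Ve t Ll).
(* Homogeneity of [V s], read off from a combination with a single term. *)
have h2 : V s (fun x => e_ l t * e_ l x) = (fun x => e_ l t * V s (e_ l) x) %[ae mu in D].
  have := isometry_comb mD onb (fun=> e_ l t) (Viso s) (s := [:: l]).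
  rewrite (_ : (fun x => \sum_(j <- [:: l]) e_ l t * e_ j x) = fun x => e_ l t * e_ l x).
    move=> /(_ _)/ae_imp; apply => [x + Dx|j]; last by rewrite inE => /eqP ->.
    by move=> ->//; rewrite big_seq1.
  by apply/funext => x; rewrite big_seq1.
apply: ae_imp (ae_and (Ve (s + t) Ll) (ae_and h1 (ae_and h2 (Ve s Ll)))).
move=> x [a1 [a2 [a3 a4]]] Dx; rewrite a1// a2// a3// a4// e_DR; ring.
Qed.

Lemma isometry_group_cvg f t0 : L2 D f ->
  normsq D (fun x => V t f x - V t0 f x) @[t --> t0] --> 0%E.
Proof.
move=> Lf; rewrite (_ : (fun t => _) = fun t => (nsq D (fun x => V t f x - V t0 f x))%:E).
  apply: cvg_EFin; first by near=> t.
  apply/cvgrPdist_le => e e0.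
  (* The constants balance as 2 (2 (e/16 + e/16) + e/4) = e: two errors from replacing f by q, one
     from the continuity on q. *)
  have e8 : 0 < e / 16%:R by rewrite divr_gt0.
  have [_ _ /(_ _ Lf _ e8)[s [c [sL fe]]]] := onb.
  set q := fun x => \sum_(l <- s) c l * e_ l x.
  have Lq : L2 D q by apply: L2_sum => // l _; exact: L2Z.
  have {}fe : nsq D (fun x => f x - q x) < e / 16%:R.
    by rewrite -lte_fin -nsqE//; exact: L2B.
  have e4 : 0 < e / 4%:R by rewrite divr_gt0.
  have /cvgrPdist_lt/(_ _ e4) near_e4 := nsq_translate_cvg s c t0.
  near=> t; rewrite /= sub0r normrN ger0_norm ?nsq_ge0//.
  have Vq : nsq D (fun x => V t q x - V t0 q x) =
      nsq D (fun x => \sum_(l <- s) c l * (e_ l t - e_ l t0) * e_ l x).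
    apply: nsq_aeq => //; first by apply: L2B => //; exact: VL.
      by apply: L2_sum => // l _; exact: L2Z.
    have Ves u : V u q = (fun x => \sum_(l <- s) c l * (e_ l u * e_ l x)) %[ae mu in D].
      have h1 := isometry_comb mD onb c (Viso u) sL.
      have h2 : {ae mu, forall x, forall j : 'I_(size s), D x ->
          V u (e_ (tnth (in_tuple s) j)) x =
          e_ (tnth (in_tuple s) j) u * e_ (tnth (in_tuple s) j) x}.
        by apply: ae_finite => j; apply: Ve; apply: sL; exact: mem_tnth.
      apply: ae_imp2 h1 h2 => x a1 a2 Dx.
      rewrite (a1 Dx) [LHS]big_tnth [RHS]big_tnth; apply: eq_bigr => j _.
      by rewrite (a2 j Dx).
    apply: ae_imp2 (Ves t) (Ves t0) => x a1 a2 Dx.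
    rewrite (a1 Dx) (a2 Dx) -sumrB; apply: eq_bigr => l _; ring.
  have h1 : nsq D (fun x => \sum_(l <- s) c l * (e_ l t - e_ l t0) * e_ l x) < e / 4%:R.
    by rewrite -[ltLHS]ger0_norm ?nsq_ge0// -normrN -sub0r; near: t; exact: near_e4.
  rewrite (_ : (fun x => _) = fun x => ((V t f x - V t q x) - (V t0 f x - V t0 q x)) +
     (V t q x - V t0 q x)); last by apply/funext => x; ring.
  have LB u : L2 D (fun x => V u f x - V u q x) by apply: L2B => //; exact: VL.
  apply: le_trans (nsqD_le mD _ _) _; [exact: L2B| by apply: L2B => //; exact: VL|].
  have := nsqB_le mD (LB t) (LB t0); rewrite !isometry_nsqB// Vq.
  move: (nsq _ _) (nsq _ _) (nsq _ _) h1 fe => x y z.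
  lra.
apply/funext => t; rewrite nsqE//.
by apply: L2B => //; exact: VL.
Unshelve. all: by end_near. Qed.

Lemma isometry_local_translations : local_translations D Lambda V.
Proof.
split; last by move=> l t Ll; exact: Ve.
split.
- move=> t; have [_ Vlin _] := Viso t; split=> //.
  + exact: VL.
  + by move=> f g Lf Lg; exact: isometry_inner.
  (* Surjectivity comes from the group law already proved for isometries. *)
  + move=> g Lg; exists (V (- t) g); split; first exact: VL.
    have := isometry_group_D t (- t) Lg; rewrite subrr => h.
    by apply: ae_imp2 h (isometry_group_0 Lg) => x a1 a2 Dx; rewrite -a1// a2.
- exact: isometry_group_0.
- by move=> *; exact: isometry_group_D.
- by move=> *; exact: isometry_group_cvg.
Qed.

Lemma local_translations_unique U : local_translations D Lambda U ->
  forall f t, L2 D f -> U t f = V t f %[ae mu in D].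
Proof.
move=> [[Uu _ _ _] Ue] f t Lf.
apply: (isometry_unique mD onb (unitary_isometry (Uu t)) (Viso t) _ Lf) => l Ll.
by apply: ae_imp2 (Ue l t Ll) (Ve t Ll) => x a1 a2 Dx; rewrite a1// a2.
Qed.

End LocalTranslations.

End SpectralOperators.

(** * Absolute continuity *)

Section AbsoluteContinuity.
Variable R : realType.
Local Notation mu := (@lebesgue_measure R).
Implicit Types (f g h : R -> R[i]) (a b x y : R).

Lemma le_mu (A B : set R) : measurable A -> measurable B -> A `<=` B -> (mu A <= mu B)%E.
Proof. by move=> mA mB AB; apply: le_measure; rewrite ?inE. Qed.

Lemma is_derive_0_near (u : R -> R) x e : is_derive x (1 : R) (u : R -> R^o) 0 -> 0 < e ->
  exists2 d, 0 < d & forall y, `|y - x| < d -> `|u y - u x| <= e * `|y - x|.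
Proof.
move=> [du vu] e0.
have : h^-1 *: (u (h *: 1 + x) - u x : R^o) @[h --> (0:R)^'] --> (0 : R^o).
  by rewrite -[X in _ --> X]vu; exact: du.
move=> /cvgrPdist_lt/(_ _ e0)[d /= d0 hd]; exists d => // y yx.
have [->|neq] := eqVneq y x; first by rewrite !subrr normr0 mulr0.
have yx0 : y - x != 0 by rewrite subr_eq0.
have := hd (y - x); rewrite /= sub0r normrN => /(_ yx yx0).
rewrite sub0r normrN /GRing.scale /= mulr1 subrK normrM normfV.
by rewrite mulrC ltr_pdivrMr ?normr_gt0// => /ltW.
Qed.

Lemma is_derivative_0_near f x e : is_derivative f x 0 -> 0 < e ->
  exists2 d, 0 < d & forall y, `|y - x| < d -> normc (f y - f x) <= e * `|y - x|.
Proof.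
move=> [dr di] e0; have e2 : 0 < e / 2 by rewrite divr_gt0.
have [d1 d10 h1] := is_derive_0_near dr e2.
have [d2 d20 h2] := is_derive_0_near di e2.
exists (Num.min d1 d2); first by rewrite lt_min d10.
move=> y; rewrite lt_min => /andP[/h1 {}h1 /h2 {}h2].
have -> : f y - f x = (Re (f y - f x))%:C + 'i%C * (Im (f y - f x))%:C.
  by apply: eqReIm; rewrite !ReImE /=; ring.
apply: le_trans (normcD _ _) _; rewrite normcM !normc_real.
have -> : normc ('i%C : R[i]) = 1 by rewrite /= expr0n add0r expr1n sqrtr1.
rewrite mul1r !ReImE; lra.
Qed.

(** Absolute continuity for lists of intervals ordered from right to left, so that a chain can be
    prolonged to the right by adding an interval at its head. *)
Lemma AC_lt a b f : absolutely_continuous_on a b f ->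
  forall e, 0 < e -> exists2 d, 0 < d & forall l : seq (R * R),
    all (fun pq => [&& a < pq.1, pq.1 <= pq.2 & pq.2 < b]) l ->
    pairwise (fun pq rs : R * R => rs.2 <= pq.1) l ->
    \sum_(pq <- l) (pq.2 - pq.1) < d ->
    \sum_(pq <- l) normc (f pq.2 - f pq.1) < e.
Proof.
move=> ac e e0; have [d d0 hd] := ac e e0; exists d => // l /allP lab lpw lsum.
pose z := (0, 0) : R * R.
rewrite (big_nth z) big_mkord.
apply: (hd (size l) (fun i => (nth z l i).1) (fun i => (nth z l i).2)).
- by move=> i; have /and3P[] := lab _ (mem_nth z (ltn_ord i)).
- have key (i j : 'I_(size l)) : (i < j)%N ->
      (nth z l j).2 <= (nth z l i).1 by move=> ij; apply: (pairwiseP z lpw) => //; exact: ltn_ord.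
  move=> i j _ _ [t /= []]; rewrite !in_itv/= => /andP[p1 q1] /andP[p2 q2].
  have [ij|ji|/val_inj//] := ltngtP i j.
    by have := lt_trans (le_lt_trans (key _ _ ij) p1) q2; rewrite ltxx.
  by have := lt_trans (le_lt_trans (key _ _ ji) p2) q1; rewrite ltxx.
- by move: lsum; rewrite (big_nth z) big_mkord.
Qed.

(* A gauge (Cousin) argument: each point has a neighbourhood on which [f] is
   controlled either by its vanishing derivative or, on the exceptional null
   set, by absolute continuity, and a supremum argument chains these. *)
Lemma AC_derivative_0 a b f : absolutely_continuous_on a b f ->
  {ae mu, forall x, a < x < b -> is_derivative f x 0} ->
  forall x y, a < x -> x <= y -> y < b -> f y = f x.
Proof.
move=> ac [N [mN N0 sN]] x y ax xy yb.
apply/eqP; rewrite -subr_eq0 -normc_eq0; apply/eqP.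
apply: (le_eps_eq0 (M := y - x + 1)); first exact: normc_ge0.
move=> e e0; have [d d0 hd] := AC_lt ac e0.
(* Outer regularity: disjoint intervals inside W have total length below the [d] of absolute
   continuity. *)
have [W [oW NW muW]] : exists W : set R, [/\ open W, N `<=` W & (mu W < d%:E)%E].
  have [|W [oW NW WN]] := @lebesgue_regularity_outer R N d mN _ d0.
    by rewrite [X in (X < _)%E](_ : _ = 0%E) ?ltry//; exact: N0.
  exists W; split=> //; rewrite -(setDUK NW).
  have mW : measurable (W : set (measurableTypeR R)) by exact: open_measurable.
  apply: le_lt_trans (measureU2 mu mN (measurableD mW mN)) _.
  by rewrite [X in (X + _)%E](_ : _ = 0%E) ?add0e//; exact: N0.
pose S := [set t | x <= t <= y /\ exists l : seq (R * R),
  [/\ all (fun pq => [&& x <= pq.1, pq.1 <= pq.2 & pq.2 <= t]) l,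
      pairwise (fun pq rs : R * R => rs.2 <= pq.1) l,
      ((\sum_(pq <- l) (pq.2 - pq.1))%:E <= mu (W `&` `]-oo, t[))%E &
      normc (f t - f x) <= e * (t - x) + \sum_(pq <- l) normc (f pq.2 - f pq.1)]].
suff [_ [l [lall lpw lmu lf]]] : S y.
  apply: (le_trans lf); rewrite mulrDl mul1r mulrC lerD2l ltW//; apply: hd => //.
    apply/allP => pq /(allP lall)/and3P[p1 p2 p3].
    by rewrite p2 (lt_le_trans ax)// (le_lt_trans p3).
  rewrite -lte_fin; apply: le_lt_trans lmu _; apply: le_lt_trans muW.
  by apply: le_mu; [apply: measurableI => //; exact: open_measurable|exact: open_measurable|exact: subIsetl].
(* Around s a chain ending just to the left passes to any v just to the right: by adding the
   interval [u, v], which lies in W, if s is exceptional, and by the vanishing derivative at s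
   otherwise. *)
have step s : x <= s <= y -> exists2 eta, 0 < eta &
    forall u v, S u -> u <= s -> s <= v -> s - u < eta -> v - s < eta -> v <= y -> S v.
  move=> /andP[xs sy]; have [sN'|sN'] := pselect (N s).
    have /nbhs_ballP[eta /= eta0 hW] : nbhs s W by apply: open_nbhs_nbhs; split => //; exact: NW.
    exists eta => // u v [/andP[xu uy] [l [lall lpw lmu lf]]] us sv su vs vy.
    have uv := le_trans us sv.
    split; first by rewrite vy (le_trans xu).
    exists ((u, v) :: l); split => /=.
    - rewrite xu uv lexx /=; apply/allP => pq /(allP lall)/and3P[-> -> p3].
      exact: le_trans p3 uv.
    - rewrite lpw andbT; apply/allP => pq /(allP lall)/and3P[_ _].
      by [].
    - rewrite big_cons /= EFinD.
      have -> : W `&` `]-oo, v[ = (W `&` `]-oo, u[) `|` (W `&` `[u, v[).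
        rewrite -setIUr; congr (_ `&` _); apply/seteqP; split=> t /=; rewrite !in_itv/=.
          by move=> tv; case: (ltP t u); [left|right].
        by case=> [tu|/andP[]//]; exact: lt_le_trans tu uv.
      rewrite measureU //; first last.
      + apply/seteqP; split=> // t /= [[_ +] [_ ]]; rewrite !in_itv/= => tu /andP[ut _].
        by move: tu; rewrite ltNge ut.
      + by apply: measurableI => //; exact: open_measurable.
      + by apply: measurableI => //; exact: open_measurable.
      rewrite addeC; apply: leeD => //.
      have -> : W `&` `[u, v[ = `[u, v[%classic.
        apply/setIidr => t /=; rewrite in_itv/= => /andP[ut tv]; apply: hW.
        by rewrite /ball /= ltr_norml; apply/andP; split; lra.
      rewrite -[X in (_ <= X)%E]/(mu `[u, v[%classic).
      rewrite lebesgue_measure_itv /= lte_fin; case: ltP => [|vu]; first by rewrite -EFinB.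
      by rewrite lee_fin subr_le0.
    - rewrite big_cons /=.
      have -> : f v - f x = (f v - f u) + (f u - f x) by ring.
      apply: le_trans (normcD _ _) _.
      have : e * (u - x) <= e * (v - x) by rewrite ler_pM2l// lerD2r.
      lra.
  have ds : is_derivative f s 0.
    have : ~ ~ (a < s < b -> is_derivative f s 0) by move=> h; apply: sN'; exact: sN.
    move=> /contrapT; apply.
    by rewrite (lt_le_trans ax)//= (le_lt_trans sy).
  have [eta eta0 heta] := is_derivative_0_near ds e0.
  exists eta => // u v [/andP[xu uy] [l [lall lpw lmu lf]]] us sv su vs vy.
  have uv := le_trans us sv.
  split; first by rewrite vy (le_trans xu).
  exists l; split => //.
  - by apply/allP => pq /(allP lall)/and3P[-> -> p3]; exact: le_trans p3 uv.
  - apply: le_trans lmu _; apply: le_mu.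
    + by apply: measurableI => //; exact: open_measurable.
    + by apply: measurableI => //; exact: open_measurable.
    + by apply: setIS => t /=; rewrite !in_itv/= => /lt_le_trans; exact.
  - have hv : normc (f v - f s) <= e * (v - s).
      by have := heta v; rewrite !ger0_norm ?subr_ge0//; exact.
    have hu : normc (f s - f u) <= e * (s - u).
      by rewrite -normcN opprB; have := heta u; rewrite !(distrC u) !ger0_norm ?subr_ge0//; exact.
    have -> : f v - f x = (f v - f s) + ((f s - f u) + (f u - f x)) by ring.
    apply: le_trans (normcD _ _) _; have := normcD (f s - f u) (f u - f x).
    lra.
have Sx : S x.
  split; first by rewrite lexx.
  by exists [::]; split => //; rewrite ?big_nil// subrr normc0 subrr mulr0 addr0.
have hS : has_sup S by split; [exists x|exists y => t [/andP[]]].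
have xs : x <= sup S by exact: sup_upper_bound.
have sy : sup S <= y by apply: ge_sup; [exists x|move=> t [/andP[]]].
have [|eta eta0 heta] := step (sup S); first by rewrite xs.
have [u Su us] := sup_adherent eta0 hS.
have us' : u <= sup S by exact: sup_upper_bound.
(* The chain crosses the supremum and reaches v; since v cannot exceed the supremum, the minimum
   defining v must be y. *)
have eta2 : 0 < eta / 2 by rewrite divr_gt0.
pose v := Num.min (sup S + eta / 2) y.
have sv : sup S <= v by rewrite le_min sy andbT; lra.
have Sv : S v.
  have vle : v <= sup S + eta / 2 by rewrite ge_min lexx.
  by apply: (heta u) => //; [lra|lra|rewrite ge_min lexx orbT].
have : v <= sup S by exact: sup_upper_bound.
have [ys|ys] := leP y (sup S + eta / 2).
  by move=> _; rewrite (_ : y = v)// /v (min_idPr ys).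
by rewrite /v (min_idPl (ltW ys)) leNgt ltrDl eta2.
Qed.

End AbsoluteContinuity.

(** * Restriction and additivity over subintervals *)

Section Subsets.
Variable R : realType.
Local Notation mu := (@lebesgue_measure R).
Implicit Types (D E : set R) (f g : R -> R[i]) (a b x y : R).

Lemma L2_subset D E f : measurable D -> measurable E -> E `<=` D -> L2 D f -> L2 E f.
Proof.
move=> mD mE ED [mr mi fin]; split.
- exact: (measurable_funS mD ED mr).
- exact: (measurable_funS mD ED mi).
- apply: le_lt_trans fin; apply: ge0_subset_integral => //.
  exact: measurable_normc_sqr.
  by move=> x _; rewrite lee_fin sqr_ge0.
Qed.

Lemma nsq_subset D E f : measurable D -> measurable E -> E `<=` D -> L2 D f ->
  nsq E f <= nsq D f.
Proof.
move=> mD mE ED Lf; have LE := L2_subset mD mE ED Lf; case: (Lf) => mr mi fin.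
rewrite -lee_fin -!nsqE//; apply: ge0_subset_integral => //.
  exact: measurable_normc_sqr.
by move=> x _; rewrite lee_fin sqr_ge0.
Qed.

Lemma L2_cst D (c : R[i]) : measurable D -> (mu D < +oo)%E -> L2 D (fun=> c).
Proof. by move=> mD finD; apply: (@L2_bounded _ D mD (normc c)) => //; split; exact: measurable_cst. Qed.

Lemma inner_1r D f : inner D f (fun=> 1) = cintegral D f.
Proof. by rewrite /inner; under eq_fun do rewrite rmorph1 mulr1. Qed.

Lemma nsq_1 D : measurable D -> nsq D (fun=> 1) = fine (mu D).
Proof.
by move=> mD; rewrite /nsq /normsq [normc 1]normc1 expr1n integral_cst// mul1e.
Qed.

(** Cauchy-Schwarz against the constant 1. *)
Lemma cintegral_bound D f : measurable D -> (mu D < +oo)%E -> L2 D f ->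
  normc (cintegral D f) ^+ 2 <= fine (mu D) * nsq D f.
Proof.
move=> mD finD Lf; rewrite -inner_1r -nsq_1// mulrC.
by apply: cauchy_schwarz => //; exact: L2_cst.
Qed.

Lemma L2_cintegrable D f : measurable D -> (mu D < +oo)%E -> L2 D f -> cintegrable D f.
Proof.
move=> mD finD Lf; have := L2_cintegrableM mD Lf (L2_cst 1 mD finD).
by under eq_fun do rewrite rmorph1 mulr1.
Qed.

Lemma cintegral_setU D E f : measurable D -> measurable E -> [disjoint D & E] ->
  cintegrable (D `|` E) f -> cintegral (D `|` E) f = cintegral D f + cintegral E f.
Proof. by move=> mD mE DE [rf jf]; apply: eqReIm; rewrite !ReImE /= Rintegral_setU. Qed.

Lemma normsq_setU D E f : measurable D -> measurable E -> [disjoint D & E] ->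
  cmeasurable (D `|` E) f -> normsq (D `|` E) f = (normsq D f + normsq E f)%E.
Proof.
move=> mD mE DE [mr mi]; rewrite /normsq ge0_integral_setU//.
  exact: measurable_normc_sqr.
by move=> x _; rewrite lee_fin sqr_ge0.
Qed.

Lemma L2_setU D E f : measurable D -> measurable E -> [disjoint D & E] ->
  L2 D f -> L2 E f -> L2 (D `|` E) f.
Proof.
move=> mD mE DE [r1 i1 n1] [r2 i2 n2].
have mf : cmeasurable (D `|` E) f by split; apply/(measurable_funU _ mD mE); split.
have [mr mi] := mf; split => //.
by rewrite normsq_setU//; exact: lte_add_pinfty.
Qed.

Lemma cintegral_setU1l a b f : a < b -> cintegrable `]a, b[ f ->
  cintegral `[a, b[ f = cintegral `]a, b[ f.
Proof.
by move=> ab [rf jf]; apply: eqReIm => /=; rewrite Rintegral_itv_obnd_cbnd.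
Qed.

Lemma itvoo_fin a b : (mu `]a, b[%classic < +oo)%E.
Proof. by rewrite lebesgue_measure_itv /= lte_fin; case: ifP => _; rewrite ?ltry// -EFinB ltry. Qed.

Lemma fine_itvoo a b : a <= b -> fine (mu `]a, b[%classic) = b - a.
Proof.
rewrite lebesgue_measure_itv /= lte_fin le_eqVlt => /predU1P[->|->//].
by rewrite ltxx subrr.
Qed.

Lemma itvoo_sub a b x y : a <= x -> y <= b -> `]x, y[ `<=` `]a, b[.
Proof.
move=> ax yb t /=; rewrite !in_itv/= => /andP[xt ty].
by rewrite (le_lt_trans ax)//= (lt_le_trans ty).
Qed.

End Subsets.

(** * Primitives of square-integrable functions *)

Section Primitive.
Variables (R : realType) (a b : R).
Local Notation mu := (@lebesgue_measure R).
Hypothesis ab : a < b.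
Variable phi : R -> R[i].
Hypothesis Lphi : L2 `]a, b[ phi.
Local Notation I := `]a, b[%classic.
Implicit Types (x y : R).

Definition primitive x : R[i] := cintegral `]a, x[ phi.

Let Lsub x y : a <= x -> y <= b -> L2 `]x, y[ phi.
Proof. by move=> ax yb; apply: L2_subset Lphi => //; exact: itvoo_sub. Qed.

Let Nsub x y : a <= x -> y <= b -> nsq `]x, y[ phi <= nsq I phi.
Proof. by move=> ax yb; apply: nsq_subset Lphi => //; exact: itvoo_sub. Qed.

Let Csub x y : a <= x -> y <= b -> cintegrable `]x, y[ phi.
Proof. by move=> ax yb; apply: L2_cintegrable => //; [exact: itvoo_fin|exact: Lsub]. Qed.

Lemma primitive_a : primitive a = 0.
Proof.
rewrite /primitive (_ : `]a, a[%classic = set0); last first.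
  by apply/seteqP; split=> t //=; rewrite in_itv/= => /andP[/lt_trans h /h]; rewrite ltxx.
by rewrite /cintegral !Rintegral_set0.
Qed.

Lemma primitiveB x y : a <= x -> x <= y -> y <= b ->
  primitive y - primitive x = cintegral `]x, y[ phi.
Proof.
rewrite [a <= x]le_eqVlt => /predU1P[<- _ _|ax]; first by rewrite primitive_a subr0.
rewrite le_eqVlt => /predU1P[<- _|xy yb].
  rewrite subrr (_ : `]x, x[%classic = set0); last first.
    by apply/seteqP; split=> t //=; rewrite in_itv/= => /andP[/lt_trans h /h]; rewrite ltxx.
  by rewrite /cintegral !Rintegral_set0.
have E : `]a, y[%classic = `]a, x[ `|` `[x, y[.
  apply/seteqP; split=> t /=; rewrite !in_itv/=.
    by move=> /andP[-> ->]; rewrite andbT; case: (ltP t x); [left|right].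
  by case=> /andP[h1 h2]; [rewrite h1 (lt_trans h2)|rewrite h2 (lt_le_trans ax)].
rewrite /primitive E cintegral_setU//.
- by rewrite addrC addKr cintegral_setU1l//; apply: Csub => //; exact: ltW.
- apply/disj_setPS => t /= []; rewrite !in_itv/= => /andP[_ tx] /andP[xt _].
  by move: tx; rewrite ltNge xt.
- by rewrite -E; exact: Csub.
Qed.

Lemma primitive_bound x y : a <= x -> x <= y -> y <= b ->
  normc (primitive y - primitive x) ^+ 2 <= (y - x) * nsq `]x, y[ phi.
Proof.
move=> ax xy yb; rewrite primitiveB// -fine_itvoo//.
by apply: cintegral_bound => //; [exact: itvoo_fin|exact: Lsub].
Qed.

Lemma primitive_bound_le x y : a <= x -> x <= y -> y <= b ->
  normc (primitive y - primitive x) ^+ 2 <= (y - x) * nsq I phi.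
Proof.
move=> ax xy yb; apply: (le_trans (primitive_bound ax xy yb)).
by rewrite ler_wpM2l ?subr_ge0// Nsub.
Qed.

Lemma sum_nsq_disjoint n (p q : 'I_n -> R) :
  (forall i, [/\ a < p i, p i <= q i & q i < b]) ->
  trivIset setT (fun i => `]p i, q i[%classic) ->
  \sum_(i < n) nsq `]p i, q i[ phi <= nsq I phi.
Proof.
move=> pq tpq; pose F i := `]p i, q i[%classic.
have FI : \big[setU/set0]_(i <- index_enum 'I_n) F i `<=` I.
  rewrite -bigcup_seq => t [i _]; have [h1 h2 h3] := pq i.
  by apply: itvoo_sub; exact: ltW.
have mF : measurable (\big[setU/set0]_(i <- index_enum 'I_n) F i).
  by apply: bigsetU_measurable => i _; exact: measurable_itv.
have mphi : measurable_fun I (fun x => (normc (phi x) ^+ 2)%:E).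
  by case: Lphi => mr mi _; exact: measurable_normc_sqr.
rewrite -lee_fin -sumEFin -nsqE//.
rewrite (eq_bigr (fun i => normsq (F i) phi)); last first.
  move=> i _; rewrite nsqE//; have [h1 h2 h3] := pq i.
  by apply: Lsub; exact: ltW.
rewrite /normsq -(@ge0_integral_bigsetU _ _ _ mu _ F (fun x => (normc (phi x) ^+ 2)%:E))//.
- apply: ge0_subset_integral => //.
- by move=> x _; rewrite lee_fin sqr_ge0.
- by move=> i; exact: measurable_itv.
- exact: index_enum_uniq.
- exact: sub_trivIset tpq.
- by apply: (measurable_funS _ FI mphi); exact: measurable_itv.
- by move=> x _; rewrite lee_fin sqr_ge0.
Qed.

Lemma primitive_AC : absolutely_continuous_on a b primitive.
Proof.
move=> e e0; pose N := nsq I phi.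
have N0 : 0 <= N by exact: nsq_ge0.
(* With total length below e k, the two halves of the estimate are less than (e k) / k / 2 = e / 2
   and at most k N / 2 <= e / 2. Adding 1 keeps the denominator positive. *)
pose k := e / (N + 1).
have k0 : 0 < k by rewrite divr_gt0// ltr_wpDl.
exists (e * k); first by rewrite mulr_gt0.
move=> n p q pq tpq spq.
have pqN := sum_nsq_disjoint pq tpq.
suff : \sum_(i < n) normc (primitive (q i) - primitive (p i)) <=
    (\sum_(i < n) (q i - p i)) / k / 2 + k / 2 * \sum_(i < n) nsq `]p i, q i[ phi.
  move=> /le_lt_trans; apply.
  have h1 : (\sum_(i < n) (q i - p i)) / k < e by rewrite ltr_pdivrMr.
  have h2 : k * \sum_(i < n) nsq `]p i, q i[ phi <= k * N by rewrite ler_pM2l.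
  have h3 : k * N <= e.
    by rewrite /k mulrAC ler_pdivrMr ?ltr_wpDl// ler_pM2l// lerDl.
  lra.
rewrite [in leRHS]mulr_suml [in leRHS]mulr_suml [in leRHS]mulr_sumr -big_split /=.
apply: ler_sum => i _; have [h1 h2 h3] := pq i.
have := primitive_bound (ltW h1) h2 (ltW h3).
set z := normc _; set m := nsq _ _ => hz.
have d0 : 0 <= q i - p i by rewrite subr_ge0.
(* AM-GM: [z <= sqrt (d m)] and [2 sqrt (d m) <= d / k + k m] *)
have m0 : 0 <= m by exact: nsq_ge0.
have D0 : 0 <= (q i - p i) / k by rewrite divr_ge0// ltW.
have E0 : 0 <= k * m by rewrite mulr_ge0// ltW.
have : z ^+ 2 <= ((q i - p i) / k / 2 + k / 2 * m) ^+ 2.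
  apply: (le_trans hz).
  have -> : (q i - p i) * m = ((q i - p i) / k) * (k * m).
    by rewrite mulrA divfK// gt_eqF.
  have := sqr_ge0 ((q i - p i) / k - k * m).
  rewrite (_ : k / 2 * m = k * m / 2); last by ring.
  move: ((q i - p i) / k) (k * m) => A B; rewrite !expr2; lra.
rewrite ler_sqr ?nnegrE ?normc_ge0//.
rewrite (_ : k / 2 * m = k * m / 2); last by ring.
by rewrite addr_ge0// divr_ge0.
Qed.

Let FTC1_real (u : R -> R) : Rintegrable I u ->
  {ae mu, forall x, x \in `]a, b[ ->
    is_derive x (1 : R) (fun y => Rintegral mu `]a, y[ u : R^o) (u x)}.
Proof.
(* Extension by zero gives an integrable function on the whole line, hence a locally integrable one,
   to which the differentiation theorem applies. Near a point of the interval the two primitives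
   coincide. *)
move=> iu; pose v := u \_ I.
have vI t : t \in `]a, b[ -> v t = u t by move=> tI; rewrite /v patchE mem_set.
have iv : Rintegrable setT v.
  rewrite /Rintegrable /v -restrict_EFin.
  by apply/(integrable_restrict mu (measurable_itv `]a, b[) measurableT); rewrite setTI.
have lv : locally_integrable [set: R] v by exact: integrable_locally_restrict.
have hy y : mu.-integrable [set` Interval (BRight a) (BRight y)] (EFin \o v).
  by apply: integrableS iv.
have := FTC1 hy lv; apply: ae_imp => x + xab; rewrite in_itv/= in xab; case/andP: (xab) => ax xb.
move=> /(_ ax)[dv vE].
have Ev y : y \in `]a, b[ -> Rintegral mu [set` Interval (BRight a) (BRight y)] v =
    Rintegral mu `]a, y[ u.
  rewrite in_itv/= => /andP[ay yb].
  rewrite -Rintegral_itv_bndo_bndc.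
    apply: eq_Rintegral => t; rewrite inE /= in_itv/= => /andP[at_ ty].
    by apply: vI; rewrite in_itv/= at_ (lt_trans ty).
  by apply: integrableS iv.
have -> : u x = v x by rewrite vI// in_itv.
rewrite -vE derive1E.
apply: (near_eq_is_derive (f := (fun y => Rintegral mu [set` Interval (BRight a) (BRight y)] v : R^o))); last first.
  by split.
near=> y; apply: Ev; rewrite in_itv/=; apply/andP; split; near: y.
  exact: lt_nbhsr.
exact: lt_nbhsl.
Unshelve. all: by end_near. Qed.

Lemma primitive_derivative :
  {ae mu, forall x, a < x < b -> is_derivative primitive x (phi x)}.
Proof.
have [ir ii] := L2_cintegrable (measurable_itv _) (itvoo_fin a b) Lphi.
apply: ae_imp2 (FTC1_real ir) (FTC1_real ii) => x h1 h2 xab.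
by split; [apply: h1|apply: h2]; rewrite in_itv.
Qed.

End Primitive.

(** * One-sided limits, the fundamental theorem and integration by parts *)

Section FundamentalTheorem.
Variables (R : realType) (a b : R).
Local Notation mu := (@lebesgue_measure R).
Hypothesis ab : a < b.
Local Notation I := `]a, b[%classic.
Implicit Types (x y l : R) (f g F phi : R -> R[i]).

Lemma ACB f g : absolutely_continuous_on a b f -> absolutely_continuous_on a b g ->
  absolutely_continuous_on a b (fun x => f x - g x).
Proof.
move=> acf acg e e0; have e2 : 0 < e / 2 by rewrite divr_gt0.
have [d1 d10 h1] := acf _ e2; have [d2 d20 h2] := acg _ e2.
exists (Num.min d1 d2); first by rewrite lt_min d10.
move=> n p q pq tpq; rewrite lt_min => /andP[s1 s2].
have := h1 n p q pq tpq s1; have := h2 n p q pq tpq s2.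
suff : \sum_(i < n) normc (f (q i) - g (q i) - (f (p i) - g (p i))) <=
  \sum_(i < n) normc (f (q i) - f (p i)) + \sum_(i < n) normc (g (q i) - g (p i)) by lra.
rewrite -big_split; apply: ler_sum => i _ /=.
rewrite (_ : _ - _ - _ = (f (q i) - f (p i)) - (g (q i) - g (p i))); last by ring.
by apply: le_trans (normcD _ _) _; rewrite normcN.
Qed.

Lemma AC_lipschitz (C : R) f : (forall x y, x <= y -> normc (f y - f x) <= C * (y - x)) ->
  absolutely_continuous_on a b f.
Proof.
move=> fC e e0; have C1 : 0 < `|C| + 1 by rewrite ltr_wpDl.
exists (e / (`|C| + 1)); first by rewrite divr_gt0.
move=> n p q pq _; rewrite ltr_pdivlMr// => /(le_lt_trans _); apply.
rewrite mulr_suml; apply: ler_sum => i _; have [_ h _] := pq i.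
apply: le_trans (fC _ _ h) _; rewrite mulrC ler_wpM2l ?subr_ge0//.
by rewrite (le_trans (ler_norm _))// lerDl.
Qed.

Lemma AC_mul (M : R) f g : absolutely_continuous_on a b f ->
  absolutely_continuous_on a b g -> (forall x, a < x < b -> normc (f x) <= M) ->
  (forall x, a < x < b -> normc (g x) <= M) ->
  absolutely_continuous_on a b (fun x => f x * g x).
Proof.
move=> acf acg fM gM e e0; have M1 : 0 < `|M| + 1 by rewrite ltr_wpDl.
have e2 : 0 < e / 2 / (`|M| + 1) by rewrite !divr_gt0.
have [d1 d10 h1] := acf _ e2; have [d2 d20 h2] := acg _ e2.
exists (Num.min d1 d2); first by rewrite lt_min d10.
move=> n p q pq tpq; rewrite lt_min => /andP[s1 s2].
have := h1 n p q pq tpq s1; have := h2 n p q pq tpq s2.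
rewrite !ltr_pdivlMr//.
suff : \sum_(i < n) normc (f (q i) * g (q i) - f (p i) * g (p i)) <=
  (\sum_(i < n) normc (f (q i) - f (p i))) * (`|M| + 1) +
  (\sum_(i < n) normc (g (q i) - g (p i))) * (`|M| + 1) by lra.
rewrite !mulr_suml -big_split; apply: ler_sum => i _ /=; have [p1 p2 p3] := pq i.
rewrite (_ : _ - _ = (f (q i) - f (p i)) * g (q i) + (g (q i) - g (p i)) * f (p i)); last by ring.
have MM : M <= `|M| + 1 by rewrite (le_trans (ler_norm _))// lerDl.
apply: le_trans (normcD _ _) _; rewrite !normcM; apply: lerD; apply: ler_wpM2l; rewrite ?normc_ge0//.
  by rewrite (le_trans _ MM)// gM// p3 (lt_le_trans p1).
by rewrite (le_trans _ MM)// fM// p1 (le_lt_trans p2).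
Qed.

Lemma right_limit_unique f x (l1 l2 : R[i]) : right_limit f x l1 -> right_limit f x l2 -> l1 = l2.
Proof.
move=> [r1 i1] [r2 i2]; apply: eqReIm.
  exact: (cvg_unique (@Rhausdorff R) r1 r2).
exact: (cvg_unique (@Rhausdorff R) i1 i2).
Qed.

Lemma left_limit_unique f x (l1 l2 : R[i]) : left_limit f x l1 -> left_limit f x l2 -> l1 = l2.
Proof.
move=> [r1 i1] [r2 i2]; apply: eqReIm.
  exact: (cvg_unique (@Rhausdorff R) r1 r2).
exact: (cvg_unique (@Rhausdorff R) i1 i2).
Qed.

Lemma right_limit_near f g x (l : R[i]) : (\forall y \near x^'+, f y = g y) ->
  right_limit f x l -> right_limit g x l.
Proof.
move=> fg [r i]; split; [move: r|move: i]; apply: cvg_trans; apply: near_eq_cvg;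
  by apply: filterS fg => y ->.
Qed.

Lemma left_limit_near f g x (l : R[i]) : (\forall y \near x^'-, f y = g y) ->
  left_limit f x l -> left_limit g x l.
Proof.
move=> fg [r i]; split; [move: r|move: i]; apply: cvg_trans; apply: near_eq_cvg;
  by apply: filterS fg => y ->.
Qed.

Lemma right_limit_D f g x (l m : R[i]) : right_limit f x l -> right_limit g x m ->
  right_limit (fun y => f y + g y) x (l + m).
Proof.
move=> [r1 i1] [r2 i2]; split; under eq_fun do rewrite !ReImE; rewrite !ReImE;
  exact: cvgD.
Qed.

Lemma left_limit_D f g x (l m : R[i]) : left_limit f x l -> left_limit g x m ->
  left_limit (fun y => f y + g y) x (l + m).
Proof.
move=> [r1 i1] [r2 i2]; split; under eq_fun do rewrite !ReImE; rewrite !ReImE;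
  exact: cvgD.
Qed.

Lemma right_limit_M f g x (l m : R[i]) : right_limit f x l -> right_limit g x m ->
  right_limit (fun y => f y * g y) x (l * m).
Proof.
move=> [r1 i1] [r2 i2]; split; under eq_fun do rewrite !ReImE; rewrite !ReImE.
  by apply: cvgB; exact: cvgM.
by apply: cvgD; exact: cvgM.
Qed.

Lemma left_limit_M f g x (l m : R[i]) : left_limit f x l -> left_limit g x m ->
  left_limit (fun y => f y * g y) x (l * m).
Proof.
move=> [r1 i1] [r2 i2]; split; under eq_fun do rewrite !ReImE; rewrite !ReImE.
  by apply: cvgB; exact: cvgM.
by apply: cvgD; exact: cvgM.
Qed.

Lemma right_limit_cst x (c : R[i]) : right_limit (fun=> c) x c.
Proof. by split; exact: cvg_cst. Qed.

Lemma left_limit_cst x (c : R[i]) : left_limit (fun=> c) x c.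
Proof. by split; exact: cvg_cst. Qed.

Lemma normc_lt_cvg (T : Type) (H : set_system T) {FH : Filter H} (f : T -> R[i]) (l : R[i]) :
  (forall e, 0 < e -> \forall y \near H, normc (f y - l) <= e) ->
  Re (f y) @[y --> H] --> Re l /\ Im (f y) @[y --> H] --> Im l.
Proof.
move=> fl; split; apply/cvgrPdist_le => e /fl; apply: filterS => y; apply: le_trans.
  by rewrite distrC -ReN -ReD Re_le_normc.
by rewrite distrC -ImN -ImD Im_le_normc.
Qed.

Lemma primitive_right_limit phi : L2 I phi -> right_limit (primitive a phi) a 0.
Proof.
move=> Lphi; apply: normc_lt_cvg => e e0.
have N0 := nsq_ge0 I phi.
have d0 : 0 < e ^+ 2 / (nsq I phi + 1) by rewrite divr_gt0 ?exprn_gt0// ltr_wpDl.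
near=> y; rewrite -ler_sqr ?nnegrE ?normc_ge0 ?(ltW e0)//.
have ay : a < y by near: y; exact: nbhs_right_gt.
have yb : y < b by near: y; exact: nbhs_right_lt.
have := primitive_bound_le Lphi (lexx a) (ltW ay) (ltW yb).
rewrite primitive_a// => /le_trans; apply.
have : y - a < e ^+ 2 / (nsq I phi + 1) by near: y; exact: nbhs_right_ltDr.
rewrite ltr_pdivlMr ?ltr_wpDl//; move/ltW; apply: le_trans.
by rewrite ler_wpM2l ?subr_ge0 ?(ltW ay)// lerDl.
Unshelve. all: by end_near. Qed.

Lemma primitive_left_limit phi : L2 I phi -> left_limit (primitive a phi) b (primitive a phi b).
Proof.
move=> Lphi; apply: normc_lt_cvg => e e0.
have N0 := nsq_ge0 I phi.
have d0 : 0 < e ^+ 2 / (nsq I phi + 1) by rewrite divr_gt0 ?exprn_gt0// ltr_wpDl.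
near=> y; rewrite -ler_sqr ?nnegrE ?normc_ge0 ?(ltW e0)//.
have ay : a < y by near: y; exact: nbhs_left_gt.
have yb : y < b by near: y; exact: nbhs_left_lt.
have := primitive_bound_le Lphi (ltW ay) (ltW yb) (lexx b).
rewrite -normcN opprB => /le_trans; apply.
have : b - y < e ^+ 2 / (nsq I phi + 1) by near: y; exact: nbhs_left_ltBl.
rewrite ltr_pdivlMr ?ltr_wpDl//; move/ltW; apply: le_trans.
by rewrite ler_wpM2l ?subr_ge0 ?(ltW yb)// lerDl.
Unshelve. all: by end_near. Qed.

Lemma is_derivativeB f g x (df dg : R[i]) : is_derivative f x df -> is_derivative g x dg ->
  is_derivative (fun y => f y - g y) x (df - dg).
Proof.
move=> [rf jf] [rg jg]; split.
  by under eq_fun do rewrite !ReImE; rewrite !ReImE; exact: is_deriveB.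
by under eq_fun do rewrite !ReImE; rewrite !ReImE; exact: is_deriveB.
Qed.

Lemma is_derivativeM f g x (df dg : R[i]) : is_derivative f x df -> is_derivative g x dg ->
  is_derivative (fun y => f y * g y) x (f x * dg + df * g x).
Proof.
move=> [rf jf] [rg jg].
have M (u v : R -> R^o) (du dv : R^o) : is_derive x (1 : R) u du -> is_derive x (1 : R) v dv ->
    is_derive x (1 : R) (fun y => u y * v y : R^o) (u x * dv + v x * du).
  by move=> hu hv; have := is_deriveM hu hv.
split; under eq_fun do rewrite !ReImE.
  have := is_deriveB (M _ _ _ _ rf rg) (M _ _ _ _ jf jg).
  by move=> /is_derive_eq; apply; rewrite !ReImE; ring.
have := is_deriveD (M _ _ _ _ rf jg) (M _ _ _ _ jf rg).
by move=> /is_derive_eq; apply; rewrite !ReImE; ring.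
Qed.

(** The difference of f and the primitive is absolutely continuous with derivative zero almost
    everywhere, so [AC_derivative_0] makes it constant; its value is read at the midpoint. *)
Lemma AC_primitive f phi : absolutely_continuous_on a b f -> L2 I phi ->
  {ae mu, forall x, a < x < b -> is_derivative f x (phi x)} ->
  exists c, forall x, a < x < b -> f x = c + primitive a phi x.
Proof.
move=> acf Lphi df; pose G x := f x - primitive a phi x.
have acG : absolutely_continuous_on a b G by apply: ACB => //; exact: primitive_AC.
have dG : {ae mu, forall x, a < x < b -> is_derivative G x 0}.
  apply: ae_imp2 df (primitive_derivative Lphi) => x h1 h2 xab.
  by rewrite -(subrr (phi x)); apply: is_derivativeB; [exact: h1|exact: h2].
have Gc x y : a < x < b -> a < y < b -> G x = G y.
  wlog xy : x y / x <= y.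
    by move=> h xab yab; case: (leP x y) => [xy|/ltW yx]; [exact: h|symmetry; exact: h].
  by move=> /andP[ax _] /andP[_ yb]; symmetry; exact: (AC_derivative_0 acG dG).
exists (G ((a + b) / 2)) => x xab; rewrite -(Gc x)//; first by rewrite /G subrK.
by apply/andP; split; move: ab; lra.
Qed.

(** The endpoint values enter as one-sided limits, because f is constrained only inside the open
    interval. *)
Lemma AC_FTC f phi (fa fb : R[i]) : absolutely_continuous_on a b f -> L2 I phi ->
  {ae mu, forall x, a < x < b -> is_derivative f x (phi x)} ->
  right_limit f a fa -> left_limit f b fb -> cintegral I phi = fb - fa.
Proof.
move=> acf Lphi df ra lb; have [c fc] := AC_primitive acf Lphi df.
have -> : fa = c.
  apply: (right_limit_unique ra); rewrite -[X in right_limit _ _ X]addr0.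
  have := right_limit_D (right_limit_cst a c) (primitive_right_limit Lphi).
  apply: right_limit_near; near=> y; rewrite fc//.
  by apply/andP; split; near: y; [exact: nbhs_right_gt|exact: nbhs_right_lt].
have -> : fb = c + primitive a phi b.
  apply: (left_limit_unique lb).
  have := left_limit_D (left_limit_cst b c) (primitive_left_limit Lphi).
  apply: left_limit_near; near=> y; rewrite fc//.
  by apply/andP; split; near: y; [exact: nbhs_left_gt|exact: nbhs_left_lt].
by rewrite addrAC subrr add0r.
Unshelve. all: by end_near. Qed.

Lemma right_limit_e l x : right_limit (e_ l) x (e_ l x).
Proof.
by split; apply: cvg_at_right_filter; [exact: continuous_Re_e|exact: continuous_Im_e].
Qed.

Lemma left_limit_e l x : left_limit (e_ l) x (e_ l x).
Proof.
by split; apply: cvg_at_left_filter; [exact: continuous_Re_e|exact: continuous_Im_e].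
Qed.

Lemma AC_e l : absolutely_continuous_on a b (e_ l).
Proof.
apply: (@AC_lipschitz (`|2 * pi * l| * 2)) => x y.
rewrite le_eqVlt => /predU1P[->|xy]; first by rewrite !subrr normc0 mulr0.
have lip (u du : R -> R) : (forall z, is_derive z (1 : R) (u : R -> R^o) (du z)) ->
    (forall z, `|du z| <= `|2 * pi * l|) -> `|u y - u x| <= `|2 * pi * l| * (y - x).
  move=> du' dub; have [|c _ ->] := @MVT_segment R u du x y (ltW xy) (fun z _ => du' z).
    apply: continuous_subspaceT => z; apply: differentiable_continuous.
    by apply/derivable1_diffP; have [] := du' z.
  by rewrite normrM [`|y - x|]ger0_norm ?subr_ge0 ?(ltW xy)// ler_wpM2r// subr_ge0 ltW.
have bd (z : R) : normc ((2 * pi * l)%:C * 'i%C * e_ l z) <= `|2 * pi * l|.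
  rewrite !normcM normc_e normc_real mulr1 (_ : normc 'i%C = 1) ?mulr1//.
  by rewrite /= expr0n add0r expr1n sqrtr1.
have -> : e_ l y - e_ l x = (Re (e_ l y - e_ l x))%:C + 'i%C * (Im (e_ l y - e_ l x))%:C.
  by apply: eqReIm; rewrite !ReImE /=; ring.
apply: le_trans (normcD _ _) _; rewrite normcM !normc_real.
have -> : normc ('i%C : R[i]) = 1 by rewrite /= expr0n add0r expr1n sqrtr1.
rewrite mul1r !ReImE mulrAC mulr_natr mulr2n; apply: lerD.
  by apply: (lip _ _ (is_derive_Re_e l)) => z; exact: le_trans (Re_le_normc _) (bd z).
by apply: (lip _ _ (is_derive_Im_e l)) => z; exact: le_trans (Im_le_normc _) (bd z).
Qed.

(** Multiplying instead of dividing by 2 pi i l keeps the frequency zero in the statement. *)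
Lemma cintegral_e l : (2 * pi * l)%:C * 'i%C * cintegral I (e_ l) = e_ l b - e_ l a.
Proof.
have Le : L2 I (e_ l) by apply: L2_e => //; exact: itvoo_fin.
have := cintegral_lin (measurable_itv `]a, b[) ((2 * pi * l)%:C * 'i%C)
  (L2_cintegrable (measurable_itv _) (itvoo_fin a b) Le)
  (L2_cintegrable (measurable_itv _) (itvoo_fin a b) (L2_0 (measurable_itv _))).
rewrite [X in _ = _ + X -> _](_ : _ = 0); last first.
  by apply: eqReIm; rewrite /= /Rintegral integral0.
under [X in cintegral _ X]eq_fun do rewrite addr0.
rewrite addr0 => <-; apply: AC_FTC.
- exact: AC_e.
- exact: L2Z.
- by apply: ae_all => x _; exact: is_derivative_e.
- exact: right_limit_e.
- exact: left_limit_e.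
Qed.

(** Integration by parts: the fundamental theorem for the product of f with [e_ (- l)]. The boundary
    terms are those that the unitary boundary condition will cancel. *)
Lemma AC_inner_e l f g (fa fb : R[i]) : absolutely_continuous_on a b f -> L2 I f -> L2 I g ->
  {ae mu, forall x, a < x < b -> is_derivative f x (g x)} ->
  right_limit f a fa -> left_limit f b fb ->
  inner I g (e_ l) = fb * Num.conj (e_ l b) - fa * Num.conj (e_ l a) +
    (2 * pi * l)%:C * 'i%C * inner I f (e_ l).
Proof.
move=> acf Lf Lg df ra lb; have [c fc] := AC_primitive acf Lg df.
have Le : L2 I (e_ l) by apply: L2_e => //; exact: itvoo_fin.
have Lem h : L2 I h -> L2 I (fun x => h x * e_ (- l) x).
  by move=> Lh; under [X in L2 _ X]eq_fun do rewrite mulrC; exact: L2_eM.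
set K := (2 * pi * l)%:C * 'i%C.
have Lphi : L2 I (fun x => - K * (f x * e_ (- l) x) + g x * e_ (- l) x).
  by apply: L2_lin => //; exact: Lem.
have innerE h : inner I h (e_ l) = cintegral I (fun x => h x * e_ (- l) x).
  by rewrite /inner; under [X in cintegral _ X]eq_fun do rewrite -e_N.
have cint h : L2 I h -> cintegrable I (fun x => h x * e_ (- l) x).
  by move=> Lh; apply: L2_cintegrable => //; [exact: itvoo_fin|exact: Lem].
suff : cintegral I (fun x => - K * (f x * e_ (- l) x) + g x * e_ (- l) x) =
    fb * e_ (- l) b - fa * e_ (- l) a.
  rewrite cintegral_lin//; [|exact: cint|exact: cint].
  rewrite !innerE !e_N => <-; ring.
(* A common bound for f, which is c plus a primitive, and for the exponential, of modulus 1. *)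
pose M := normc c + Num.sqrt ((b - a) * nsq I g) + 1.
apply: AC_FTC.
- apply: (@AC_mul M f (e_ (- l))) => //; first exact: AC_e.
    move=> x xab; rewrite fc//; apply: le_trans (normcD _ _) _.
    rewrite /M -addrA lerD2l; apply: ler_wpDr => //.
    rewrite -[X in X <= _]ger0_norm ?normc_ge0// -sqrtr_sqr; apply: ler_wsqrtr.
    case/andP: xab => ax xb.
    have := primitive_bound_le Lg (lexx a) (ltW ax) (ltW xb).
    rewrite primitive_a// subr0 => /le_trans; apply.
    by rewrite ler_wpM2r ?nsq_ge0// lerD2r ltW.
  by move=> x _; rewrite normc_e /M lerDr addr_ge0 ?normc_ge0 ?sqrtr_ge0.
- exact: Lphi.
- apply: ae_imp df => x h xab.
  have := is_derivativeM (h xab) (is_derivative_e (- l) x).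
  congr is_derivative; rewrite /K (_ : 2 * pi * - l = - (2 * pi * l)); last by ring.
  by rewrite rmorphN; ring.
- by apply: right_limit_M => //; exact: right_limit_e.
- by apply: left_limit_M => //; exact: left_limit_e.
Qed.

End FundamentalTheorem.

(** * Two intervals *)

Section TwoIntervals.
Variables (R : realType) (w rho : R).
Local Notation mu := (@lebesgue_measure R).
Hypotheses (w0 : 0 < w) (w1 : w < 1) (rho0 : 0 < rho).
Local Notation Omega := (two_intervals w rho).
Local Notation I1 := `]0, w[%classic.
Local Notation I2 := `]w + rho, 1 + rho[%classic.
Implicit Types (f g : R -> R[i]) (l m : R).

Lemma measurable_two_intervals : measurable Omega.
Proof. exact: measurableU. Qed.

Lemma two_intervals_disjoint : [disjoint I1 & I2].
Proof.
apply/disj_setPS => t /= []; rewrite !in_itv/= => /andP[_ tw] /andP[wt _].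
by move: w0 rho0; lra.
Qed.

Lemma mu_two_intervals : mu Omega = 1%E.
Proof.
have -> : mu Omega = (mu I1 + mu I2)%E.
  by apply: measureU => //; apply/eqP; have := two_intervals_disjoint; rewrite disj_set2E.
rewrite !lebesgue_measure_itv /= !lte_fin w0 ltrD2r w1.
by rewrite -!EFinD; congr EFin; ring.
Qed.

Lemma two_intervals_fin : (mu Omega < +oo)%E.
Proof. by rewrite mu_two_intervals ltry. Qed.

Lemma is_spectrum_onb Lambda :
  is_spectrum Omega Lambda <-> orthonormal_basis Omega Lambda (@e_ R).
Proof.
rewrite /is_spectrum mu_two_intervals /= sqrtr1 invr1.
suff -> : (fun l x => (1 : R)%:C * e_ l x) = @e_ R by [].
by apply/funext => l; apply/funext => x; rewrite rmorph1 mul1r.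
Qed.

Lemma two_intervals_sub1 : I1 `<=` Omega. Proof. by move=> x; left. Qed.
Lemma two_intervals_sub2 : I2 `<=` Omega. Proof. by move=> x; right. Qed.

Lemma L2_two1 f : L2 Omega f -> L2 I1 f.
Proof. by apply: L2_subset => //; [exact: measurable_two_intervals|exact: two_intervals_sub1]. Qed.

Lemma L2_two2 f : L2 Omega f -> L2 I2 f.
Proof. by apply: L2_subset => //; [exact: measurable_two_intervals|exact: two_intervals_sub2]. Qed.

Lemma nsq_two1 f : L2 Omega f -> nsq I1 f <= nsq Omega f.
Proof. by apply: nsq_subset => //; [exact: measurable_two_intervals|exact: two_intervals_sub1]. Qed.

Lemma nsq_two2 f : L2 Omega f -> nsq I2 f <= nsq Omega f.
Proof. by apply: nsq_subset => //; [exact: measurable_two_intervals|exact: two_intervals_sub2]. Qed.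

Lemma L2_two f : L2 I1 f -> L2 I2 f -> L2 Omega f.
Proof.
move=> [r1 i1 n1] [r2 i2 n2].
have mr : measurable_fun Omega (fun x => Re (f x)) by apply/measurable_funU.
have mi : measurable_fun Omega (fun x => Im (f x)) by apply/measurable_funU.
split => //; rewrite normsq_setU//; first exact: lte_add_pinfty.
exact: two_intervals_disjoint.
Qed.

Lemma cintegral_two f : L2 Omega f -> cintegral Omega f = cintegral I1 f + cintegral I2 f.
Proof.
move=> Lf; apply: cintegral_setU => //; first exact: two_intervals_disjoint.
by apply: L2_cintegrable => //; [exact: measurable_two_intervals|exact: two_intervals_fin].
Qed.

Lemma nsq_two f : L2 Omega f -> nsq Omega f = nsq I1 f + nsq I2 f.
Proof.
move=> Lf; apply: EFin_inj; rewrite EFinD -!nsqE; [|exact: L2_two2|exact: L2_two1|exact: Lf].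
by apply: normsq_setU => //; [exact: two_intervals_disjoint|exact: L2_cmeasurable Lf].
Qed.

Lemma inner_two f g : L2 Omega f -> L2 Omega g ->
  inner Omega f g = inner I1 f g + inner I2 f g.
Proof.
move=> Lf Lg; apply: cintegral_setU => //; first exact: two_intervals_disjoint.
by apply: L2_cintegrableM => //; exact: measurable_two_intervals.
Qed.

Lemma L2_e_two l : L2 Omega (e_ l).
Proof. by apply: L2_e; [exact: measurable_two_intervals|exact: two_intervals_fin]. Qed.

Lemma inner_ee (D : set R) l m : inner D (e_ l) (e_ m) = cintegral D (e_ (l - m)).
Proof. by rewrite /inner; congr cintegral; apply/funext => x; rewrite e_B. Qed.

Lemma inner_e_diag l : inner Omega (e_ l) (e_ l) = 1.
Proof.
rewrite inner_ee subrr (_ : e_ 0 = fun=> 1); last by apply/funext => x; rewrite e_0.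
rewrite -inner_1r inner_nsq nsq_1; last exact: measurable_two_intervals.
by rewrite mu_two_intervals.
Qed.

Lemma e_orthogonal l m : l != m -> inner Omega (e_ l) (e_ m) = 0 <->
  e_ (l - m) w + e_ (l - m) (1 + rho) = 1 + e_ (l - m) (w + rho).
Proof.
move=> lm; rewrite inner_ee cintegral_two; last exact: L2_e_two.
set k := l - m.
have h1 := cintegral_e w0 k; have h2 := cintegral_e (_ : w + rho < 1 + rho) k.
have {}h2 := h2 ltac:(by rewrite ltrD2r).
rewrite e_x0 in h1.
have K0 : (2 * pi * k)%:C * 'i%C != 0.
  rewrite mulf_neq0//; last by rewrite eq_complex /= eqxx oner_eq0.
  rewrite eq_complex /= eqxx andbT !mulf_neq0//; first exact: lt0r_neq0 (pi_gt0 R).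
  by rewrite subr_eq0.
split=> [h|h].
  apply/eqP; rewrite -subr_eq0; apply/eqP.
  rewrite -[RHS](mulr0 ((2 * pi * k)%:C * 'i%C)) -h mulrDr h1 h2; ring.
apply: (mulfI K0); rewrite mulr0 mulrDr h1 h2 -(subrr (1 + e_ k (w + rho))) -{1}h; ring.
Qed.

Lemma onb_distinct Lambda l m : orthonormal_basis Omega Lambda (@e_ R) ->
  Lambda l -> Lambda m -> l != m ->
  e_ (l - m) w + e_ (l - m) (1 + rho) = 1 + e_ (l - m) (w + rho).
Proof.
by move=> [_ orth _] Ll Lm lm; apply/(e_orthogonal lm); rewrite orth// (negbTE lm).
Qed.

End TwoIntervals.

(** * Approximation in the graph norm on one interval *)

Section IntervalApproximation.
Variables (R : realType) (a b : R).
Local Notation mu := (@lebesgue_measure R).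
Hypotheses (ab : a < b) (ab1 : b - a <= 1).
Local Notation I := `]a, b[%classic.
Implicit Types (x y : R) (f g q phi : R -> R[i]).

Lemma AC_continuous f x : absolutely_continuous_on a b f -> a < x < b ->
  forall e, 0 < e -> exists2 d, 0 < d & forall y, a < y < b -> `|y - x| < d ->
    normc (f y - f x) < e.
Proof.
move=> acf /andP[ax xb] e e0; have [d d0 h] := AC_lt acf e0; exists d => // y /andP[ay yb] yx.
have [xy|/ltW yx'] := leP x y.
  have := h [:: (x, y)]; rewrite /= ax xy yb !big_seq1 /=; apply=> //.
  by move: yx; rewrite ger0_norm// subr_ge0.
rewrite -normcN opprB.
have := h [:: (y, x)]; rewrite /= ay yx' xb !big_seq1 /=; apply=> //.
by move: yx; rewrite distrC ger0_norm// subr_ge0.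
Qed.

Lemma AC_cmeasurable f : absolutely_continuous_on a b f -> cmeasurable I f.
Proof.
move=> acf.
have near_I x : a < x < b -> \forall y \near x, a < y < b.
  move=> /andP[ax xb]; near=> y; apply/andP; split; near: y; first exact: lt_nbhsr.
  exact: lt_nbhsl.
have near_d x d : 0 < d -> \forall y \near x, `|y - x| < d.
  by move=> d0; exists d => // z /=; rewrite distrC.
split; apply: open_continuous_measurable_fun; try exact: interval_open.
  move=> x; rewrite inE/= in_itv/= => xab; apply/cvgrPdist_lt => e e0.
  have [d d0 h] := AC_continuous acf xab e0.
  near=> y; rewrite distrC -ReN -ReD; apply: le_lt_trans (Re_le_normc _) _.
  by apply: h; [near: y; exact: near_I|near: y; exact: near_d].
move=> x; rewrite inE/= in_itv/= => xab; apply/cvgrPdist_lt => e e0.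
have [d d0 h] := AC_continuous acf xab e0.
near=> y; rewrite distrC -ImN -ImD; apply: le_lt_trans (Im_le_normc _) _.
by apply: h; [near: y; exact: near_I|near: y; exact: near_d].
Unshelve. all: by end_near. Qed.

Lemma primitive_sup_bound phi x : L2 I phi -> a <= x <= b ->
  normc (primitive a phi x) ^+ 2 <= nsq I phi.
Proof.
move=> Lphi /andP[ax xb].
have := primitive_bound_le Lphi (lexx a) ax xb; rewrite primitive_a subr0 => /le_trans; apply.
rewrite -[leRHS]mul1r ler_wpM2r ?nsq_ge0//.
by move: ab1; lra.
Qed.

Lemma L2_primitive phi : L2 I phi -> L2 I (primitive a phi).
Proof.
move=> Lphi; apply: (@L2_bounded _ _ _ (Num.sqrt (nsq I phi))) => //.
- exact: itvoo_fin.
- by apply: AC_cmeasurable; exact: primitive_AC.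
- move=> x /=; rewrite in_itv/= => /andP[ax xb].
  rewrite -[X in X <= _]ger0_norm ?normc_ge0// -sqrtr_sqr; apply: ler_wsqrtr.
  by apply: primitive_sup_bound => //; rewrite !ltW.
Qed.

Lemma nsq_le_sup f (M : R) : L2 I f -> (forall x, a < x < b -> normc (f x) ^+ 2 <= M) ->
  nsq I f <= M.
Proof.
move=> Lf fM; have M0 : 0 <= M.
  have h : a < (a + b) / 2 < b by apply/andP; split; move: ab; lra.
  exact: le_trans (sqr_ge0 _) (fM _ h).
rewrite -lee_fin -nsqE//; apply: (@le_trans _ _ (\int[mu]_(x in I) (M)%:E)%E).
  apply: ge0_le_integral => //.
  - by move=> x _; rewrite lee_fin sqr_ge0.
  - by case: Lf => mr mi _; exact: measurable_normc_sqr.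
rewrite integral_cst//= lebesgue_measure_itv /= lte_fin ab -EFinB -EFinM lee_fin.
by rewrite -[leRHS]mulr1 ler_wpM2l.
Qed.

Lemma primitive_lin (c : R[i]) f g x : L2 I f -> L2 I g -> a <= x <= b ->
  primitive a (fun y => c * f y + g y) x = c * primitive a f x + primitive a g x.
Proof.
move=> Lf Lg /andP[ax xb]; rewrite /primitive cintegral_lin//;
  apply: L2_cintegrable => //; try exact: itvoo_fin;
  by apply: (L2_subset _ _ (@itvoo_sub _ a b a x (lexx a) xb)).
Qed.

Lemma FTC_smooth q q' x : (forall y, is_derivative q y (q' y)) -> L2 I q' ->
  absolutely_continuous_on a b q -> right_limit q a (q a) ->
  left_limit q b (q b) -> a < x <= b -> q x = q a + primitive a q' x.
Proof.
move=> dq Lq' acq ra lb /andP[ax]; rewrite le_eqVlt => /predU1P[->|xb].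
  have := AC_FTC ab acq Lq' (ae_all (fun y _ => dq y)) ra lb.
  by rewrite /primitive => ->; rewrite addrC subrK.
have [c fc] := AC_primitive ab acq Lq' (ae_all (fun y _ => dq y)).
rewrite fc ?ax//; congr (_ + _); symmetry; apply: (right_limit_unique ra).
rewrite -[X in right_limit _ _ X]addr0.
have := right_limit_D (right_limit_cst a c) (primitive_right_limit ab Lq').
apply: right_limit_near; near=> y; rewrite fc//.
by apply/andP; split; near: y; [exact: nbhs_right_gt|exact: nbhs_right_lt].
Unshelve. all: by end_near. Qed.

(* The constant is the mean of [f - primitive a g] over the interval. *)
Lemma interval_approx f g : L2 I f -> L2 I g -> exists c : R[i],
  forall e q q', 0 < e -> (forall y, is_derivative q y (q' y)) ->
    L2 I q -> L2 I q' -> absolutely_continuous_on a b q ->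
    right_limit q a (q a) -> left_limit q b (q b) ->
    nsq I (fun x => f x - q x) <= e -> nsq I (fun x => q' x - g x) <= e ->
    [/\ normc (c - q a) ^+ 2 <= 16%:R / (b - a) * e,
        normc (c + primitive a g b - q b) ^+ 2 <= 16%:R / (b - a) * e &
        nsq I (fun x => f x - (c + primitive a g x)) <= 16%:R * e].
Proof.
move=> Lf Lg; have L0 : 0 < b - a by rewrite subr_gt0.
have Lk := L2_primitive Lg.
have Lc (c : R[i]) : L2 I (fun=> c) by apply: L2_cst => //; exact: itvoo_fin.
have Lfk := L2B (measurable_itv _) Lf Lk.
exists ((b - a)^-1%:C * cintegral I (fun x => f x - primitive a g x)); set c := _ * _.
move=> e q q' e0 dq Lq Lq' acq ra lb fq qg.
have Lqg := L2B (measurable_itv _) Lq' Lg.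
have Lp := L2_primitive Lqg.
set d := q a.
have pE x : a <= x <= b -> primitive a (fun y => q' y - g y) x =
    primitive a q' x - primitive a g x.
  move=> xab; have := primitive_lin (-1) Lg Lq' xab; rewrite mulN1r addrC => <-.
  by congr primitive; apply/funext => y; rewrite mulN1r addrC.
have pe x : a <= x <= b -> normc (primitive a (fun y => q' y - g y) x) ^+ 2 <= e.
  by move=> xab; apply: le_trans (primitive_sup_bound Lqg xab) qg.
(* Since q is d plus the primitive of q', the function is the sum of f - q and the primitive of q' -
   g, each of squared norm at most e. *)
have step1 : nsq I (fun x => f x - primitive a g x - d) <= 4%:R * e.
  have Lfq := L2B (measurable_itv _) Lf Lq.
  have h1 := nsqD_le (measurable_itv _) Lfq Lp.
  have h2 : nsq I (primitive a (fun y => q' y - g y)) <= e.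
    by apply: nsq_le_sup => // x /andP[ax xb]; apply: pe; rewrite !ltW.
  suff -> : nsq I (fun x => f x - primitive a g x - d) =
    nsq I (fun x => f x - q x + primitive a (fun y => q' y - g y) x).
    by move: h1 h2 fq; lra.
  rewrite /nsq; congr fine; apply: eq_integral => x; rewrite inE/= in_itv/= => /andP[ax xb].
  rewrite pE ?(ltW ax) ?(ltW xb)// (FTC_smooth dq Lq' acq ra lb (x := x)) ?ax ?(ltW xb)//.
  by congr ((normc _ ^+ 2)%:E); rewrite -/d; ring.
(* (b - a) (c - d) is the integral of the function of [step1], because c is a mean value. *)
have step2 : normc (c - d) ^+ 2 <= 4%:R / (b - a) * e.
  have Lfkd := L2B (measurable_itv _) Lfk (Lc d).
  have := cintegral_bound (measurable_itv _) (itvoo_fin a b) Lfkd.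
  rewrite -inner_1r innerBl// inner_1r.
  have -> : inner I (fun=> d) (fun=> 1) = d * (b - a)%:C.
    have := innerZl (measurable_itv _) d (Lc 1) (Lc 1).
    under [X in inner _ X _ = _ -> _]eq_fun do rewrite mulr1.
    by rewrite inner_nsq nsq_1// fine_itvoo ?ltW// => ->.
  have -> : cintegral I (fun x => f x - primitive a g x) - d * (b - a)%:C =
      (b - a)%:C * (c - d).
    rewrite /c mulrBr mulrA -rmorphM mulfV ?gt_eqF// rmorph1 mul1r; ring.
  rewrite fine_itvoo ?(ltW ab)// normcM normc_real exprMn real_normK ?num_real//.
  move=> h; rewrite mulrAC ler_pdivlMr// mulrC.
  rewrite -(ler_pM2l L0) mulrA -expr2; apply: (le_trans h).
  by rewrite ler_wpM2l ?(ltW L0).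
(* The constant 16 covers all three bounds: 4 at the left end, 2 (4 / (b - a) + 1) at the right end
   with b - a <= 1, and 2 (4 + 4) for the norm. *)
have H416 : 4%:R / (b - a) * e <= 16%:R / (b - a) * e.
  by rewrite ler_wpM2r ?(ltW e0)// ler_wpM2r ?invr_ge0 ?(ltW L0)// ler_nat.
have e4 : e <= 4%:R / (b - a) * e.
  rewrite -[leLHS]mul1r ler_wpM2r ?(ltW e0)// ler_pdivlMr// mul1r.
  by move: ab1; lra.
split.
- exact: le_trans step2 H416.
- have bb : a <= b <= b by rewrite lexx ltW.
  rewrite (FTC_smooth dq Lq' acq ra lb (x := b)) ?ab ?lexx//.
  have -> : c + primitive a g b - (q a + primitive a q' b) =
      (c - d) - primitive a (fun y => q' y - g y) b by rewrite pE// -/d; ring.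
  apply: le_trans (normc_sqrB_le _ _) _; have := pe b bb.
  rewrite (_ : 16%:R / (b - a) * e = 4%:R / (b - a) * e *+ 4); last by ring.
  by move: step2 e4; lra.
- have -> : (fun x => f x - (c + primitive a g x)) =
      (fun x => (f x - primitive a g x - d) - (c - d)).
    by apply/funext => x; ring.
  apply: (le_trans (nsqB_le (measurable_itv _) _ _)) => //.
    by apply: L2B => //.
  have := nsqZ (measurable_itv _) (c - d) (Lc 1).
  under [X in nsq _ X = _ -> _]eq_fun do rewrite mulr1.
  rewrite nsq_1// fine_itvoo ?(ltW ab)// => ->.
  have : normc (c - d) ^+ 2 * (b - a) <= 4%:R * e.
    by rewrite -ler_pdivlMr// mulrAC.
  by move: step1; lra.
Qed.

End IntervalApproximation.

(** * Boundary limits of almost everywhere equal functions *)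

Section Limits.
Variable R : realType.
Local Notation mu := (@lebesgue_measure R).
Implicit Types (f g h : R -> R[i]) (a b : R).

Lemma ae_exists (P : R -> Prop) a b : {ae mu, forall x, P x} -> a < b ->
  exists2 x, a < x < b & P x.
Proof.
move=> [N [mN N0 sN]] ab; apply: contrapT => nP.
have IN : `]a, b[%classic `<=` N.
  move=> x /=; rewrite in_itv/= => xab; apply: sN => /= Px.
  by apply: nP; exists x.
have : (mu `]a, b[%classic <= mu N)%E by apply: le_mu.
rewrite [X in (_ <= X)%E](_ : _ = 0%E); last exact: N0.
by rewrite lebesgue_measure_itv /= lte_fin ab -EFinB lee_fin subr_le0 leNgt ab.
Qed.

(** A set of full measure meets every interval ]a, a + e[, so both functions take a common value
    arbitrarily close to a. Thus boundary values depend only on the a.e. class. *)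
Lemma right_limit_ae f g a b (l m : R[i]) : a < b ->
  {ae mu, forall x, a < x < b -> f x = g x} ->
  right_limit f a l -> right_limit g a m -> l = m.
Proof.
move=> ab fg [rf jf] [rg jg].
have key (u v : R -> R) (s t : R) : u y @[y --> a^'+] --> s -> v y @[y --> a^'+] --> t ->
    (forall e, 0 < e -> exists2 y, a < y < a + e & u y = v y) -> s = t.
  move=> us vt uv; apply/eqP; rewrite -subr_eq0 -normr_eq0; apply/eqP.
  apply: (le_eps_eq0 (M := 2)); first exact: normr_ge0.
  move=> e e0; move/cvgrPdist_lt: us => /(_ _ e0)[d1 /= d10 h1].
  move/cvgrPdist_lt: vt => /(_ _ e0)[d2 /= d20 h2].
  have [|y /andP[ay yd] uvy] := uv (Num.min d1 d2); first by rewrite lt_min d10.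
  have : `|a - y| < Num.min d1 d2 by rewrite distrC ger0_norm ?subr_ge0 ?ltW// ltrBlDl.
  rewrite lt_min => /andP[y1 y2].
  have := h1 y y1 ay; have := h2 y y2 ay; rewrite uvy !ltr_norml ler_norml.
  move=> /andP[? ?] /andP[? ?]; apply/andP; split; lra.
have ex e : 0 < e -> exists2 y, a < y < a + e & f y = g y.
  move=> e0; have [|y /andP[ay]] := ae_exists fg (b := Num.min b (a + e)) (a := a).
    by rewrite lt_min ab ltrDl.
  rewrite lt_min => /andP[yb ye] h; exists y; first by rewrite ay.
  by apply: h; rewrite ay.
apply: eqReIm.
  by apply: (key _ _ _ _ rf rg) => e /ex[y ? fgy]; exists y => //; rewrite fgy.
by apply: (key _ _ _ _ jf jg) => e /ex[y ? fgy]; exists y => //; rewrite fgy.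
Qed.

Lemma left_limit_ae f g a b (l m : R[i]) : a < b ->
  {ae mu, forall x, a < x < b -> f x = g x} ->
  left_limit f b l -> left_limit g b m -> l = m.
Proof.
move=> ab fg [rf jf] [rg jg].
have key (u v : R -> R) (s t : R) : u y @[y --> b^'-] --> s -> v y @[y --> b^'-] --> t ->
    (forall e, 0 < e -> exists2 y, b - e < y < b & u y = v y) -> s = t.
  move=> us vt uv; apply/eqP; rewrite -subr_eq0 -normr_eq0; apply/eqP.
  apply: (le_eps_eq0 (M := 2)); first exact: normr_ge0.
  move=> e e0; move/cvgrPdist_lt: us => /(_ _ e0)[d1 /= d10 h1].
  move/cvgrPdist_lt: vt => /(_ _ e0)[d2 /= d20 h2].
  have [|y /andP[yd yb] uvy] := uv (Num.min d1 d2); first by rewrite lt_min d10.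
  have : `|b - y| < Num.min d1 d2 by rewrite ger0_norm ?subr_ge0 ?ltW// ltrBlDr -ltrBlDl.
  rewrite lt_min => /andP[y1 y2].
  have := h1 y y1 yb; have := h2 y y2 yb; rewrite uvy !ltr_norml ler_norml.
  move=> /andP[? ?] /andP[? ?]; apply/andP; split; lra.
have ex e : 0 < e -> exists2 y, b - e < y < b & f y = g y.
  move=> e0; have [|y /andP[]] := ae_exists fg (a := Num.max a (b - e)) (b := b).
    by rewrite gt_max ab ltrBlDr ltrDl.
  rewrite gt_max => /andP[ya ye] yb h; exists y; first by rewrite ye.
  by apply: h; rewrite ya.
apply: eqReIm.
  by apply: (key _ _ _ _ rf rg) => e /ex[y ? fgy]; exists y => //; rewrite fgy.
by apply: (key _ _ _ _ jf jg) => e /ex[y ? fgy]; exists y => //; rewrite fgy.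
Qed.

Lemma AC_eq f g a b : (forall x, a < x < b -> f x = g x) ->
  absolutely_continuous_on a b f -> absolutely_continuous_on a b g.
Proof.
move=> fg acf e e0; have [d d0 h] := acf e e0; exists d => // n p q pq tpq spq.
rewrite (eq_bigr (fun i => normc (f (q i) - f (p i)))); first exact: h.
move=> i _; have [p1 p2 p3] := pq i.
by rewrite !fg ?p1 ?p3 ?(le_lt_trans p2)// (lt_le_trans p1).
Qed.

Lemma AC_cstD f a b (c : R[i]) : absolutely_continuous_on a b f ->
  absolutely_continuous_on a b (fun x => c + f x).
Proof.
move=> acf e e0; have [d d0 h] := acf e e0; exists d => // n p q pq tpq spq.
rewrite (eq_bigr (fun i => normc (f (q i) - f (p i)))); first exact: h.
by move=> i _; congr normc; ring.
Qed.

End Limits.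

(** * Two-by-two matrices acting on boundary columns *)

Section Col2.
Variable R : realType.
Local Notation C := R[i].
Implicit Types (a b c d z : C) (B : 'M[C]_2).

Lemma mul_col2 B a b :
  B *m col2 a b = col2 (B ord0 ord0 * a + B ord0 ord_max * b)
                       (B ord_max ord0 * a + B ord_max ord_max * b).
Proof.
apply/matrixP => i j; rewrite !mxE big_ord_recl big_ord1 !mxE /=.
have -> : lift ord0 ord0 = ord_max :> 'I_2 by apply/val_inj.
by case: (boolP (i == 0)) => [/eqP ->//|i0]; have -> : i = ord_max
  by apply/val_inj; case: i i0 => [[|[|]]].
Qed.

Lemma col2_inj a b c d : col2 a b = col2 c d -> a = c /\ b = d.
Proof.
by move=> h; split; [move: (congr1 (fun M : 'cV_2 => M ord0 ord0) h)|
  move: (congr1 (fun M : 'cV_2 => M ord_max ord0) h)]; rewrite !mxE.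
Qed.

(** A unitary matrix preserves the Hermitian product of columns. Applied to the boundary values of a
    function and of an exponential, this cancels the boundary terms of integration by parts. *)
Lemma unitary_col2 B a b c d a' b' c' d' : B \is unitarymx ->
  B *m col2 a b = col2 a' b' -> B *m col2 c d = col2 c' d' ->
  a' * Num.conj c' + b' * Num.conj d' = a * Num.conj c + b * Num.conj d.
Proof.
move=> /unitarymxP BU Bab Bcd.
have inE (x y z t : C) : ((col2 z t ^t*)%sesqui *m col2 x y) ord0 ord0 =
    x * Num.conj z + y * Num.conj t.
  rewrite mxE big_ord_recl big_ord1 !mxE /=.
  by rewrite ![Num.conj _ * _]mulrC.
rewrite -!inE -Bab -Bcd trmx_mul map_mxM /= -mulmxA [X in _ *m X]mulmxA.
by rewrite (mulmx1C BU) mul1mx.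
Qed.

End Col2.

(** * The spectral matrix *)

Section SpectralMatrix.
Variables (R : realType) (w rho : R).
Local Notation mu := (@lebesgue_measure R).
Hypotheses (w0 : 0 < w) (w1 : w < 1) (rho0 : 0 < rho).
Local Notation Omega := (two_intervals w rho).
Local Notation I1 := `]0, w[%classic.
Local Notation I2 := `]w + rho, 1 + rho[%classic.
Variable Lambda : set R.
Hypothesis onb : orthonormal_basis Omega Lambda (@e_ R).
Implicit Types (f g h : R -> R[i]) (B : 'M[R[i]]_2).

(** The exponential lies in the domain of the operator, so its class has a representative satisfying
    the boundary condition, and a.e. equality transfers the four limits. *)
Lemma spectral_matrix_e B l : spectral_matrix w rho Lambda B -> Lambda l ->
  B *m col2 1 (e_ l (w + rho)) = col2 (e_ l w) (e_ l (1 + rho)).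
Proof.
move=> [_ [A [[_ Ae] domA]]] Ll.
have /domA[_ [h [eh _ [fa1 [fa2 [fb1 [fb2 [ra1 ra2 lb1 lb2 Bf]]]]]]]] :
  exists g, A (e_ l) g by eexists; exact: Ae.
have h1 : {ae mu, forall x, 0 < x < w -> h x = e_ l x}.
  by apply: ae_imp eh => x ehx xw; rewrite ehx//; left; rewrite /= in_itv.
have h2 : {ae mu, forall x, w + rho < x < 1 + rho -> h x = e_ l x}.
  by apply: ae_imp eh => x ehx xw; rewrite ehx//; right; rewrite /= in_itv.
have w12 : w + rho < 1 + rho by rewrite ltrD2r.
rewrite -(e_x0 l).
rewrite -(right_limit_ae w0 h1 ra1 (right_limit_e _ _)).
rewrite -(right_limit_ae w12 h2 ra2 (right_limit_e _ _)).
rewrite -(left_limit_ae w0 h1 lb1 (left_limit_e _ _)).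
by rewrite -(left_limit_ae w12 h2 lb2 (left_limit_e _ _)).
Qed.

Section Existence.
Variable B : 'M[R[i]]_2.
Hypothesis BU : B \is unitarymx.
Hypothesis Be : forall l, Lambda l ->
  B *m col2 1 (e_ l (w + rho)) = col2 (e_ l w) (e_ l (1 + rho)).

Let tpi : R[i] := (2 * pi : R)%:C * 'i%C.

Let tpi0 : tpi != 0.
Proof.
rewrite mulf_neq0//; last by rewrite eq_complex /= eqxx oner_eq0.
by rewrite eq_complex /= eqxx andbT !mulf_neq0//; exact: lt0r_neq0 (pi_gt0 R).
Qed.

Let mO := @measurable_two_intervals R w rho.
Let Le := L2_e_two w0 w1 rho0.

(** Integration by parts on both intervals against [e_ l]; unitarity of [B] makes the boundary terms
    add up to zero, leaving the coefficient relation for h' / (2 pi i). *)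
Lemma diagonal_of_boundary h : Dmax w rho h -> boundary_condition w rho B h ->
  exists g, diagonal_operator Omega Lambda h g.
Proof.
move=> [Lh ac1 ac2 [g Lg dg]] [fa1 [fa2 [fb1 [fb2 [ra1 ra2 lb1 lb2 Bf]]]]].
exists (fun x => tpi^-1 * g x); split=> //; first exact: L2Z.
move=> l Ll; rewrite innerZl//; apply: (mulfI tpi0); rewrite mulVKf//.
have d1 : {ae mu, forall x, 0 < x < w -> is_derivative h x (g x)}.
  by apply: ae_imp dg => x d xw; apply: d; left; rewrite /= in_itv.
have d2 : {ae mu, forall x, w + rho < x < 1 + rho -> is_derivative h x (g x)}.
  by apply: ae_imp dg => x d xw; apply: d; right; rewrite /= in_itv.
have w12 : w + rho < 1 + rho by rewrite ltrD2r.
rewrite !inner_two//.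
rewrite (AC_inner_e w0 l ac1 (L2_two1 Lh) (L2_two1 Lg) d1 ra1 lb1).
rewrite (AC_inner_e w12 l ac2 (L2_two2 Lh) (L2_two2 Lg) d2 ra2 lb2).
have := unitary_col2 BU Bf (Be Ll); rewrite rmorph1 e_x0 rmorph1 !mulr1 => bd.
have -> : (2 * pi * l)%:C * 'i%C = tpi * l%:C by rewrite /tpi rmorphM; ring.
rewrite mulrA mulrDr -[RHS]add0r -(subrr (fa1 + fa2 * Num.conj (e_ l (w + rho)))) -{1}bd.
ring.
Qed.

Lemma fourier_comb_boundary (s : seq R) (c : R -> R[i]) : (forall l, l \in s -> Lambda l) ->
  let q x := \sum_(l <- s) c l * e_ l x in
  B *m col2 (q 0) (q (w + rho)) = col2 (q w) (q (1 + rho)).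
Proof.
move=> sL q; rewrite /q => {q}; elim: s sL => [_|i s ih sL].
  by rewrite !big_nil mul_col2 !mulr0 !addr0.
rewrite !big_cons.
have {}ih := ih (fun j js => sL j (mem_behead (s := i :: s) js)).
have Bei := Be (sL i (mem_head _ _)).
rewrite mul_col2 in ih; rewrite mul_col2 in Bei; rewrite mul_col2.
have [b1 b2] := col2_inj Bei; have [i1 i2] := col2_inj ih.
by rewrite -b1 -b2 -i1 -i2 e_x0; congr col2; ring.
Qed.

Lemma is_derivative_comb (s : seq R) (c : R -> R[i]) (y : R) :
  is_derivative (fun x => \sum_(l <- s) c l * e_ l x) y
    (\sum_(l <- s) c l * ((2 * pi * l)%:C * 'i%C * e_ l y)).
Proof.
have cst0 (z : R[i]) : is_derivative (fun=> z) y 0 by split; exact: is_derive_cst.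
elim: s => [|i s ih].
  by rewrite big_nil (_ : (fun x => _) = fun=> 0)//; apply/funext => x; rewrite big_nil.
(* A sum written with two differences, so that the rule for differences suffices. *)
rewrite big_cons (_ : (fun x => _) = fun x => c i * e_ i x - (0 - \sum_(l <- s) c l * e_ l x)).
  rewrite -[X in _ + X]opprK -[X in _ - X]sub0r; apply: is_derivativeB.
    have := is_derivativeM (cst0 (c i)) (is_derivative_e i y).
    by rewrite mul0r addr0.
  exact: is_derivativeB.
by apply/funext => x; rewrite big_cons sub0r opprK.
Qed.

Lemma comb_endpoints (s : seq R) (c : R -> R[i]) (x : R) :
  let q x := \sum_(l <- s) c l * e_ l x in right_limit q x (q x) /\ left_limit q x (q x).
Proof.
move=> q; rewrite /q => {q}; elim: s => [|i s [ihr ihl]].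
  rewrite big_nil (_ : (fun x => _) = fun=> 0); last by apply/funext => y; rewrite big_nil.
  by split; [exact: right_limit_cst|exact: left_limit_cst].
rewrite big_cons (_ : (fun x => _) = fun x => c i * e_ i x + \sum_(l <- s) c l * e_ l x).
  split.
    by apply: right_limit_D ihr; apply: right_limit_M; [exact: right_limit_cst|exact: right_limit_e].
  by apply: left_limit_D ihl; apply: left_limit_M; [exact: left_limit_cst|exact: left_limit_e].
by apply/funext => y; rewrite big_cons.
Qed.

Lemma AC_comb (a b : R) (s : seq R) (c : R -> R[i]) :
  absolutely_continuous_on a b (fun x => \sum_(l <- s) c l * e_ l x).
Proof.
elim: s => [|i s ih].
  move=> e e0; exists 1 => // n p q _ _ _; rewrite big1// => k _.
  by rewrite !big_nil subrr normc0.
pose M := normc (c i) + 1.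
have acst : absolutely_continuous_on a b (fun=> c i).
  by move=> e e0; exists 1 => // n p q _ _ _; rewrite big1// => k _; rewrite subrr normc0.
have ac1 : absolutely_continuous_on a b (fun x => c i * e_ i x).
  apply: (@AC_mul _ _ _ M) => //; [exact: AC_e| |] => x _.
    by rewrite lerDl.
  by rewrite normc_e lerDr normc_ge0.
have ac0 : absolutely_continuous_on a b (fun=> (0 : R[i])).
  by move=> e e0; exists 1 => // n p q _ _ _; rewrite big1// => k _; rewrite subrr normc0.
apply: AC_eq (ACB ac1 (ACB ac0 ih)) => x _.
by rewrite big_cons sub0r opprK.
Qed.

(** On each interval the representative is a constant plus the primitive of 2 pi i g, which settles
    regularity at once. Only the boundary relation uses the Fourier sums. *)
Lemma boundary_of_diagonal f g : diagonal_operator Omega Lambda f g ->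
  exists h, [/\ f = h %[ae mu in Omega], Dmax w rho h & boundary_condition w rho B h].
Proof.
move=> [Lf Lg fg]; pose g2 x := tpi * g x.
have Lg2 : L2 Omega g2 by exact: L2Z.
have Lg21 := L2_two1 Lg2; have Lg22 := L2_two2 Lg2.
have w12 : w + rho < 1 + rho by rewrite ltrD2r.
have L1 : w - 0 <= 1 by rewrite subr0 ltW.
have L2' : 1 + rho - (w + rho) <= 1 by move: w0; lra.
have [c1 hc1] := interval_approx w0 L1 (L2_two1 Lf) Lg21.
have [c2 hc2] := interval_approx w12 L2' (L2_two2 Lf) Lg22.
set k1 := primitive 0 g2 in hc1; set k2 := primitive (w + rho) g2 in hc2.
have approx e : 0 < e -> exists2 q : R -> R[i],
    B *m col2 (q 0) (q (w + rho)) = col2 (q w) (q (1 + rho)) &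
    [/\ normc (c1 - q 0) ^+ 2 <= 16%:R / (w - 0) * e,
        normc (c1 + k1 w - q w) ^+ 2 <= 16%:R / (w - 0) * e &
        nsq I1 (fun x => f x - (c1 + k1 x)) <= 16%:R * e] /\
    [/\ normc (c2 - q (w + rho)) ^+ 2 <= 16%:R / (1 + rho - (w + rho)) * e,
        normc (c2 + k2 (1 + rho) - q (1 + rho)) ^+ 2 <= 16%:R / (1 + rho - (w + rho)) * e &
        nsq I2 (fun x => f x - (c2 + k2 x)) <= 16%:R * e].
  (* Differentiation multiplies the error on g by the squared modulus of 2 pi i; dividing e by M
     keeps both errors at most e. *)
  move=> e0; pose M := normc tpi ^+ 2 + 1.
  have M1 : 1 <= M by rewrite lerDr sqr_ge0.
  have M0 : 0 < M by rewrite (lt_le_trans ltr01).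
  have [s [us sL] [fs gs]] := fourier_sum_approx2 mO onb Lf Lg (divr_gt0 e0 M0).
  pose c l := inner Omega f (e_ l).
  pose q x := \sum_(l <- s) c l * e_ l x.
  pose q' x := \sum_(l <- s) c l * ((2 * pi * l)%:C * 'i%C * e_ l x).
  (* The coefficients of g are l times those of f, so the derivative of a Fourier sum of f is 2 pi i
     times the Fourier sum of g over the same frequencies. *)
  have q'E x : q' x = tpi * fourier_sum Omega (@e_ R) s g x.
    rewrite /q' /fourier_sum big_distrr /=; rewrite big_seq [RHS]big_seq.
    apply: eq_bigr => l ls; rewrite fg; last exact: sL.
    by rewrite /c /tpi !rmorphM; ring.
  have Lq : L2 Omega q by apply: L2_sum => // l _; exact: L2Z.
  have Lq' : L2 Omega q' by apply: L2_sum => // l _; apply: L2Z => //; exact: L2Z.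
  have hf : nsq Omega (fun x => f x - q x) <= e.
    by apply: le_trans (ltW fs) _; rewrite ler_pdivrMr// ler_peMr// ltW.
  have hg : nsq Omega (fun x => q' x - g2 x) <= e.
    rewrite (_ : (fun x => _) = fun x => tpi * (fourier_sum Omega (@e_ R) s g x - g x)); last first.
      by apply/funext => x; rewrite q'E /g2; ring.
    have LS : L2 Omega (fourier_sum Omega (@e_ R) s g) by apply: (L2_fourier_sum mO onb).
    rewrite (nsqZ mO tpi (L2B mO LS Lg)).
    rewrite nsqBC; move: gs; rewrite ltr_pdivlMr// => /ltW; apply: le_trans.
    by rewrite mulrC ler_wpM2l ?nsq_ge0// lerDl.
  have dq y : is_derivative q y (q' y) by exact: is_derivative_comb.
  have [lim1 lim2] : (forall x, right_limit q x (q x)) /\ (forall x, left_limit q x (q x)).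
    by split=> x; have [] := comb_endpoints s c x.
  have LfB := L2B mO Lf Lq; have LgB := L2B mO Lq' Lg2.
  have hf1 := le_trans (nsq_two1 LfB) hf; have hf2 := le_trans (nsq_two2 LfB) hf.
  have hg1 := le_trans (nsq_two1 LgB) hg; have hg2 := le_trans (nsq_two2 LgB) hg.
  exists q; first exact: fourier_comb_boundary.
  split.
    exact: (hc1 e q q' e0 dq (L2_two1 Lq) (L2_two1 Lq') (@AC_comb _ _ s c) (lim1 _) (lim2 _) hf1 hg1).
  exact: (hc2 e q q' e0 dq (L2_two2 Lq) (L2_two2 Lq') (@AC_comb _ _ s c) (lim1 _) (lim2 _) hf2 hg2).
pose h x := if x < w then c1 + k1 x else c2 + k2 x.
have h1 x : 0 < x < w -> c1 + k1 x = h x by rewrite /h => /andP[_ ->].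
have h2 x : w + rho < x < 1 + rho -> c2 + k2 x = h x.
  by rewrite /h => /andP[xw _]; rewrite ltNge (ltW (lt_trans _ xw)) ?ltrDl.
have AC1 : absolutely_continuous_on 0 w (fun x => c1 + k1 x).
  by exact: AC_cstD (primitive_AC Lg21).
have AC2 : absolutely_continuous_on (w + rho) (1 + rho) (fun x => c2 + k2 x).
  by exact: AC_cstD (primitive_AC Lg22).
have Lh1 : L2 I1 (fun x => c1 + k1 x).
  apply: L2D => //; first by apply: L2_cst => //; exact: itvoo_fin.
  exact: (L2_primitive L1 Lg21).
have Lh2 : L2 I2 (fun x => c2 + k2 x).
  apply: L2D => //; first by apply: L2_cst => //; exact: itvoo_fin.
  exact: (L2_primitive L2' Lg22).
have Lh : L2 Omega h.
  by apply: L2_two => //; [apply: eq_L2 Lh1 => x|apply: eq_L2 Lh2 => x];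
    rewrite /= in_itv/=; [exact: h1|exact: h2].
exists h; split.
- have e1 : f = (fun x => c1 + k1 x) %[ae mu in I1].
    apply/(nsqB_eq0P (measurable_itv _) (L2_two1 Lf) Lh1).
    apply: (le_eps_eq0 (M := 16%:R)); first exact: nsq_ge0.
    by move=> e /approx[q _ [[_ _ +] _]].
  have e2 : f = (fun x => c2 + k2 x) %[ae mu in I2].
    apply/(nsqB_eq0P (measurable_itv _) (L2_two2 Lf) Lh2).
    apply: (le_eps_eq0 (M := 16%:R)); first exact: nsq_ge0.
    by move=> e /approx[q _ [_ [_ _ +]]].
  apply: ae_imp2 e1 e2 => x a1 a2 [xI|xI].
    by rewrite a1// h1//; move: xI; rewrite /= in_itv.
  by rewrite a2// h2//; move: xI; rewrite /= in_itv.
- split => //; [exact: AC_eq AC1|exact: AC_eq AC2|exists g2 => //].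
  have d1 := primitive_derivative Lg21.
  have d2 := primitive_derivative Lg22.
  have near_I (a b x : R) : a < x < b -> \forall y \near x, a < y < b.
    move=> /andP[ax xb]; near=> y; apply/andP; split; near: y; first exact: lt_nbhsr.
    exact: lt_nbhsl.
  have dD (c : R[i]) u x d : is_derivative u x d -> is_derivative (fun y => c + u y) x d.
    have c0 : is_derivative (fun=> c) x 0 by split; exact: is_derive_cst.
    have z0 : is_derivative (fun=> (0 : R[i])) x 0 by split; exact: is_derive_cst.
    move=> du; have := is_derivativeB c0 (is_derivativeB z0 du).
    rewrite !sub0r opprK (_ : (fun y => c - (0 - u y)) = fun y => c + u y)//.
    by apply/funext => y; rewrite sub0r opprK.
  have near_d (u v : R -> R[i]) (x : R) (d : R[i]) : (\forall y \near x, u y = v y) -> is_derivative u x d ->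
      is_derivative v x d.
    move=> uv [du dv']; split.
      by apply: near_eq_is_derive du; apply: filterS uv => y ->.
    by apply: near_eq_is_derive dv'; apply: filterS uv => y ->.
  apply: ae_imp2 d1 d2 => x a1 a2 [|]; rewrite /= in_itv/= => xI.
    apply: (near_d (fun y => c1 + k1 y)); last exact/dD/a1.
    by apply: filterS (near_I _ _ _ xI) => y; exact: h1.
  apply: (near_d (fun y => c2 + k2 y)); last exact/dD/a2.
  by apply: filterS (near_I _ _ _ xI) => y; exact: h2.
- exists c1, c2, (c1 + k1 w), (c2 + k2 (1 + rho)); split.
  + rewrite -[X in right_limit _ _ X]addr0.
    have := right_limit_D (right_limit_cst 0 c1) (primitive_right_limit w0 Lg21).
    apply: right_limit_near; near=> y; apply: h1.
    by apply/andP; split; near: y; [exact: nbhs_right_gt|exact: nbhs_right_lt].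
  + rewrite -[X in right_limit _ _ X]addr0.
    have := right_limit_D (right_limit_cst (w + rho) c2) (primitive_right_limit w12 Lg22).
    apply: right_limit_near; near=> y; apply: h2.
    by apply/andP; split; near: y; [exact: nbhs_right_gt|exact: nbhs_right_lt].
  + have := left_limit_D (left_limit_cst w c1) (primitive_left_limit w0 Lg21).
    apply: left_limit_near; near=> y; apply: h1.
    by apply/andP; split; near: y; [exact: nbhs_left_gt|exact: nbhs_left_lt].
  + have := left_limit_D (left_limit_cst (1 + rho) c2) (primitive_left_limit w12 Lg22).
    apply: left_limit_near; near=> y; apply: h2.
    by apply/andP; split; near: y; [exact: nbhs_left_gt|exact: nbhs_left_lt].
  rewrite mul_col2; set K1 := 16%:R / (w - 0) in approx.
  set K2 := 16%:R / (1 + rho - (w + rho)) in approx.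
  (* Each row of the boundary relation is exact for the approximants, so its defect z for the limit
     is a fixed linear combination of endpoint errors, and these tend to zero. *)
  have zero (x y z : R[i]) : (forall e, 0 < e -> exists u v t : R[i],
       [/\ normc u ^+ 2 <= K1 * e, normc v ^+ 2 <= K2 * e, normc t ^+ 2 <= (K1 + K2) * e &
         z = x * u + y * v - t]) -> z = 0.
    move=> huv; apply/eqP; rewrite -normc_eq0 -sqrf_eq0; apply/eqP.
    pose M := (normc x ^+ 2 * K1 *+ 2 + normc y ^+ 2 * K2 *+ 2 + (K1 + K2)) *+ 2.
    apply: (le_eps_eq0 (M := M)); first exact: sqr_ge0.
    move=> e /huv[u [v [t [hu hv ht ->]]]].
    apply: le_trans (normc_sqrB_le _ _) _.
    have := normc_sqrB_le (x * u) (- (y * v)); rewrite opprK normcN !normcM !exprMn.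
    have xu : normc x ^+ 2 * normc u ^+ 2 <= normc x ^+ 2 * (K1 * e) by rewrite ler_wpM2l ?sqr_ge0.
    have yv : normc y ^+ 2 * normc v ^+ 2 <= normc y ^+ 2 * (K2 * e) by rewrite ler_wpM2l ?sqr_ge0.
    rewrite (_ : M * e = (normc x ^+ 2 * (K1 * e) *+ 2 + normc y ^+ 2 * (K2 * e) *+ 2 +
      (K1 + K2) * e) *+ 2); last by rewrite /M; ring.
    by move: xu yv ht; lra.
  have K10 : 0 < K1 by rewrite divr_gt0// subr_gt0.
  have K20 : 0 < K2 by rewrite divr_gt0// subr_gt0.
  have wid (x K K' e : R) : 0 < K -> 0 < e -> x <= K' * e -> x <= (K + K') * e.
    by move=> K0 e0 /le_trans; apply; rewrite ler_wpM2r ?(ltW e0)// lerDr ltW.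
  congr col2; apply/eqP; rewrite -subr_eq0; apply/eqP.
    apply: (zero (B ord0 ord0) (B ord0 ord_max)) => e e0.
    have [q Bq [[b1 b2 _] [b3 b4 _]]] := approx e e0.
    exists (c1 - q 0), (c2 - q (w + rho)), (c1 + k1 w - q w); split=> //.
      by rewrite [K1 + K2]addrC; exact: wid.
    by move: Bq; rewrite mul_col2 => /col2_inj[<- _]; ring.
  apply: (zero (B ord_max ord0) (B ord_max ord_max)) => e e0.
  have [q Bq [[b1 b2 _] [b3 b4 _]]] := approx e e0.
  exists (c1 - q 0), (c2 - q (w + rho)), (c2 + k2 (1 + rho) - q (1 + rho)); split=> //.
    exact: wid.
  by move: Bq; rewrite mul_col2 => /col2_inj[_ <-]; ring.
Unshelve. all: by end_near. Qed.

Lemma spectral_matrix_exists : spectral_matrix w rho Lambda B.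
Proof.
split=> //; exists (diagonal_operator Omega Lambda); split.
  by apply: spectral_operator_diagonal => //; exact: two_intervals_fin.
move=> f; split=> [[g fg]|[Lf [h [fh Dh Bh]]]].
  split; first by case: fg.
  exact: boundary_of_diagonal fg.
have [g hg] := diagonal_of_boundary Dh Bh; exists g.
have [Lh Lg _] := hg.
apply: (diagonal_operator_ae mO _ Lf Lg _ _ hg) => //; first exact: two_intervals_fin.
- by apply: ae_imp fh => x fhx Ox; rewrite fhx.
- exact: ae_all.
Qed.

End Existence.

End SpectralMatrix.

(** * Completeness of Fourier series *)

Section TrigonometricPolynomials.
Variables (R : realType) (Lambda : set R).
Implicit Types (p q : R -> R[i]) (s : seq R).

Definition trig_poly p := exists s (c : R -> R[i]),
  (forall j, j \in s -> Lambda j) /\ forall x, p x = \sum_(j <- s) c j * e_ j x.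

(** The coefficients of a trigonometric polynomial are a function of the frequency while its list of
    frequencies may have repetitions; merging two lists therefore has to record multiplicities. *)
Lemma sum_count_mem (s u : seq R) (F : R -> R[i]) : uniq u -> {subset s <= u} ->
  \sum_(j <- s) F j = \sum_(j <- u) (count_mem j s)%:R * F j.
Proof.
move=> uu; elim: s => [_|a s ih su].
  by rewrite big_nil big1// => j _; rewrite mul0r.
rewrite big_cons ih; last by move=> j js; apply: su; rewrite inE js orbT.
have au : a \in u by apply: su; rewrite mem_head.
rewrite [in RHS](bigD1_seq a)//= [in LHS](bigD1_seq a)//= eqxx add1n -natr1.
rewrite [in LHS](_ : \sum_(i <- u | i != a) (count_mem i s)%:R * F i =
  \sum_(i <- u | i != a) ((a == i) + count_mem i s)%N%:R * F i); first by ring.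
by apply: eq_bigr => i ia; rewrite eq_sym (negbTE ia).
Qed.

Lemma trig_polyD p q : trig_poly p -> trig_poly q -> trig_poly (fun x => p x + q x).
Proof.
move=> [s1 [c1 [sL1 p1]]] [s2 [c2 [sL2 p2]]]; pose u := undup (s1 ++ s2).
exists u, (fun j => (count_mem j s1)%:R * c1 j + (count_mem j s2)%:R * c2 j); split.
  by move=> j; rewrite mem_undup mem_cat => /orP[/sL1|/sL2].
move=> x; rewrite p1 p2 (@sum_count_mem s1 u); first last.
- by move=> j js; rewrite mem_undup mem_cat js.
- exact: undup_uniq.
rewrite (@sum_count_mem s2 u); first last.
- by move=> j js; rewrite mem_undup mem_cat js orbT.
- exact: undup_uniq.
by rewrite -big_split; apply: eq_bigr => j _ /=; ring.
Qed.

Lemma trig_polyZ (a : R[i]) p : trig_poly p -> trig_poly (fun x => a * p x).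
Proof.
move=> [s [c [sL ps]]]; exists s, (fun j => a * c j); split=> // x.
by rewrite ps big_distrr; apply: eq_bigr => j _ /=; ring.
Qed.

Lemma trig_poly_e l : Lambda l -> trig_poly (e_ l).
Proof.
move=> Ll; exists [:: l], (fun=> 1); split; first by move=> j; rewrite inE => /eqP ->.
by move=> x; rewrite big_seq1 mul1r.
Qed.

Lemma trig_poly0 : trig_poly (fun=> 0).
Proof. by exists [::], (fun=> 0); split=> // x; rewrite big_nil. Qed.

Lemma eq_trig_poly p q : (forall x, p x = q x) -> trig_poly p -> trig_poly q.
Proof. by move=> pq [s [c [sL ps]]]; exists s, c; split => // x; rewrite -pq. Qed.

Lemma trig_poly_sum (I : Type) (s : seq I) (F : I -> R -> R[i]) :
  (forall i, trig_poly (F i)) -> trig_poly (fun x => \sum_(i <- s) F i x).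
Proof.
move=> tF; elim: s => [|i s ih].
  by apply: eq_trig_poly trig_poly0 => x; rewrite big_nil.
by apply: eq_trig_poly (trig_polyD (tF i) ih) => x; rewrite big_cons.
Qed.

Lemma trig_polyM p q : (forall l m, Lambda l -> Lambda m -> Lambda (l + m)) ->
  trig_poly p -> trig_poly q -> trig_poly (fun x => p x * q x).
Proof.
move=> LD [s1 [c1 [sL1 p1]]] [s2 [c2 [sL2 p2]]].
(* [trig_poly_sum] asks for all indices, so terms off the lists are set to zero. *)
have h : trig_poly (fun x => \sum_(i <- s1) \sum_(j <- s2)
    (if (i \in s1) && (j \in s2) then c1 i * c2 j * e_ (i + j) x else 0)).
  apply: trig_poly_sum => i; apply: trig_poly_sum => j.
  have [/andP[is1 js2]|_] := boolP ((i \in s1) && (j \in s2)); last exact: trig_poly0.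
  by apply: trig_polyZ; apply: trig_poly_e; apply: LD; [exact: sL1|exact: sL2].
apply: eq_trig_poly h => x; rewrite p1 p2 big_distrl /= big_seq [RHS]big_seq.
apply: eq_bigr => i is1; rewrite big_distrr /= big_seq [RHS]big_seq.
by apply: eq_bigr => j js2; rewrite is1 js2 /= e_D; ring.
Qed.

Lemma trig_poly1 : Lambda 0 -> trig_poly (fun=> 1).
Proof. by move=> /trig_poly_e; apply: eq_trig_poly => x; rewrite e_0. Qed.

Lemma trig_polyX n p : (forall l m, Lambda l -> Lambda m -> Lambda (l + m)) ->
  Lambda 0 -> trig_poly p -> trig_poly (fun x => p x ^+ n).
Proof.
move=> LD L0 tp; elim: n => [|n ih].
  by apply: eq_trig_poly (trig_poly1 L0) => x; rewrite expr0.
by apply: eq_trig_poly (trig_polyM LD tp ih) => x; rewrite exprS.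
Qed.

Section Closure.
Variables (D : set R) (mD : measurable D).
Local Notation mu := (@lebesgue_measure R).
Hypothesis finD : (mu D < +oo)%E.
Implicit Types (f g : R -> R[i]).

Lemma L2_trig_poly p : trig_poly p -> L2 D p.
Proof.
move=> [s [c [_ ps]]]; rewrite (_ : p = fun x => \sum_(j <- s) c j * e_ j x); last exact/funext.
by apply: L2_sum => // j _; apply: L2Z => //; exact: L2_e.
Qed.

Definition approximable f := L2 D f /\
  forall e, 0 < e -> exists2 p, trig_poly p & nsq D (fun x => f x - p x) < e.

Lemma approximable_trig p : trig_poly p -> approximable p.
Proof.
move=> tp; split; first exact: L2_trig_poly.
move=> e e0; exists p => //; rewrite (_ : nsq _ _ = 0)//.
apply: (@complexI R); rewrite -inner_nsq.
transitivity (inner D (fun=> 0) (fun=> 0)); last by rewrite inner0l.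
by congr (inner D _ _); apply/funext => x; rewrite subrr.
Qed.

Lemma approximable_lim f : L2 D f ->
  (forall e, 0 < e -> exists2 g, approximable g & nsq D (fun x => f x - g x) < e) ->
  approximable f.
Proof.
move=> Lf hf; split=> // e e0; have e4 : 0 < e / 4%:R by rewrite divr_gt0.
have [g [Lg hg] fg] := hf _ e4; have [p tp gp] := hg _ e4; exists p => //.
have Lp := L2_trig_poly tp.
have := nsqD_le mD (L2B mD Lf Lg) (L2B mD Lg Lp).
under [X in nsq _ X <= _ -> _]eq_fun do rewrite addrA subrK.
move=> /le_lt_trans; apply; move: fg gp; lra.
Qed.

Lemma approximable_lin (a : R[i]) f g : approximable f -> approximable g ->
  approximable (fun x => a * f x + g x).
Proof.
move=> [Lf hf] [Lg hg]; split; first exact: L2_lin.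
move=> e e0; pose M := normc a ^+ 2 + 1.
have M0 : 0 < M by rewrite ltr_wpDl// sqr_ge0.
have e4 : 0 < e / 4%:R by rewrite divr_gt0.
have [p tp fp] := hf _ (divr_gt0 e4 M0); have [q tq gq] := hg _ e4.
exists (fun x => a * p x + q x); first by apply: trig_polyD => //; exact: trig_polyZ.
have Lp := L2_trig_poly tp; have Lq := L2_trig_poly tq.
have Lfp := L2B mD Lf Lp; have Lgq := L2B mD Lg Lq.
have := nsqD_le mD (L2Z mD a Lfp) Lgq; rewrite (nsqZ mD a Lfp).
rewrite (_ : (fun x => _ + _) = (fun x => a * f x + g x - (a * p x + q x))); last first.
  by apply/funext => x; ring.
move=> /le_lt_trans; apply.
have : normc a ^+ 2 * nsq D (fun x => f x - p x) <= M * nsq D (fun x => f x - p x).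
  by rewrite ler_wpM2r ?nsq_ge0// lerDl.
have : M * nsq D (fun x => f x - p x) < e / 4%:R by rewrite mulrC -ltr_pdivlMr.
by move: gq; lra.
Qed.

Lemma approximable0 : approximable (fun=> 0).
Proof. exact: approximable_trig trig_poly0. Qed.

Lemma approximableZ (a : R[i]) f : approximable f -> approximable (fun x => a * f x).
Proof.
move=> hf; have := approximable_lin a hf approximable0.
by under [X in approximable X -> _]eq_fun do rewrite addr0.
Qed.

Lemma approximableD f g : approximable f -> approximable g ->
  approximable (fun x => f x + g x).
Proof.
move=> hf hg; have := approximable_lin 1 hf hg.
by under [X in approximable X -> _]eq_fun do rewrite mul1r.
Qed.

Lemma approximableB f g : approximable f -> approximable g ->
  approximable (fun x => f x - g x).
Proof.
move=> hf hg; have := approximable_lin (-1) hg hf.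
by under [X in approximable X -> _]eq_fun do rewrite mulN1r addrC.
Qed.

Lemma approximable_sum (I : Type) (s : seq I) (F : I -> R -> R[i]) :
  (forall i, approximable (F i)) -> approximable (fun x => \sum_(i <- s) F i x).
Proof.
move=> tF; elim: s => [|i s ih].
  by under [X in approximable X]eq_fun do rewrite big_nil; exact: approximable0.
by under [X in approximable X]eq_fun do rewrite big_cons; exact: approximableD.
Qed.

Lemma eq_approximable f g : (forall x, D x -> f x = g x) -> approximable f -> approximable g.
Proof.
move=> fg [Lf hf]; split; first exact: eq_L2 Lf.
move=> e /hf[p tp fp]; exists p => //; rewrite (_ : nsq _ _ = nsq D (fun x => f x - p x))//.
rewrite /nsq; congr fine; apply: eq_integral => x /set_mem Dx.
by rewrite fg.
Qed.

(** Dominated convergence applied to the squared distances. *)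
Lemma dominated_approximable (v : R -> R) f (u : nat -> R -> R[i]) : L2 D f ->
  (forall n, approximable (u n)) -> Rintegrable D v ->
  (forall n x, D x -> normc (f x - u n x) ^+ 2 <= v x) ->
  {ae mu, forall x, D x -> normc (f x - u n x) ^+ 2 @[n --> \oo] --> 0} ->
  approximable f.
Proof.
move=> Lf au iv dom cvg0; apply: approximable_lim => // e e0.
pose F n x := (normc (f x - u n x) ^+ 2)%:E.
have mF n : measurable_fun D (F n).
  have [mr mi _] := L2B mD Lf (au n).1.
  exact: measurable_normc_sqr mr mi.
have [] := @dominated_convergence _ _ _ mu D mD F (cst 0%E) (EFin \o v) mF.
- exact: measurable_cst.
- apply: ae_imp cvg0 => x h Dx; apply: cvg_EFin; first by apply: nearW.
  exact: h.
- exact: iv.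
- by apply: ae_all => x n Dx; rewrite /F/= lee_fin ger0_norm ?sqr_ge0// dom.
move=> _ _; rewrite integral0 => /fine_cvgP[_].
move=> /cvgrPdist_lt/(_ _ e0)[N _ hN]; exists (u N); first exact: au.
have := hN N (leqnn N); rewrite /= sub0r normrN => /(le_lt_trans _); apply.
exact: ler_norm.
Qed.

End Closure.

End TrigonometricPolynomials.

(** * Density of trigonometric polynomials of period T *)

Section Completeness.
Variables (R : realType) (T : R).
Hypothesis T0 : 0 < T.
Local Notation mu := (@lebesgue_measure R).
Local Notation D := `]0, T[%classic.
Definition frequencies : set R := [set n%:~R / T | n in [set: int]].
Implicit Types (f g : R -> R[i]) (b x : R) (A : set R).

Lemma bernoulli_sub n (y : R) : 0 <= y <= 1 -> 1 - n%:R * y <= (1 - y) ^+ n.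
Proof.
move=> /andP[y0 y1]; elim: n => [|n ih]; first by rewrite mul0r subr0 expr0.
have y1' : 0 <= 1 - y by rewrite subr_ge0.
rewrite exprS; apply: le_trans (ler_wpM2l y1' ih).
have : 0 <= n%:R * y * y by rewrite !mulr_ge0.
rewrite -[n.+1%:R]natr1; move: (n%:R : R) => m; rewrite -subr_ge0 => h.
by rewrite -subr_ge0 (_ : _ - _ = m * y * y - 0) ?subr_ge0 ?h//; last ring.
Qed.

Lemma bernoulli_add n (y : R) : 0 <= y -> n%:R * y <= (1 + y) ^+ n.
Proof.
move=> y0; suff : 1 + n%:R * y <= (1 + y) ^+ n by apply: le_trans; rewrite lerDr.
elim: n => [|n ih]; first by rewrite mul0r addr0 expr0.
have y1' : 0 <= 1 + y by rewrite addr_ge0.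
rewrite exprS; apply: le_trans (ler_wpM2l y1' ih).
have : 0 <= n%:R * y * y by rewrite !mulr_ge0.
rewrite -[n.+1%:R]natr1; move: (n%:R : R) => m h.
by rewrite -subr_ge0 (_ : _ - _ = m * y * y); last ring.
Qed.

(* The polynomials [(1 - t^n)^(2^n)] of Brosowski and Deutsch separate
   [t < 1/2] from [t > 1/2]. *)
Definition step_poly n (t : R) := (1 - t ^+ n) ^+ (2 ^ n)%N.

Lemma step_poly_itv n t : 0 <= t <= 1 -> 0 <= step_poly n t <= 1.
Proof.
move=> /andP[t0 t1]; have tn0 : 0 <= t ^+ n by rewrite exprn_ge0.
have tn1 : t ^+ n <= 1 by rewrite exprn_ile1.
by rewrite exprn_ge0 ?exprn_ile1// ?subr_ge0// lerBlDr lerDl.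
Qed.

(** Bernoulli's inequality bounds the polynomial below by 1 - (2 t)^n. *)
Lemma step_poly_cvg1 t : 0 <= t -> t < 1 / 2 -> step_poly n t @[n --> \oo] --> (1 : R).
Proof.
move=> t0 t2; have t01 n : 0 <= t ^+ n <= 1.
  by rewrite exprn_ge0//= exprn_ile1//; move: t2; lra.
apply: (@squeeze_cvgr _ _ _ _ (fun n => 1 - (2 * t) ^+ n) (fun=> 1)).
- apply: nearW => n; have /andP[_ ->] : 0 <= step_poly n t <= 1.
    by apply: step_poly_itv; rewrite t0 /=; move: t2; lra.
  by rewrite andbT exprMn -natrX; exact: bernoulli_sub.
- rewrite -[X in _ --> X]subr0; apply: cvgB; first exact: cvg_cst.
  by apply: cvg_expr; rewrite ger0_norm ?mulr_ge0//; move: t2; lra.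
- exact: cvg_cst.
Qed.

(** The product with (1 + t^n)^(2^n) is at most 1, and that factor is at least (2 t)^n by
    Bernoulli's inequality. *)
Lemma step_poly_cvg0 t : 1 / 2 < t -> t <= 1 -> step_poly n t @[n --> \oo] --> (0 : R).
Proof.
move=> t2 t1; have t0 : 0 < t by move: t2; lra.
have t20 : 0 < 2 * t by rewrite mulr_gt0.
apply: (@squeeze_cvgr _ _ _ _ (fun=> 0) (fun n => ((2 * t)^-1) ^+ n)).
- apply: nearW => n; have /andP[-> _] : 0 <= step_poly n t <= 1.
    by apply: step_poly_itv; rewrite ltW.
  have tn0 : 0 < t ^+ n by rewrite exprn_gt0.
  have tn1 : t ^+ n <= 1 by rewrite exprn_ile1// ltW.
  have h : (2 * t) ^+ n <= (1 + t ^+ n) ^+ (2 ^ n)%N.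
    by rewrite exprMn -natrX; apply: bernoulli_add; exact: ltW.
  rewrite /= exprVn -div1r ler_pdivlMr ?exprn_gt0//.
  apply: (@le_trans _ _ (step_poly n t * (1 + t ^+ n) ^+ (2 ^ n)%N)).
    by rewrite ler_wpM2l// exprn_ge0// subr_ge0.
  rewrite /step_poly -exprMn (_ : (1 - t ^+ n) * (1 + t ^+ n) = 1 - (t ^+ n) ^+ 2); last by ring.
  apply: exprn_ile1; last by rewrite lerBlDr lerDl sqr_ge0.
  by rewrite subr_ge0; apply: exprn_ile1 => //; exact: ltW.
- exact: cvg_cst.
- apply: cvg_expr; rewrite ger0_norm ?invr_ge0 ?ltW// invf_lt1//.
  by move: t2; lra.
Qed.

(** It crosses the level 1/2 at b. Each sine has only half the basic frequency, but their product
    contains just the frequencies 0 and 1/T up to sign, so the function has period T. *)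
Definition separator b x : R := 1 / 2 + sin (pi / T * x) * sin (pi / T * (x - b)) / 2.

Lemma separator_itv b x : 0 <= separator b x <= 1.
Proof.
have : `|sin (pi / T * x) * sin (pi / T * (x - b))| <= 1.
  by rewrite normrM mulr_ile1// sin_max.
by rewrite ler_norml /separator => /andP[? ?]; apply/andP; split; lra.
Qed.

Lemma sin_pi_gt0 (y : R) : 0 < y < T -> 0 < sin (pi / T * y).
Proof.
move=> /andP[y0 yT]; apply: sin_gt0_pi; rewrite !mulr_gt0 ?pi_gt0 ?invr_gt0//=.
by rewrite mulrAC -mulrA gtr_pMr ?pi_gt0// ltr_pdivrMr// mul1r.
Qed.

Lemma separator_lt b x : 0 < b < T -> 0 < x < b -> separator b x < 1 / 2.
Proof.
move=> /andP[b0 bT] /andP[x0 xb].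
have s1 : 0 < sin (pi / T * x) by apply: sin_pi_gt0; rewrite x0 (lt_trans xb).
have s2 : 0 < sin (pi / T * (b - x)) by apply: sin_pi_gt0; apply/andP; split; lra.
have -> : separator b x = 1 / 2 - sin (pi / T * x) * sin (pi / T * (b - x)) / 2.
  by rewrite /separator -[x - b]opprB mulrN sinN; ring.
by rewrite ltrBlDr ltrDl divr_gt0// mulr_gt0.
Qed.

Lemma separator_gt b x : 0 < b < T -> b < x < T -> 1 / 2 < separator b x.
Proof.
move=> /andP[b0 bT] /andP[bx xT].
have s1 : 0 < sin (pi / T * x) by apply: sin_pi_gt0; rewrite xT (lt_trans b0).
have s2 : 0 < sin (pi / T * (x - b)) by apply: sin_pi_gt0; apply/andP; split; lra.
by rewrite ltrDl divr_gt0// mulr_gt0.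
Qed.

Lemma frequenciesD l m : frequencies l -> frequencies m -> frequencies (l + m).
Proof. by move=> [i _ <-] [j _ <-]; exists (i + j) => //; rewrite intrD mulrDl. Qed.

Lemma frequencies0 : frequencies 0.
Proof. by exists 0 => //; rewrite mul0r. Qed.

Lemma trig_poly_separator b : trig_poly frequencies (fun x => (separator b x)%:C).
Proof.
(* The product of sines is half a difference of cosines, whence the 1/4 in the constant term;
   writing the second cosine with exponentials gives the 1/8. *)
pose a := expi (pi * b / T).
have Fp : frequencies T^-1 by exists 1 => //; rewrite mul1r.
have Fm : frequencies (- T^-1) by exists (-1) => //; rewrite mulN1r.
have h1 := trig_polyZ (- (1 / 8%:R) * Num.conj a) (trig_poly_e Fp).
have h2 := trig_polyZ (- (1 / 8%:R) * a) (trig_poly_e Fm).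
have h0 := trig_polyZ ((1 / 2 + cos (pi * b / T) / 4%:R)%:C) (trig_poly1 frequencies0).
apply: eq_trig_poly (trig_polyD h0 (trig_polyD h1 h2)) => x.
have E : sin (pi / T * x) * sin (pi / T * (x - b)) =
   (cos (pi * b / T) - cos (2 * pi * T^-1 * x - pi * b / T)) / 2.
  set u := pi / T * x; set v := pi / T * (x - b).
  rewrite (_ : pi * b / T = u - v); last by rewrite /u /v; ring.
  rewrite (_ : 2 * pi * T^-1 * x - (u - v) = u + v); last by rewrite /u /v; ring.
  by rewrite cosB cosD; field.
have a8 : (1 / 8%:R : R[i]) = (1 / 8%:R : R)%:C by rewrite fmorph_div rmorph1 rmorph_nat.
rewrite /separator E cosB e_N /e_ /a /expi a8; apply: eqReIm; rewrite !ReImE /=; by field.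
Qed.

Lemma period_fin : (mu D < +oo)%E. Proof. exact: itvoo_fin. Qed.

Local Notation appr := (approximable frequencies D).

Definition cindic A x : R[i] := (\1_A x : R)%:C.

Lemma L2_cindic A : measurable A -> L2 D (cindic A).
Proof.
move=> mA; apply: (@L2_bounded _ _ _ 1) => //; first exact: period_fin.
  by split => /=; [exact: measurable_indic|exact: measurable_cst].
by move=> x _; rewrite normc_real indicE ger0_norm// lern1 leq_b1.
Qed.

Lemma normc_sqr_real_le (u v : R) : 0 <= u <= 1 -> 0 <= v <= 1 -> normc (u%:C - v%:C) ^+ 2 <= 1.
Proof.
move=> /andP[u0 u1] /andP[v0 v1]; rewrite -rmorphB normc_real real_normK ?num_real//.
rewrite -subr_ge0 (_ : 1 - _ = (1 - (u - v)) * (1 + (u - v))); last by ring.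
by apply: mulr_ge0; lra.
Qed.

Lemma approximable_ray b : 0 < b < T -> appr (cindic `]-oo, b[).
Proof.
move=> b0T; pose u n x := (step_poly n (separator b x))%:C : R[i].
apply: (@dominated_approximable _ _ D _ period_fin (cst 1) _ u) => //.
- exact: L2_cindic.
- move=> n; apply: approximable_trig => //; first exact: period_fin.
  have h1 := trig_poly1 frequencies0.
  have h2 := trig_polyX n frequenciesD frequencies0 (trig_poly_separator b).
  have h3 := trig_polyX (2 ^ n)%N frequenciesD frequencies0 (trig_polyD h1 (trig_polyZ (-1) h2)).
  apply: eq_trig_poly h3 => x.
  by rewrite /u /step_poly rmorphXn rmorphB rmorph1 rmorphXn mulN1r.
- exact: (L2_cintegrable (measurable_itv _) period_fin (L2_cst 1 (measurable_itv _) period_fin)).1.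
- move=> n x _; apply: normc_sqr_real_le; last exact/step_poly_itv/separator_itv.
  by rewrite indicE ler0n lern1 leq_b1.
(* At b the separator equals 1/2, where neither convergence lemma applies. *)
- have : {ae mu, forall x, x <> b}.
    exists [set b]; split => //; first exact: lebesgue_measure_set1.
    by move=> x /= /contrapT.
  apply: ae_imp => x xb /=; rewrite in_itv/= => /andP[x0 xT].
  have -> : (fun n => normc (cindic `]-oo, b[ x - u n x) ^+ 2) =
      fun n => (\1_`]-oo, b[ x - step_poly n (separator b x)) ^+ 2.
    by apply/funext => n; rewrite /cindic /u -rmorphB normc_real real_normK ?num_real.
  rewrite -[X in _ --> X](mulr0 0); under eq_fun do rewrite expr2.
  have /andP[s0 s1] := separator_itv b x.
  suff h : \1_`]-oo, b[ x - step_poly n (separator b x) @[n --> \oo] --> (0 : R).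
    exact: (cvgM h h).
  case: (ltgtP x b) => [xlt|xgt|//].
    rewrite indicE mem_set/= ?in_itv//= -[X in _ --> X](subrr 1).
    by apply: cvgB; [exact: cvg_cst|apply: step_poly_cvg1 => //; apply: separator_lt => //; rewrite x0].
  rewrite indicE memNset/= ?in_itv/=; last by apply/negP; rewrite -leNgt ltW.
  rewrite -[X in _ --> X](subrr 0).
  by apply: cvgB; [exact: cvg_cst|apply: step_poly_cvg0 => //; apply: separator_gt => //; rewrite xgt].
Qed.

Lemma cindicC A x : cindic (~` A) x = 1 - cindic A x.
Proof.
rewrite /cindic !indicE in_setC.
by case: (x \in A); apply: eqReIm; rewrite !ReImE /=; ring.
Qed.

Lemma approximable_cst (c : R[i]) : appr (fun=> c).
Proof.
have := trig_polyZ c (trig_poly1 frequencies0).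
under [X in trig_poly _ X -> _]eq_fun do rewrite mulr1.
by apply: approximable_trig => //; exact: period_fin.
Qed.

(** Open left rays are stable under intersection and generate the Borel sets, while approximable
    indicators are stable under complement and countable disjoint union, so Dynkin's theorem
    applies. Rays ending outside the period are constant on it. *)
Lemma approximable_cindic A : measurable A -> appr (cindic A).
Proof.
have mD : measurable D by exact: measurable_itv.
have mE : @measurable _ (measurableTypeR R) = <<s RGenInftyO.G (R:=R) >>.
  exact: RGenInftyO.measurableE.
move=> mA; have sA : <<s RGenInftyO.G (R:=R) >> A by rewrite -mE.
apply: (@dynkin_induction _ (measurableTypeR R) (RGenInftyO.G (R:=R))
  (fun A => appr (cindic A)) mE) sA.
- move=> _ _ [x ->] [y ->]; exists (Num.min x y).
  by apply/seteqP; split=> t /=; rewrite !in_itv/= lt_min => /andP.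
- have := approximable_cst 1; apply: eq_approximable => // x _.
  by rewrite /cindic indicT.
- move=> _ [b ->]; have [b0|b0] := leP b 0.
    have := approximable_cst 0; apply: eq_approximable => // x /=.
    rewrite in_itv/= => /andP[x0 _]; rewrite /cindic indicE memNset//= in_itv/=.
    by apply/negP; rewrite -leNgt (le_trans b0)// ltW.
  have [bT|Tb] := ltP b T; first by apply: approximable_ray; rewrite b0.
  have := approximable_cst 1; apply: eq_approximable => // x /=.
  rewrite in_itv/= => /andP[_ xT]; rewrite /cindic indicE mem_set//= in_itv/=.
  exact: lt_le_trans xT Tb.
- move=> S mS aS; have := approximableB mD period_fin (approximable_cst 1) aS.
  by apply: eq_approximable => // x _; rewrite cindicC.
- move=> F mF tF aF; pose G n := \big[setU/set0]_(k < n) F k.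
  have aG n : appr (cindic (G n)).
    elim: n => [|n ih].
      have := approximable_cst 0; apply: eq_approximable => // x _.
      by rewrite /cindic /G big_ord0 indicE in_set0.
    have := approximableD mD period_fin ih (aF n); apply: eq_approximable => // x _.
    rewrite /G big_ord_recr /= /cindic -rmorphD; congr (_%:C).
    rewrite !indicE in_setU; case: (boolP (x \in F n)) => [/set_mem xn|_]; last by rewrite orbF addr0.
    rewrite memNset ?add0r//= -bigcup_mkord => -[k /= kn xk].
    by have := tF k n I I (ex_intro _ x (conj xk xn)) => kE; rewrite kE ltnn in kn.
  apply: (@dominated_approximable _ _ D mD period_fin (cst 1) _ (fun n => cindic (G n))) => //.
  + by apply: L2_cindic; exact: bigcupT_measurable.
  + exact: (L2_cintegrable (measurable_itv _) period_fin (L2_cst 1 (measurable_itv _) period_fin)).1.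
  + by move=> n x _; apply: normc_sqr_real_le; rewrite indicE ler0n lern1 leq_b1.
  + apply: ae_all => x _; apply: cvg_near_cst.
    have [[k _ xk]|xF] := pselect ((\bigcup_k F k) x).
      near=> n; rewrite /cindic !indicE !mem_set; first by rewrite subrr normc0 expr0n.
        rewrite /G -bigcup_mkord; exists k => //=; near: n; exact: nbhs_infty_gt.
      by exists k.
    near=> n; rewrite /cindic !indicE !memNset//; first by rewrite subrr normc0 expr0n.
    by rewrite /G -bigcup_mkord => -[k _ xk]; apply: xF; exists k.
Unshelve. all: by end_near. Qed.

Import HBNNSimple.

(** Simple functions increase to [u] from below, so the squared distances are dominated by
    [u ^+ 2]. *)
Lemma approximable_nneg (u : R -> R) : sqintegrable D u -> (forall x, D x -> 0 <= u x) ->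
  appr (fun x => (u x)%:C).
Proof.
have mD : measurable (D : set (measurableTypeR R)) by exact: measurable_itv.
move=> [mu1 iu] u0.
have mf : measurable_fun D (EFin \o u : measurableTypeR R -> \bar R) by exact/measurable_EFinP.
pose g n := nnsfun_approx mD mf n.
have gle n x : D x -> 0 <= g n x <= u x.
  move=> Dx; apply/andP; split; first exact: fun_ge0.
  by rewrite -lee_fin /g nnsfun_approxE; apply: le_approx => // y Dy; rewrite lee_fin u0.
have Lu : L2 D (fun x => (u x)%:C).
  by apply/L2P => //; split => //=; exact: sqintegrable0.
apply: (@dominated_approximable _ _ D mD period_fin (fun x => u x ^+ 2) _ (fun n x => (g n x)%:C)) => //.
- move=> n; have mg y : measurable (g n @^-1` [set y]) by exact: measurable_sfunP.
  have := approximable_sum mD period_fin (finmap.enum_fset (fset_set (range (g n))))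
    (fun y => approximableZ mD period_fin y%:C (approximable_cindic (mg y))).
  apply: eq_approximable => // x _; rewrite fimfunE fsbig_finite//= rmorph_sum.
  by apply: eq_bigr => y _; rewrite rmorphM.
- move=> n x Dx; have /andP[g0 gu] := gle n x Dx.
  rewrite -rmorphB normc_real real_normK ?num_real//.
  by rewrite lerXn2r ?nnegrE ?subr_ge0 ?u0// lerBlDr lerDl.
- apply: ae_all => x Dx.
  have h : g n x @[n --> \oo] --> u x.
    have uE y : D y -> (0 <= (EFin \o u) y)%E by move=> Dy; rewrite lee_fin u0.
    by have /fine_cvgP[] := cvg_nnsfun_approx mD mf uE Dx.
  rewrite (_ : (fun n => _) = fun n => (u x - g n x) ^+ 2); last first.
    by apply/funext => n; rewrite -rmorphB normc_real real_normK ?num_real.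
  rewrite -[X in _ --> X](mulr0 0); under eq_fun do rewrite expr2.
  by apply: cvgM; rewrite -[X in _ --> X](subrr (u x)); apply: cvgB => //; exact: cvg_cst.
Qed.

Lemma sqintegrable_max0 (u : R -> R) : sqintegrable D u ->
  sqintegrable D (fun x => Num.max (u x) 0).
Proof.
move=> [mu1 iu]; apply: (@sqintegrable_le _ _ _ 1 _ u) => //.
  by apply: measurable_maxr => //; exact: measurable_cst.
move=> x _; rewrite mul1r; case: (leP (u x) 0) => h; first by rewrite normr0.
by [].
Qed.

Lemma approximable_real (u : R -> R) : sqintegrable D u -> appr (fun x => (u x)%:C).
Proof.
have mD : measurable D by exact: measurable_itv.
move=> su; have sn : sqintegrable D (fun x => -1 * u x) by exact: sqintegrableZ.
have m0 v : 0 <= Num.max v (0 : R) by rewrite le_max lexx orbT.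
have h1 := approximable_nneg (sqintegrable_max0 su) (fun x _ => m0 (u x)).
have h2 := approximable_nneg (sqintegrable_max0 sn) (fun x _ => m0 (-1 * u x)).
have := approximableB mD period_fin h1 h2; apply: eq_approximable => // x _.
rewrite -rmorphB mulN1r; congr (_%:C).
by case: (leP (u x) 0) => h; case: (leP (- u x) 0) => h'; lra.
Qed.

Theorem fourier_complete f : L2 D f -> appr f.
Proof.
have mD : measurable D by exact: measurable_itv.
move=> /(L2P mD)[rf jf].
have := approximableD mD period_fin (approximable_real rf)
  (approximableZ mD period_fin 'i%C (approximable_real jf)).
by apply: eq_approximable => // x _; apply: eqReIm; rewrite !ReImE /=; ring.
Qed.

End Completeness.

(** * Translation invariance and extension by zero *)

Section ShiftAndCut.
Variable R : realType.
Local Notation mu := (@lebesgue_measure R).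
Implicit Types (D E : set R) (f g : R -> R[i]) (c : R).

Lemma lebesgue_measure_shift c (A : set R) : measurable A ->
  pushforward mu ((fun x => x + c) : measurableTypeR R -> measurableTypeR R) A = mu A.
Proof.
have mc : measurable_fun setT ((fun x => x + c) : measurableTypeR R -> measurableTypeR R).
  by apply: measurable_funD => //; exact: measurable_cst.
move=> mA; apply/esym/lebesgue_measure_unique => //= _ [[a b]] _ <-.
rewrite /pushforward (_ : _ @^-1` _ = `]a - c, b - c]%classic); last first.
  by apply/seteqP; split=> x /=; rewrite !in_itv/= ltrBlDr lerBrDr.
rewrite [LHS]lebesgue_measure_itv /= lebesgue_measure_itv /= !lte_fin ltrD2r.
by case: ifP => // _; rewrite -!EFinD; congr EFin; ring.
Qed.

Lemma ge0_integral_shift c D (f : R -> \bar R) : measurable D -> measurable_fun D f ->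
  (forall x, D x -> (0 <= f x)%E) ->
  (\int[mu]_(x in D) f x = \int[mu]_(x in [set x : R | D (x + c)%R]) f (x + c)%R)%E.
Proof.
move=> mD mf f0.
have mc : measurable_fun setT ((fun x => x + c) : measurableTypeR R -> measurableTypeR R).
  by apply: measurable_funD => //; exact: measurable_cst.
have := @ge0_integral_pushforward _ _ (measurableTypeR R) (measurableTypeR R) R
  (fun x => x + c) mc mu D f mD mf (fun x xD => f0 x (set_mem xD)).
move=> <-; apply: eq_measure_integral => A mA AD.
by rewrite [RHS]lebesgue_measure_shift.
Qed.

Lemma normsq_shift c D f : measurable D -> cmeasurable D f ->
  normsq D f = normsq [set x | D (x + c)] (fun x => f (x + c)).
Proof.
move=> mD [mr mi]; rewrite /normsq (ge0_integral_shift c)//.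
  exact: measurable_normc_sqr.
by move=> x _; rewrite lee_fin sqr_ge0.
Qed.

Lemma measurable_shift c D : measurable D -> measurable [set x | D (x + c)].
Proof.
move=> mD; rewrite -[X in measurable X]setTI.
have mc : measurable_fun setT (fun x : R => x + c).
  by apply: measurable_funD => //; exact: measurable_cst.
exact: mc.
Qed.

Lemma cmeasurable_shift c D f : measurable D -> cmeasurable D f ->
  cmeasurable [set x | D (x + c)] (fun x => f (x + c)).
Proof.
move=> mD [mr mi].
have mc E : measurable_fun E (fun x : R => x + c).
  by apply: measurable_funD => //; exact: measurable_cst.
by split; [apply: (measurable_comp mD _ mr)|apply: (measurable_comp mD _ mi)] => //;
  move=> _ [x + <-].
Qed.

Lemma L2_shift c D f : measurable D -> L2 D f ->
  L2 [set x | D (x + c)] (fun x => f (x + c)).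
Proof.
move=> mD Lf; have mf := L2_cmeasurable Lf; have [mr mi] := cmeasurable_shift c mD mf.
by split=> //; rewrite -normsq_shift//; case: Lf.
Qed.

(** A representative is uncontrolled outside [D], where it may even fail to be measurable; it is cut
    off before being composed with maps of the line. *)
Definition cut D f x : R[i] := if x \in D then f x else 0.

Lemma cutE D f x : D x -> cut D f x = f x.
Proof. by move=> Dx; rewrite /cut mem_set. Qed.

Lemma cmeasurable_cut D E f : measurable D -> measurable E -> cmeasurable D f ->
  cmeasurable E (cut D f).
Proof.
move=> mD mE [mr mi].
have ED : E `&` D `<=` D by move=> x [].
split.
  have := (measurable_restrict (fun x => Re (f x)) mD mE).1 (measurable_funS mD ED mr).
  by congr measurable_fun; apply/funext => x; rewrite patchE /cut; case: ifP.
have := (measurable_restrict (fun x => Im (f x)) mD mE).1 (measurable_funS mD ED mi).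
by congr measurable_fun; apply/funext => x; rewrite patchE /cut; case: ifP.
Qed.

Lemma L2_cut D E f : measurable D -> measurable E -> D `<=` E -> L2 D f -> L2 E (cut D f).
Proof.
move=> mD mE DE Lf.
have mc := cmeasurable_cut mD mE (L2_cmeasurable Lf).
have [mr mi] := mc; split => //.
have -> : normsq E (cut D f) = normsq D f.
  rewrite -[in LHS](setDUK DE) normsq_setU//; first last.
  - by rewrite setDUK.
  - by apply/disj_setPS => x [Dx []].
  - exact: measurableD.
  rewrite [X in (_ + X)%E](_ : _ = 0%E) ?adde0.
    by apply: eq_integral => x /set_mem Dx; rewrite cutE.
  rewrite /normsq (eq_integral (cst 0%E)) ?integral0// => x /set_mem[_ nDx].
  by rewrite /cut memNset// normc0 expr0n.
by case: Lf.
Qed.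

(** Covers domains that miss part of the period, such as ]0, w[ together with ]w, 1[. *)
Lemma fourier_complete_sub (T : R) D f : 0 < T -> measurable D -> D `<=` `]0, T[ ->
  L2 D f -> forall e, 0 < e ->
  exists2 p, trig_poly (frequencies T) p & nsq D (fun x => f x - p x) < e.
Proof.
move=> T0 mD DT Lf e e0.
have mI : measurable (`]0, T[%classic : set R) by exact: measurable_itv.
have [_ /(_ _ e0)[p tp fp]] := fourier_complete T0 (L2_cut mD mI DT Lf).
exists p => //; apply: le_lt_trans fp.
have Lp : L2 `]0, T[ p by apply: (L2_trig_poly mI _ tp); exact: itvoo_fin.
apply: le_trans (nsq_subset mI mD DT (L2B mI (L2_cut mD mI DT Lf) Lp)).
rewrite /nsq (_ : normsq D _ = normsq D (fun x => cut D f x - p x))//.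
by apply: eq_integral => x /set_mem Dx; rewrite cutE.
Qed.

End ShiftAndCut.

(** * The two families of spectra *)

Section Spectra.
Variables (R : realType) (w rho : R).
Local Notation mu := (@lebesgue_measure R).
Hypotheses (w0 : 0 < w) (w1 : w < 1) (rho0 : 0 < rho).
Local Notation Omega := (two_intervals w rho).
Local Notation I1 := `]0, w[%classic.
Local Notation I2 := `]w + rho, 1 + rho[%classic.
Local Notation Z := [set x : R | x \is a Num.int].
Implicit Types (f g : R -> R[i]) (l m : R).

Let mO := @measurable_two_intervals R w rho.
Let Le := L2_e_two w0 w1 rho0.

Lemma onb_of_total (Lambda : set R) :
  (forall l m, Lambda l -> Lambda m -> l != m ->
     e_ (l - m) w + e_ (l - m) (1 + rho) = 1 + e_ (l - m) (w + rho)) ->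
  (forall f, L2 Omega f -> forall e, 0 < e ->
     exists2 p, trig_poly Lambda p & nsq Omega (fun x => f x - p x) < e) ->
  orthonormal_basis Omega Lambda (@e_ R).
Proof.
move=> orth tot; split => [l _|l m Ll Lm|f Lf e e0]; first exact: Le.
  have [->|lm] := eqVneq l m; first by rewrite inner_e_diag// eqxx.
  by rewrite (e_orthogonal w0 w1 rho0 lm).2 ?orth.
have [p [s [c [sL ps]]] fp] := tot f Lf e e0; exists s, c; split=> //.
have Ls : L2 Omega (fun x => \sum_(j <- s) c j * e_ j x).
  by apply: L2_sum => // l _; exact: L2Z.
rewrite nsqE; last exact: L2B.
rewrite lte_fin; move: fp; congr (nsq _ _ < _); apply/funext => x.
by rewrite ps.
Qed.

Lemma L2_I2_shift c f : L2 I2 f ->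
  L2 `]w + rho - c, 1 + rho - c[ (fun x => f (x + c)).
Proof.
move=> /(L2_shift c (measurable_itv _)); congr L2; apply/seteqP; split=> x /=;
  by rewrite !in_itv/= ltrBlDr ltrBrDr.
Qed.

Lemma nsq_I2_shift c f : L2 I2 f ->
  nsq I2 f = nsq `]w + rho - c, 1 + rho - c[ (fun x => f (x + c)).
Proof.
move=> Lf; rewrite /nsq (normsq_shift c)//; last exact: L2_cmeasurable Lf.
congr (fine (normsq _ _)); apply/seteqP; split=> x /=;
  by rewrite !in_itv/= ltrBlDr ltrBrDr.
Qed.

Lemma e_intr l x : l \is a Num.int -> x \is a Num.int -> e_ l x = 1.
Proof. by move=> li xi; apply/e_eq1; exact: rpredM. Qed.

(** Moving the second interval back by rho fills the unit interval up to the point w, and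
    exponentials of integer frequency are unchanged by this integer translation. *)
Lemma spectrum_Z : rho \is a Num.int -> orthonormal_basis Omega Z (@e_ R).
Proof.
move=> rhoZ; apply: onb_of_total => [l m lZ mZ _|f Lf e e0].
  have lmZ : l - m \is a Num.int by exact: rpredB.
  have e1 : e_ (l - m) 1 = 1 by apply: e_intr => //; exact: rpred1.
  rewrite (e_DR _ 1) (e_DR _ w) (e_intr lmZ rhoZ) e1 !mulr1; exact: addrC.
pose ft x := if x < w then f x else f (x + rho).
pose J1 := `]0, w[%classic : set R; pose J2 := `]w, 1[%classic : set R.
have Lf2 : L2 J2 (fun x => f (x + rho)).
  have := L2_I2_shift rho (L2_two2 Lf); congr L2; by rewrite !addrK.
have ft1 x : J1 x -> f x = ft x by rewrite /J1/= in_itv/= /ft => /andP[_ ->].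
have ft2 x : J2 x -> f (x + rho) = ft x.
  by rewrite /J2/= in_itv/= /ft => /andP[xw _]; rewrite ltNge (ltW xw).
have dJ : [disjoint J1 & J2].
  apply/disj_setPS => x []; rewrite /J1 /J2 /= !in_itv/= => /andP[_ xw] /andP[wx _].
  by have := lt_trans xw wx; rewrite ltxx.
have L1 : L2 J1 ft by apply: eq_L2 (L2_two1 Lf) => x; exact: ft1.
have L2' : L2 J2 ft by apply: eq_L2 Lf2 => x; exact: ft2.
have Lft : L2 (J1 `|` J2) ft.
  exact: (L2_setU (measurable_itv _) (measurable_itv _) dJ L1 L2').
have mJ : measurable (J1 `|` J2) by apply: measurableU; exact: measurable_itv.
have JI : J1 `|` J2 `<=` `]0, 1[%classic.
  move=> x [|]; rewrite /J1 /J2 /= !in_itv/= => /andP[h1 h2].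
    by rewrite h1 (lt_trans h2).
  by rewrite h2 (lt_trans w0).
have [p tp fp] := fourier_complete_sub (@ltr01 R) mJ JI Lft e0.
have tpZ : trig_poly Z p.
  have [s [c [sL ps]]] := tp; exists s, c; split=> // j /sL[n _ <-].
  by rewrite divr1 /=; exact: intr_int.
exists p => //; apply: le_lt_trans fp.
have Lp : L2 Omega p by apply: (L2_trig_poly mO (two_intervals_fin w0 w1 rho0) tp).
have prho x : p (x + rho) = p x.
  have [s [c [sL ps]]] := tpZ; rewrite !ps; rewrite big_seq [RHS]big_seq.
  by apply: eq_bigr => j /sL jZ; rewrite e_DR (e_intr jZ rhoZ) mulr1.
have LfB : L2 Omega (fun x => f x - p x) := L2B mO Lf Lp.
rewrite nsq_two// (nsq_I2_shift rho (L2_two2 LfB)) !addrK.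
have Lpj E : measurable E -> (mu E < +oo)%E -> L2 E p.
  by move=> mE fE; exact: (L2_trig_poly mE fE tp).
have finJ : (mu (J1 `|` J2) < +oo)%E.
  by apply: le_lt_trans (itvoo_fin 0 1); apply: le_mu => //; exact: measurable_itv.
have LB : L2 (J1 `|` J2) (fun x => ft x - p x) by apply: L2B => //; exact: Lpj.
have LB1 := L2_subset mJ (measurable_itv _) (@subsetUl _ J1 J2) LB.
have LB2 := L2_subset mJ (measurable_itv _) (@subsetUr _ J1 J2) LB.
rewrite (_ : nsq (J1 `|` J2) _ = nsq J1 (fun x => ft x - p x) + nsq J2 (fun x => ft x - p x)).
  apply: lerD; rewrite le_eqVlt; apply/orP; left; apply/eqP; rewrite /nsq; congr fine;
    apply: eq_integral => x /set_mem xJ.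
    by rewrite ft1.
  by rewrite prho ft2.
apply: EFin_inj; rewrite EFinD -!nsqE//.
exact: (normsq_setU (measurable_itv _) (measurable_itv _) dJ (L2_cmeasurable LB)).
Qed.

Definition half_spectrum (r : R) : set R :=
  [set s + 2 * j%:~R | s in [set 0; r] & j in [set: int]].

Lemma half_spectrumP r x : half_spectrum r x <->
  (exists j : int, x = 2 * j%:~R) \/ (exists j : int, x = r + 2 * j%:~R).
Proof.
split=> [[s [->|->] [j _ <-]]|[[j ->]|[j ->]]].
- by left; exists j; rewrite add0r.
- by right; exists j.
- by exists 0; [left|exists j => //; rewrite add0r].
- by exists r; [right|exists j].
Qed.

Lemma e_even (j n : int) : e_ (2 * j%:~R) (n%:~R / 2) = 1 :> R[i].
Proof.
apply/e_eq1; rewrite (_ : 2 * j%:~R * (n%:~R / 2) = (j * n)%:~R) ?intr_int//.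
by rewrite intrM; field.
Qed.

(** The product of frequency and point is k + 1/2. Hence [e_ r] is odd under translation by l/2,
    while the frequencies in 2Z are even. *)
Lemma e_r_half (l : int) k : l != 0 -> e_ ((2 * k + 1)%:~R / l%:~R) (l%:~R / 2) = -1 :> R[i].
Proof.
move=> l0; apply/e_eqN1; rewrite (_ : _ - _ = k%:~R) ?intr_int//.
rewrite intrD intrM; field.
by rewrite intr_eq0.
Qed.

Lemma half_spectrum_orth (l k : int) (x y : R) : l != 0 ->
  let r := (2 * k + 1)%:~R / l%:~R in
  half_spectrum r x -> half_spectrum r y ->
  e_ (x - y) (1 / 2) + e_ (x - y) ((l + 1)%:~R / 2) = 1 + e_ (x - y) (l%:~R / 2) :> R[i].
Proof.
move=> l0 r; have er : e_ r (l%:~R / 2) = -1 :> R[i] by exact: e_r_half.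
have el1 a : e_ a ((l + 1)%:~R / 2) = e_ a (l%:~R / 2) * e_ a (1 / 2) :> R[i].
  by rewrite -e_DR; congr e_; rewrite intrD; field.
have e1 (j : int) : e_ (2 * j%:~R) (1 / 2) = 1 :> R[i] by have := e_even j 1.
have el (j : int) : e_ (2 * j%:~R) (l%:~R / 2) = 1 :> R[i] by exact: e_even.
have eNl : e_ (- r) (l%:~R / 2) = -1 :> R[i] by rewrite e_N er rmorphN rmorph1.
move=> /half_spectrumP[[i ->]|[i ->]] /half_spectrumP[[j ->]|[j ->]]; rewrite el1.
- rewrite -mulrBr -intrB el e1 mulr1; reflexivity.
- rewrite (_ : _ - _ = 2 * (i - j)%:~R + - r); last by rewrite intrB; ring.
  rewrite (e_D (2 * _) (- r)) (e_D (2 * _) (- r)) el e1 eNl; ring.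
- rewrite (_ : _ - _ = 2 * (i - j)%:~R + r); last by rewrite intrB; ring.
  rewrite (e_D (2 * _) r) (e_D (2 * _) r) el e1 er; ring.
- rewrite (_ : _ - _ = 2 * (i - j)%:~R); last by rewrite intrB; ring.
  rewrite el e1 mulr1; reflexivity.
Qed.

Lemma spectrum_half (l k : int) : w = 1 / 2 -> w + rho = l%:~R / 2 -> l != 0 ->
  orthonormal_basis Omega (half_spectrum ((2 * k + 1)%:~R / l%:~R)) (@e_ R).
Proof.
move=> wE wrho l0; set r := _ / _.
have orho : 1 + rho = (l + 1)%:~R / 2.
  by rewrite intrD mulrDl -wrho wE; field.
apply: onb_of_total => [x y xr yr _|f Lf e e0].
  have := half_spectrum_orth l0 xr yr; rewrite -orho -wrho.
  by rewrite (_ : e_ (x - y) (1 / 2) = e_ (x - y) w)// wE.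
pose h := l%:~R / 2 : R.
have I2E : `]w + rho - h, 1 + rho - h[%classic = I1.
  by rewrite wrho orho /h subrr wE intrD mulrDl addrAC subrr add0r.
have Lf1 := L2_two1 Lf.
have Lf2 : L2 I1 (fun x => f (x + h)) by rewrite -I2E; apply: L2_I2_shift; exact: L2_two2.
have mI : measurable I1 by exact: measurable_itv.
(* The even component, and in [q] the odd component divided by [e_ r]. Both are then expanded on an
   interval of length 1/2, that is with frequencies in 2Z. *)
pose p x := (1 / 2) * f x + (1 / 2) * f (x + h).
pose q x := e_ (- r) x * ((1 / 2) * f x - (1 / 2) * f (x + h)).
have Lp : L2 I1 p by exact: (L2D mI (L2Z mI (1 / 2) Lf1) (L2Z mI (1 / 2) Lf2)).
have Lq : L2 I1 q.
  exact: (L2_eM (- r) mI (L2B mI (L2Z mI (1 / 2) Lf1) (L2Z mI (1 / 2) Lf2))).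
(* Two intervals, each with a bound 2 (e/8 + e/8), give e. *)
have e8 : 0 < e / 8%:R by rewrite divr_gt0.
have sub : I1 `<=` `]0, 1 / 2[ by rewrite wE.
have half0 : 0 < 1 / 2 :> R by rewrite divr_gt0.
have [P tP pP] := fourier_complete_sub half0 mI sub Lp e8.
have [Q tQ qQ] := fourier_complete_sub half0 mI sub Lq e8.
have freqE j : frequencies (1 / 2) j -> exists n : int, j = 2 * n%:~R :> R.
  by move=> [n _ <-]; exists n; field.
have per (S : R -> R[i]) x : trig_poly (frequencies (1 / 2)) S -> S (x + h) = S x.
  move=> [s [c [sL ps]]]; rewrite !ps; rewrite big_seq [RHS]big_seq.
  apply: eq_bigr => j /sL/freqE[n ->].
  by rewrite e_DR e_even mulr1.
have tP' : trig_poly (half_spectrum r) P.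
  have [s [c [sL ps]]] := tP; exists s, c; split=> // j /sL/freqE[n ->].
  by apply/half_spectrumP; left; exists n.
have tQ' : trig_poly (half_spectrum r) (fun x => e_ r x * Q x).
  have [s [c [sL ps]]] := tQ.
  have hs : trig_poly (half_spectrum r) (fun x => \sum_(i <- s) (if i \in s then c i * e_ (r + i) x else 0)).
    apply: trig_poly_sum => i; have [/sL/freqE[n ->]|_] := boolP (i \in s); last exact: trig_poly0.
    by apply: trig_polyZ; apply: trig_poly_e; apply/half_spectrumP; right; exists n.
  apply: eq_trig_poly hs => x; rewrite ps big_distrr /= big_seq [RHS]big_seq.
  by apply: eq_bigr => i ->; rewrite e_D; ring.
exists (fun x => P x + e_ r x * Q x); first exact: trig_polyD.
have tPQ := trig_polyD tP' tQ'.
have LPQ : L2 Omega (fun x => P x + e_ r x * Q x).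
  exact: (L2_trig_poly mO (two_intervals_fin w0 w1 rho0) tPQ).
have LB := L2B mO Lf LPQ.
rewrite nsq_two// (nsq_I2_shift h (L2_two2 LB)) I2E.
have fI1 : (mu I1 < +oo)%E by exact: itvoo_fin.
have LpP := L2B mI Lp (L2_trig_poly mI fI1 tP).
have LqQ := L2B mI Lq (L2_trig_poly mI fI1 tQ).
have LeqQ := L2_eM r mI LqQ.
have eqn : nsq I1 (fun x => e_ r x * (q x - Q x)) = nsq I1 (fun x => q x - Q x).
  rewrite /nsq; congr fine; apply: eq_integral => x _.
  by rewrite normcM normc_e mul1r.
have ee x : e_ r x * e_ (- r) x = 1 by rewrite e_N e_J.
have erh x : e_ r (x + h) = - e_ r x by rewrite e_DR e_r_half// mulrN1.
have b1 : nsq I1 (fun x => f x - (P x + e_ r x * Q x)) <=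
    (nsq I1 (fun x => p x - P x) + nsq I1 (fun x => e_ r x * (q x - Q x))) *+ 2.
  apply: le_trans (nsqD_le mI LpP LeqQ); rewrite le_eqVlt; apply/orP; left; apply/eqP.
  congr nsq; apply/funext => x; rewrite /p /q mulrBr mulrA ee; by field.
have b2 : nsq I1 (fun x => f (x + h) - (P (x + h) + e_ r (x + h) * Q (x + h))) <=
    (nsq I1 (fun x => p x - P x) + nsq I1 (fun x => e_ r x * (q x - Q x))) *+ 2.
  apply: le_trans (nsqB_le mI LpP LeqQ); rewrite le_eqVlt; apply/orP; left; apply/eqP.
  congr nsq; apply/funext => x; rewrite (per _ x tP) (per _ x tQ) erh /p /q mulrBr mulrA ee; by field.
move: b1 b2 pP qQ; rewrite eqn; lra.
Qed.

End Spectra.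

(** * Classification of spectra *)

Section Cells.
Variables (R : realType) (D : set R) (mD : measurable D).
Local Notation mu := (@lebesgue_measure R).
Hypothesis finD : (mu D < +oo)%E.
Variable Lambda : set R.
Hypothesis onb : orthonormal_basis D Lambda (@e_ R).
Implicit Types (f g : R -> R[i]) (l a h : R).

Lemma inner_cut E f g : measurable E -> E `<=` D -> L2 E f -> L2 D g ->
  inner D (cut E f) g = inner E f g.
Proof.
move=> mE ED Lf Lg; have Lc := L2_cut mE mD ED Lf.
rewrite /inner -{1}(setDUK ED) cintegral_setU//; first last.
- by rewrite setDUK//; exact: L2_cintegrableM.
- by apply/disj_setPS => x [Ex []].
- exact: measurableD.
rewrite [X in _ + X](_ : _ = 0) ?addr0.
  by apply: eqReIm; rewrite /= /Rintegral; congr fine; apply: eq_integral => x /set_mem Ex;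
    rewrite cutE.
rewrite -[RHS](inner0l (D `\` E) g) /inner.
by apply: eqReIm; rewrite /= /Rintegral; congr fine; apply: eq_integral => x /set_mem [_ nEx];
  rewrite /cut memNset.
Qed.

Lemma cintegral_e_shift l a h : 0 < h ->
  cintegral `]a, a + h[ (e_ l) = e_ l a * cintegral `]0, h[ (e_ l).
Proof.
move=> h0; have ah : a < a + h by rewrite ltrDl.
have [->|l0] := eqVneq l 0.
  rewrite (_ : e_ 0 = fun=> 1); last by apply/funext => x; rewrite e_0.
  by rewrite mul1r -!inner_1r !inner_nsq !nsq_1// !fine_itvoo ?ltW// subr0 addrAC subrr add0r.
have z : (2 * pi * l)%:C * 'i%C != 0.
  rewrite mulf_neq0//; first by rewrite fmorph_eq0 !mulf_neq0// lt0r_neq0// pi_gt0.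
  by apply/eqP => -[/eqP]; rewrite oner_eq0.
apply: (mulfI z); rewrite (cintegral_e ah) mulrCA (cintegral_e h0) e_x0 e_DR; ring.
Qed.

(** The cells have equal length, so the inner product of the step function with [e_ l] is the given
    sum times a common factor, the integral of [e_ (- l)] over ]0, h[. The step function is thus
    orthogonal to the basis, and disjointness isolates each height. *)
Lemma cells_free (n : nat) (a : 'I_n -> R) h (c : 'I_n -> R[i]) : 0 < h ->
  (forall i, `]a i, a i + h[ `<=` D) ->
  (forall i j : 'I_n, (i < j)%N -> a i + h <= a j) ->
  (forall l, Lambda l -> \sum_(i < n) c i * Num.conj (e_ l (a i)) = 0) ->
  forall i, c i = 0.
Proof.
move=> h0 aD aa cL i; pose A i := `]a i, a i + h[%classic : set R.
have mA k : measurable (A k) by exact: measurable_itv.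
have fA k : (mu (A k) < +oo)%E by exact: itvoo_fin.
have L1 k : L2 (A k) (fun=> 1) by exact: L2_cst.
pose f x := \sum_(i < n) c i * cut (A i) (fun=> 1) x.
have Lc k : L2 D (fun x => c k * cut (A k) (fun=> 1) x).
  exact: (L2Z mD _ (L2_cut (mA k) mD (aD k) (L1 k))).
have Lf : L2 D f by apply: L2_sum => // k _; exact: Lc.
have Le l : L2 D (e_ l) by exact: L2_e.
have f0 : nsq D f = 0.
  apply: (onb_orth0 mD onb) => // l Ll; rewrite inner_suml//.
  transitivity ((\sum_(i < n) c i * Num.conj (e_ l (a i))) * cintegral `]0, h[ (e_ (- l))).
    rewrite big_distrl; apply: eq_bigr => k _ /=.
    have Lk : L2 D (cut (A k) (fun=> 1)) := L2_cut (mA k) mD (aD k) (L1 k).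
    rewrite innerZl// (inner_cut (mA k) (aD k) (L1 k) (Le l)) -mulrA -e_N.
    rewrite -cintegral_e_shift//; congr (_ * _).
    by rewrite /inner; congr cintegral; apply/funext => x; rewrite mul1r e_N.
  by rewrite cL// mul0r.
have := nsq_subset mD (mA i) (aD i) Lf; rewrite f0.
have -> : nsq (A i) f = nsq (A i) (fun=> c i * 1).
  rewrite /nsq; congr fine; apply: eq_integral => x /set_mem Ax; congr (_ ^+ 2)%:E; congr normc.
  rewrite /f (bigD1 i)//= cutE// big1 ?addr0// => j ji.
  rewrite /cut memNset ?mulr0// => Aj; move: Ax Aj; rewrite /A /= !in_itv/=.
  move=> /andP[x1 x2] /andP[x3 x4]; move: ji; rewrite neq_ltn => /orP[/aa|/aa]; lra.
have ah : a i <= a i + h by rewrite lerDl ltW.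
rewrite (nsqZ (mA i) _ (L1 i)) (nsq_1 (mA i)) (fine_itvoo ah) => c0.
apply/eqP; rewrite -normc_eq0 -sqrf_eq0 eq_le sqr_ge0 andbT.
by move: c0; rewrite (_ : a i + h - a i = h); [rewrite pmulr_lle0|ring].
Qed.

Lemma two_cells b d h : 0 < h -> b + h <= d -> `]b, b + h[ `<=` D ->
  `]d, d + h[ `<=` D -> exists2 l, Lambda l & e_ l b != e_ l d.
Proof.
move=> h0 bd D1 D2; apply: contrapT => nl.
have eb l : Lambda l -> e_ l b = e_ l d.
  by move=> Ll; apply/eqP; apply/negPn/negP => h1; apply: nl; exists l.
pose a (i : 'I_2) := if i == 0%N :> nat then b else d.
pose c (i : 'I_2) : R[i] := if i == 0%N :> nat then 1 else -1.
suff /eqP : c ord0 = 0 by rewrite /c /= oner_eq0.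
apply: (@cells_free 2 a h c h0).
- by case=> -[|[|[]]]//= ?; rewrite /a/=.
- by case=> -[|[|[]]]//= ? [[|[|[]]]]//= ? _; rewrite /a/=.
- move=> l Ll; rewrite !big_ord_recl big_ord0 /= /a /c/= eb//; ring.
Qed.

Lemma three_cells b d h l0 : 0 < h -> h <= b -> b + h <= d ->
  `]0, h[ `<=` D -> `]b, b + h[ `<=` D -> `]d, d + h[ `<=` D ->
  exists2 l, Lambda l & ~ (e_ l b = 1 /\ e_ l d = 1) /\
    ~ (e_ l b = e_ l0 b /\ e_ l d = e_ l0 d).
Proof.
move=> h0 hb bd D1 D2 D3; apply: contrapT => nl.
have el l : Lambda l ->
    (e_ l b = 1 /\ e_ l d = 1) \/ (e_ l b = e_ l0 b /\ e_ l d = e_ l0 d).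
  move=> Ll; apply: contrapT => h1; apply: nl; exists l => //.
  by split=> h2; apply: h1; [left|right].
pose a (i : 'I_3) := if i == 0%N :> nat then 0 else if i == 1%N :> nat then b else d.
pose c (c0 c1 c2 : R[i]) (i : 'I_3) : R[i] := if i == 0%N :> nat then c0 else
  if i == 1%N :> nat then c1 else c2.
set p := Num.conj (e_ l0 b); set q := Num.conj (e_ l0 d).
have free (c0 c1 c2 : R[i]) : c0 + c1 + c2 = 0 -> c0 + c1 * p + c2 * q = 0 ->
    [/\ c0 = 0, c1 = 0 & c2 = 0].
  move=> s1 s2; suff H i : c c0 c1 c2 i = 0.
    by split; [exact: (H (@Ordinal 3 0 isT))|exact: (H (@Ordinal 3 1 isT))|
               exact: (H (@Ordinal 3 2 isT))].
  apply: (@cells_free 3 a h (c c0 c1 c2) h0).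
  - by case=> -[|[|[|]]]//= ?; rewrite /a/= ?add0r.
  - by case=> -[|[|[|]]]//= ? [[|[|[|]]]]//= ? _; rewrite /a/= ?add0r//; lra.
  - move=> l Ll; rewrite !big_ord_recl big_ord0 /= /a /c/= e_x0 rmorph1.
    case: (el l Ll) => -[-> ->].
      by rewrite rmorph1 !mulr1 addr0 addrA.
    by rewrite -/p -/q mulr1 addr0 addrA.
(* Up to sign these heights are the cross product of (1, 1, 1) and (1, p, q). They vanish only if p
   = q = 1; the two equations then coincide and (1, -1, 0) solves them. *)
have [||/eqP + _ _] := free (p - q) (q - 1) (1 - p); [ring|ring|].
rewrite subr_eq0 => /eqP pq.
have [||_ _ /eqP] := free (p - q) (q - 1) (1 - p); [ring|ring|].
rewrite subr_eq0 => /eqP p1.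
have [||/eqP] := free 1 (-1) 0; [ring|by rewrite -p1; ring|].
by rewrite oner_eq0.
Qed.

(** An exponential with frequency in [M] outside [Lambda] would have norm 1 and be orthogonal to the
    basis. *)
Lemma onb_maximal (M : set R) : mu D = 1%E -> Lambda `<=` M ->
  (forall l m, M l -> M m -> l != m -> inner D (e_ l) (e_ m) = 0) -> Lambda = M.
Proof.
move=> D1 LM orthM; apply/seteqP; split=> // m Mm; apply: contrapT => nm.
have Le l : L2 D (e_ l) by exact: L2_e.
have /eqP : nsq D (e_ m) = 0.
  apply: (onb_orth0 mD onb) => // l Ll; apply: orthM => //; first exact: LM.
  by apply/eqP => ml; apply: nm; rewrite ml.
rewrite (_ : nsq D (e_ m) = nsq D (fun=> 1)).
  by rewrite nsq_1// D1 oner_eq0.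
by rewrite /nsq; congr fine; apply: eq_integral => x _; rewrite normc_e [normc 1]normc1.
Qed.

Lemma onb_nonempty : mu D = 1%E -> exists l, Lambda l.
Proof.
move=> D1; apply: contrapT => nl.
have /eqP : nsq D (fun=> 1) = 0.
  apply: (onb_orth0 mD onb) => [|l Ll]; first exact: L2_cst.
  by exfalso; apply: nl; exists l.
by rewrite nsq_1// D1 oner_eq0.
Qed.

(** Multiplication by an exponential, of modulus 1, preserves norms and shifts all frequencies;
    approximating [e_ l0] times f approximates f. *)
Lemma onb_translate l0 : orthonormal_basis D [set l - l0 | l in Lambda] (@e_ R).
Proof.
have Le l : L2 D (e_ l) by exact: L2_e.
have [_ orth dens] := onb.
split=> [j _|j k [l Ll <-] [m Lm <-]|f Lf e e0]; first exact: Le.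
  rewrite inner_ee (_ : l - l0 - (m - l0) = l - m); last by ring.
  by rewrite -inner_ee orth// (inj_eq (addIr _)).
have Lg : L2 D (fun x => e_ l0 x * f x) by exact: L2_eM.
have [s [c [sL fs]]] := dens _ Lg _ e0.
exists [seq l - l0 | l <- s], (fun l => c (l + l0)); split.
  by move=> _ /mapP[l ls ->]; exists l => //; exact: sL.
apply: le_lt_trans fs; rewrite le_eqVlt; apply/orP; left; apply/eqP.
apply: eq_integral => x _; congr (_ ^+ 2)%:E.
rewrite -[LHS]mul1r -(normc_e l0 x) -normcM; congr normc.
rewrite mulrBr big_map big_distrr; congr (_ - _); apply: eq_bigr => l _ /=.
by rewrite subrK mulrCA -e_D addrC subrK.
Qed.

End Cells.

(** * Arithmetic constraints on the frequencies of a spectrum *)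

Section Classification.
Variables (R : realType) (w rho : R).
Local Notation mu := (@lebesgue_measure R).
Hypotheses (w0 : 0 < w) (w1 : w < 1) (rho0 : 0 < rho).
Local Notation Omega := (two_intervals w rho).
Local Notation Z := [set x : R | x \is a Num.int].
Implicit Types (l m k : R).

Let mO := @measurable_two_intervals R w rho.

Lemma half_notin_int : (1 / 2 : R) \is a Num.int = false.
Proof.
apply/negP => hi; have /e_eq1 : (1 / 2 : R) * 1 \is a Num.int by rewrite mulr1.
rewrite e_half => /(congr1 (fun z => Re z)) /=; lra.
Qed.

(* Taking conjugates of [a + b = 1 + c] gives [(a + b) * (c - a * b) = 0]. *)
Lemma unit_sum_eq (a b c : R[i]) : normc a = 1 -> normc b = 1 -> normc c = 1 ->
  a + b = 1 + c -> [\/ a = 1 /\ b = c, b = 1 /\ a = c | a = - b /\ c = -1].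
Proof.
move=> a1 b1 c1 abc.
have J (z : R[i]) : normc z = 1 -> z * Num.conj z = 1.
  by move=> z1; rewrite mulcJ z1 expr1n.
have abcJ : Num.conj a + Num.conj b = 1 + Num.conj c.
  by rewrite -rmorphD abc rmorphD; congr (_ + _); rewrite rmorph1.
have abc0 : (a + b) * c = a * b * (a + b).
  have := congr1 ( *%R (a * b * c)) abcJ; rewrite !mulrDr.
  rewrite (_ : a * b * c * Num.conj a = b * c * (a * Num.conj a)); last by ring.
  rewrite (_ : a * b * c * Num.conj b = a * c * (b * Num.conj b)); last by ring.
  rewrite (_ : a * b * c * Num.conj c = a * b * (c * Num.conj c)); last by ring.
  rewrite !J// !mulr1 => h; transitivity (a * b * (1 + c)); last by rewrite -abc mulrDr.
  rewrite mulrDl mulrDr mulr1 [RHS]addrC -h; ring.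
have [ab0|ab0] := eqVneq (a + b) 0.
  apply: Or33; split; first by apply/eqP; rewrite -addr_eq0 ab0.
  by apply/eqP; rewrite -addr_eq0 addrC -abc ab0.
have cE : c = a * b by apply: (mulfI ab0); rewrite abc0 mulrC.
have /eqP : (a - 1) * (b - 1) = 0.
  rewrite (_ : _ * _ = 1 + a * b - (a + b)); last by ring.
  by rewrite abc cE subrr.
rewrite mulf_eq0 !subr_eq0 => /orP[/eqP a1'|/eqP b1']; [apply: Or31|apply: Or32]; split=> //.
  by rewrite cE a1' mul1r.
by rewrite cE b1' mulr1.
Qed.

(** The three ways to match two pairs of unit numbers. Integrality of k in the first two comes from
    k = k (1 - w) + k w and k = k (1 + rho) - k rho. *)
Lemma spectrum_difference Lambda l m : orthonormal_basis Omega Lambda (@e_ R) ->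
  Lambda l -> Lambda m -> l != m -> let k := l - m in
  [\/ k \is a Num.int /\ k * w \is a Num.int,
      k \is a Num.int /\ k * rho \is a Num.int |
      k * (w + rho) - 1 / 2 \is a Num.int /\ k * (1 + rho - w) - 1 / 2 \is a Num.int].
Proof.
move=> onb Ll Lm lm k; have := onb_distinct w0 w1 rho0 onb Ll Lm lm.
move/unit_sum_eq; rewrite -/k !normc_e => /(_ erefl erefl erefl).
have ratio x y : e_ k x = e_ k y -> e_ k (x - y) = 1.
  by move=> xy; apply: (mulIf (e_neq0 k y)); rewrite -e_DR subrK mul1r.
case=> [[/e_eq1 kw /ratio/e_eq1 k1]|[/e_eq1 k1 /ratio/e_eq1 kr]|[+ /e_eqN1 kr]].
- apply: Or31; split=> //; rewrite (_ : k = k * (1 + rho - (w + rho)) + k * w); last by ring.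
  exact: rpredD.
- move: kr; rewrite (_ : w - (w + rho) = - rho) ?mulrN ?rpredN => [kr|]; last by ring.
  apply: Or32; split=> //; rewrite (_ : k = k * (1 + rho) - k * rho); last by ring.
  exact: rpredB.
- move=> h; apply: Or33; split=> //; apply/e_eqN1.
  by apply: (mulIf (e_neq0 k w)); rewrite -e_DR subrK mulN1r h opprK.
Qed.

Lemma subset_I1 a h : 0 <= a -> a + h <= w -> `]a, a + h[%classic `<=` Omega.
Proof.
move=> a0 ah x /=; rewrite in_itv/= => /andP[x1 x2]; left; rewrite /= in_itv/=.
by apply/andP; split; lra.
Qed.

Lemma subset_I2 a h : w + rho <= a -> a + h <= 1 + rho -> `]a, a + h[%classic `<=` Omega.
Proof.
move=> a0 ah x /=; rewrite in_itv/= => /andP[x1 x2]; right; rewrite /= in_itv/=.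
by apply/andP; split; lra.
Qed.

Lemma subset_I0 h : h <= w -> `]0, h[%classic `<=` Omega.
Proof.
by move=> hw x /=; rewrite in_itv/= => /andP[x1 x2]; left; rewrite /= in_itv/= x1 (lt_le_trans x2).
Qed.

Lemma exists_pos_le (x y : R) : 0 < x -> 0 < y -> exists h, [/\ 0 < h, h <= x & h <= y].
Proof. by move=> x0 y0; exists (Num.min x y); rewrite lt_min x0 y0 !ge_min !lexx orbT. Qed.

Section ContainingZero.
Variable Lambda : set R.
Hypotheses (onb : orthonormal_basis Omega Lambda (@e_ R)) (L0 : Lambda 0).

Lemma spectrum_element l : Lambda l ->
  [\/ l \is a Num.int /\ l * w \is a Num.int,
      l \is a Num.int /\ l * rho \is a Num.int |
      l * (w + rho) - 1 / 2 \is a Num.int /\ l * (1 + rho - w) - 1 / 2 \is a Num.int].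
Proof.
move=> Ll; have [->|l0] := eqVneq l 0; first by apply: Or31; rewrite mul0r rpred0.
by have := spectrum_difference onb Ll L0 l0; rewrite subr0.
Qed.

Lemma integer_spectrum : Lambda `<=` Z -> rho \is a Num.int.
Proof.
move=> LZ; apply: contrapT => rhoZ.
(* Exactly these translations make the first interval overlap the second one. *)
have [n [n1 n2]] : exists n : int, rho < n%:~R /\ n%:~R < 1 + rho.
  exists (Num.floor rho + 1); split; first exact: floorD1_gt.
  rewrite intrD addrC ltrD2l lt_neqAle floor_le_tmp andbT.
  by apply/negP => /eqP rE; apply: rhoZ; rewrite -rE; exact: intr_int.
(* The left end of the overlap of the first interval with the second one moved back by n. *)
have [a [a0 an aw ar]] : exists a : R,
    [/\ 0 <= a, w + rho - n%:~R <= a, 0 < w - a & 0 < 1 + rho - n%:~R - a].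
  have [h|h] := leP 0 (w + rho - n%:~R); [exists (w + rho - n%:~R)|exists 0]; split; move: w0 w1 rho0; lra.
have [h [h0 h1 h2]] := exists_pos_le aw ar.
have n0 : 1 <= n%:~R :> R by rewrite ler1z -gtz0_ge1 -(ltr0z R); move: w0 w1 rho0; lra.
have ahn : a + h <= a + n%:~R by move: w0 w1 rho0; lra.
have s1 : `]a, a + h[%classic `<=` Omega by apply: subset_I1; move: w0 w1 rho0; lra.
have s2 : `]a + n%:~R, a + n%:~R + h[%classic `<=` Omega by apply: subset_I2; move: w0 w1 rho0; lra.
have [l /LZ lZ] := two_cells mO (two_intervals_fin w0 w1 rho0) onb h0 ahn s1 s2.
by rewrite e_DR (e_intr lZ (intr_int _ _)) mulr1 eqxx.
Qed.

(** Such k pair integrally with every integer combination of 1, w and rho; the cells below are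
    placed at such points. *)
Definition integral_pairing k :=
  [/\ k \is a Num.int, k * w \is a Num.int & k * rho \is a Num.int].

Variable l0 : R.
Hypotheses (Ll0 : Lambda l0) (l0Z : l0 \isn't a Num.int).

Lemma noninteger_element : l0 * (w + rho) - 1 / 2 \is a Num.int.
Proof. by case: (spectrum_element Ll0) => -[//]; rewrite (negbTE l0Z). Qed.

(* Of the three alternatives of [spectrum_difference], the third cannot hold for
   all of [l], [l0] and [l - l0], since this would put [1 / 2] in [Z]. *)
Lemma spectrum_cosets l : Lambda l -> integral_pairing l \/ integral_pairing (l - l0).
Proof.
move=> Ll; have l0h := noninteger_element.
have intr3 k : k \is a Num.int -> k * (w + rho) \is a Num.int ->
    k * w \is a Num.int \/ k * rho \is a Num.int -> integral_pairing k.
  move=> kZ ks [kw|kr]; split=> //.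
    by rewrite (_ : k * rho = k * (w + rho) - k * w); [exact: rpredB|ring].
  by rewrite (_ : k * w = k * (w + rho) - k * rho); [exact: rpredB|ring].
have [ll0|ll0] := eqVneq l l0.
  by right; rewrite ll0 subrr; split; rewrite ?mul0r rpred0.
have [kZ|nkZ] := boolP (l - l0 \is a Num.int).
  have nlZ : l \isn't a Num.int.
    by apply: contra l0Z => lZ; rewrite -(subKr l l0); exact: rpredB.
  have lh : l * (w + rho) - 1 / 2 \is a Num.int.
    by case: (spectrum_element Ll) => -[//]; rewrite (negbTE nlZ).
  have ks : (l - l0) * (w + rho) \is a Num.int.
    rewrite (_ : _ * _ = l * (w + rho) - 1 / 2 - (l0 * (w + rho) - 1 / 2)); first exact: rpredB.
    by ring.
  right; case: (spectrum_difference onb Ll Ll0 ll0) => -[h1 h2].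
  - by apply: intr3 => //; left.
  - by apply: intr3 => //; right.
  - by have := rpredB ks h1; rewrite subKr half_notin_int.
have kh : (l - l0) * (w + rho) - 1 / 2 \is a Num.int.
  by case: (spectrum_difference onb Ll Ll0 ll0) => -[//]; rewrite (negbTE nkZ).
have ls : l * (w + rho) \is a Num.int.
  rewrite (_ : _ * _ = (l - l0) * (w + rho) - 1 / 2 + (l0 * (w + rho) - 1 / 2) + 1); last by field.
  by apply: rpredD; [exact: rpredD|exact: rpred1].
left; case: (spectrum_element Ll) => -[h1 h2].
- by apply: intr3 => //; left.
- by apply: intr3 => //; right.
- by have := rpredB ls h1; rewrite subKr half_notin_int.
Qed.

(** On each coset of the group the pair of values at b and d is constant: (1, 1) on the group
    itself, the values of [e_ l0] on the other. [three_cells] excludes this. *)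
Lemma no_three_cells b d h : 0 < h -> h <= b -> b + h <= d ->
  `]0, h[%classic `<=` Omega -> `]b, b + h[%classic `<=` Omega ->
  `]d, d + h[%classic `<=` Omega ->
  (forall k, integral_pairing k -> k * b \is a Num.int /\ k * d \is a Num.int) -> False.
Proof.
move=> h0 hb bd c1 c2 c3 G.
have [l Ll [n1 n2]] := three_cells mO (two_intervals_fin w0 w1 rho0) onb l0 h0 hb bd c1 c2 c3.
case: (spectrum_cosets Ll) => /G[/e_eq1 kb /e_eq1 kd]; first by apply: n1.
by apply: n2; rewrite -(subrK l0 l) !(e_D (l - l0)) kb kd !mul1r.
Qed.

Lemma noninteger_spectrum : w = 1 / 2 /\ 2 * rho \is a Num.int.
Proof.
have w12 : w = 1 / 2.
  apply/eqP; apply/negPn/negP => w12.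
  have /orP[wh|wh] : (w < 1 / 2) || (1 / 2 < w) by rewrite -neq_lt.
    (* The second interval, of length 1 - w > w, has room for two cells at distance w. *)
    have [h [h0 hw h2]] : exists h, [/\ 0 < h, h <= w & h <= 1 - 2 * w].
      by apply: exists_pos_le => //; move: w0 w1 rho0; lra.
    apply: (@no_three_cells (w + rho) (2 * w + rho) h) => //; try by (move: w0 w1 rho0; lra).
    + by apply: subset_I0.
    + by apply: subset_I2; move: w0 w1 rho0; lra.
    + by apply: subset_I2; move: w0 w1 rho0; lra.
    + move=> k [kZ kw kr]; split; first by rewrite mulrDr; exact: rpredD.
      by rewrite (_ : _ * _ = k * w + k * w + k * rho); [exact: rpredD (rpredD kw kw) kr|ring].
  (* The first interval, of length w > 1 - w, has room for two cells at distance 1 - w. *)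
  have [h [h0 hw h2]] : exists h, [/\ 0 < h, h <= 1 - w & h <= 2 * w - 1].
    by apply: exists_pos_le; move: w0 w1 rho0; lra.
  apply: (@no_three_cells (1 - w) (w + rho) h) => //; try by (move: w0 w1 rho0; lra).
  + by apply: subset_I0; move: w0 w1 rho0; lra.
  + by apply: subset_I1; move: w0 w1 rho0; lra.
  + by apply: subset_I2; move: w0 w1 rho0; lra.
  + move=> k [kZ kw kr]; split; last by rewrite mulrDr; exact: rpredD.
    by rewrite mulrBr mulr1; exact: rpredB.
split=> //; apply: contrapT => r2.
(* Here rho lies strictly between q/2 and (q + 1)/2, so the second interval contains w + (q + 1)/2 =
   w + (q + 1) w in its interior, besides the cell at its left end. *)
set q := Num.floor (2 * rho).
have [q1 q2] : q%:~R < 2 * rho /\ 2 * rho < q%:~R + 1.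
  split; last by rewrite -[X in _ + X]/(1%:~R) -intrD floorD1_gt.
  rewrite lt_neqAle floor_le_tmp andbT.
  by apply/negP => /eqP rE; apply: r2; rewrite -rE; exact: intr_int.
have [h [h0 hw h2]] : exists h,
    [/\ 0 < h, h <= rho - q%:~R / 2 & h <= 1 / 2 - (rho - q%:~R / 2)].
  by apply: exists_pos_le; move: w0 w1 rho0; lra.
apply: (@no_three_cells (w + rho) (w + (q%:~R + 1) / 2) h) => //; try by (move: w0 w1 rho0; lra).
+ by apply: subset_I0; move: w0 w1 rho0; lra.
+ by apply: subset_I2; move: w0 w1 rho0; lra.
+ by apply: subset_I2; move: w0 w1 rho0; lra.
+ move=> k [kZ kw kr]; split; first by rewrite mulrDr; exact: rpredD.
  rewrite (_ : k * _ = k * w + (q%:~R + 1) * (k * w)); last by rewrite w12; field.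
  by apply: rpredD => //; apply: rpredM => //; apply: rpredD; [exact: intr_int|exact: rpred1].
Qed.

End ContainingZero.

Lemma zero_spectrum_cases Lambda : orthonormal_basis Omega Lambda (@e_ R) -> Lambda 0 ->
  (Lambda `<=` Z /\ rho \is a Num.int) \/
  exists2 l0, Lambda l0 /\ l0 \isn't a Num.int & w = 1 / 2 /\ 2 * rho \is a Num.int.
Proof.
move=> onb L0; have [LZ|nLZ] := pselect (Lambda `<=` Z).
  by left; split=> //; exact: (integer_spectrum onb LZ).
right; have [l0 Ll0 l0Z] : exists2 l0, Lambda l0 & l0 \isn't a Num.int.
  apply: contrapT => h; apply: nLZ => l Ll /=; apply/negPn/negP => lZ.
  by apply: h; exists l.
by exists l0 => //; exact: (noninteger_spectrum onb L0 Ll0 l0Z).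
Qed.

Lemma half_endpoints (l : int) : w = 1 / 2 -> w + rho = l%:~R / 2 ->
  1 + rho = (l + 1)%:~R / 2 /\ 1 < l.
Proof.
move=> wE wr; split.
  by rewrite intrD mulrDl -wr wE; field.
by rewrite -(ltr_int R); move: wE wr rho0; rewrite (_ : (1 : int)%:~R = 1)//; lra.
Qed.

(** A spectrum is first translated so as to contain 0. An integer gap with w = 1/2 is counted under
    the second alternative, with l = 2 rho + 1. *)
Lemma spectralP : spectral Omega <->
  (rho \is a Num.int /\ w <> 1 / 2) \/
  (exists l : int, [/\ w = 1 / 2, w + rho = l%:~R / 2 & 1 + rho = (l + 1)%:~R / 2]).
Proof.
split=> [[Lambda /(is_spectrum_onb w0 w1 rho0) onb]|].
  have [l1 Ll1] := onb_nonempty mO (two_intervals_fin w0 w1 rho0) onb (mu_two_intervals w0 w1 rho0).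
  have onb1 := onb_translate mO (two_intervals_fin w0 w1 rho0) onb l1.
  have L0 : [set l - l1 | l in Lambda] 0 by exists l1; rewrite ?subrr.
  have r2 : rho \is a Num.int \/ (w = 1 / 2 /\ 2 * rho \is a Num.int).
    by case: (zero_spectrum_cases onb1 L0) => [[_ h]|[_ _ h]]; [left|right].
  have half : w = 1 / 2 -> 2 * rho \is a Num.int -> exists l : int,
      [/\ w = 1 / 2, w + rho = l%:~R / 2 & 1 + rho = (l + 1)%:~R / 2].
    move=> wE /intrP[q qE]; exists (q + 1).
    have wr : w + rho = (q + 1)%:~R / 2 by rewrite intrD -qE wE; field.
    by have [? _] := half_endpoints wE wr; split.
  case: r2 => [rZ|[wE r2]]; last by right; exact: half.
  have [wE|wE] := pselect (w = 1 / 2); last by left.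
  by right; apply: half => //; apply: rpredM => //; exact: rpred_nat.
case=> [[rZ _]|[l [wE wr _]]].
  by exists Z; apply/(is_spectrum_onb w0 w1 rho0)/(spectrum_Z w0 w1 rho0).
have [_ l1] := half_endpoints wE wr.
(* Any k would give a spectrum; k = 0 is chosen. *)
exists (half_spectrum ((2 * 0 + 1)%:~R / l%:~R)); apply/(is_spectrum_onb w0 w1 rho0).
by apply: (spectrum_half w0 w1 rho0) => //; rewrite gt_eqF// (lt_trans ltr01).
Qed.

Lemma orthonormal_orthogonal Lambda l m : orthonormal_basis Omega Lambda (@e_ R) ->
  Lambda l -> Lambda m -> l != m -> inner Omega (e_ l) (e_ m) = 0.
Proof. by move=> [_ orth _] Ll Lm lm; rewrite orth// (negbTE lm). Qed.

Lemma onb_subset Lambda M : orthonormal_basis Omega Lambda (@e_ R) ->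
  orthonormal_basis Omega M (@e_ R) -> Lambda `<=` M -> Lambda = M.
Proof.
move=> onbL onbM LM.
apply: (onb_maximal mO (two_intervals_fin w0 w1 rho0) onbL (mu_two_intervals w0 w1 rho0) LM).
by move=> l m; exact: (orthonormal_orthogonal onbM).
Qed.

Lemma spectrum_integer_gap Lambda : rho \is a Num.int -> w <> 1 / 2 ->
  is_spectrum Omega Lambda /\ Lambda 0 <-> Lambda = Z.
Proof.
move=> rZ wE; have onbZ := spectrum_Z w0 w1 rho0 rZ; split=> [|->]; last first.
  by split; [exact/(is_spectrum_onb w0 w1 rho0)|exact: rpred0].
move=> [/(is_spectrum_onb w0 w1 rho0) onb L0].
by case: (zero_spectrum_cases onb L0) => [[LZ _]|[_ _ []//]]; exact: onb_subset.
Qed.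

(** Adding q l to k adds 2 q to (2 k + 1) / l, which allows k to be reduced modulo l. *)
Lemma half_spectrum_shift (r : R) (q : int) : half_spectrum (r + 2 * q%:~R) = half_spectrum r.
Proof.
apply/seteqP; split=> x /half_spectrumP[[j ->]|[j ->]]; apply/half_spectrumP.
- by left; exists j.
- by right; exists (q + j); rewrite intrD; ring.
- by left; exists j.
- by right; exists (j - q); rewrite intrB; ring.
Qed.

Lemma spectrum_half_gap (l : int) Lambda : w = 1 / 2 -> w + rho = l%:~R / 2 ->
  orthonormal_basis Omega Lambda (@e_ R) -> Lambda 0 ->
  exists2 k : int, 0 <= k < l & Lambda = half_spectrum ((2 * k + 1)%:~R / l%:~R).
Proof.
move=> wE wr onb L0; have [_ l1] := half_endpoints wE wr.
have lp : 0 < l by exact: lt_trans l1.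
have l0 : l != 0 by rewrite gt_eqF.
have lR : l%:~R != 0 :> R by rewrite intr_eq0.
suff [k Lk] : exists k : int, Lambda `<=` half_spectrum ((2 * k + 1)%:~R / l%:~R).
  have kE := divz_eq k l.
  exists (k %% l)%Z; first by rewrite modz_ge0//= ltz_pmod.
  apply: onb_subset => //; first exact: (spectrum_half w0 w1 rho0).
  rewrite -(half_spectrum_shift _ (k %/ l)%Z) (_ : _ + _ = (2 * k + 1)%:~R / l%:~R)//.
  rewrite [in RHS]kE !(intrD, intrM); field.
  exact: lR.
case: (zero_spectrum_cases onb L0) => [[LZ /intrP[p pE]]|[m [Lm mZ] _]].
  (* For rho = p the hypotheses give l = 2 p + 1, and the two cosets of 2Z make up Z. *)
  exists p; have -> : (2 * p + 1)%:~R / l%:~R = 1 :> R.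
    rewrite (_ : (2 * p + 1)%:~R = l%:~R) ?divff//.
    by rewrite intrD intrM -pE; move: wE wr; rewrite (_ : (1 : int)%:~R = 1)//; lra.
  move=> x /LZ/intrP[n ->]; apply/half_spectrumP.
  have := divz_eq n 2; have : (0 <= (n %% 2)%Z < 2) by rewrite modz_ge0//= ltz_pmod.
  case: (n %% 2)%Z => [[|[|[]]]|]//= _ ->; rewrite !(intrD, intrM).
    by left; exists (n %/ 2)%Z; ring.
  by right; exists (n %/ 2)%Z; ring.
(* The relation m l/2 = k + 1/2 determines m; with w = 1/2 the group of integral pairings consists
   of even integers. *)
have /intrP[k kE] := noninteger_element onb L0 Lm mZ.
have mE : m = (2 * k + 1)%:~R / l%:~R.
  apply: (mulIf lR); rewrite divfK// intrD intrM -kE wr; by field.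
exists k => x Lx; rewrite -mE; apply/half_spectrumP.
have even y : integral_pairing y -> exists j : int, y = 2 * j%:~R.
  by move=> [_ /intrP[j yw] _]; exists j; rewrite -yw wE; field.
case: (spectrum_cosets onb L0 Lm mZ Lx) => /even[j jE]; [left|right]; exists j => //.
by rewrite -jE; ring.
Qed.

End Classification.

(** * Values of the spectral matrix *)

Section TwoByTwo.
Variable R : realType.
Local Notation C := R[i].
Implicit Types (a b c d x y s t z : C) (B : 'M[C]_2).

Lemma mx2_col2 a b c d x y :
  mx2 a b c d *m col2 x y = col2 (a * x + b * y) (c * x + d * y).
Proof. by rewrite mul_col2 !mxE. Qed.

Lemma eq_mx2_col2 B B' s t : s != t -> B *m col2 1 s = B' *m col2 1 s ->
  B *m col2 1 t = B' *m col2 1 t -> B = B'.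
Proof.
move=> st; rewrite !mul_col2 => /col2_inj[s0 s1] /col2_inj[t0 t1].
have key a b a' b' : a * 1 + b * s = a' * 1 + b' * s -> a * 1 + b * t = a' * 1 + b' * t ->
    a = a' /\ b = b'.
  rewrite !mulr1 => h1 h2; have bb : b = b'.
    have st0 : s - t != 0 by rewrite subr_eq0.
    apply: (mulIf st0); rewrite (_ : b * _ = a + b * s - (a + b * t)); last by ring.
    rewrite h1 h2; ring.
  by split=> //; apply: (addIr (b * s)); rewrite h1 bb.
have [e00 e01] := key _ _ _ _ s0 t0; have [e10 e11] := key _ _ _ _ s1 t1.
apply/matrixP => i j.
case: (unliftP ord0 i) => [i' ->|->]; case: (unliftP ord0 j) => [j' ->|->];
  rewrite ?(ord1 i') ?(ord1 j') // (_ : lift _ _ = ord_max) //; exact/val_inj.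
Qed.

Lemma unitary_mx2 a b : a * Num.conj a + b * Num.conj b = 1 ->
  a * Num.conj b + b * Num.conj a = 0 -> mx2 a b b a \is unitarymx.
Proof.
move=> h1 h2; apply/unitarymxP/matrixP => i j.
rewrite !mxE !big_ord_recl big_ord0 addr0 !mxE /=.
by case: i => -[|[|[]]]//= ?; case: j => -[|[|[]]]//= ?; rewrite ?h1 ?h2// addrC.
Qed.

(** The matrix with eigenvectors (1, 1) and (1, -1) for the eigenvalues 1 and z. It is therefore
    multiplicative in z, which computes all integer powers. *)
Definition circulant z := mx2 ((1 + z) / 2) ((1 - z) / 2) ((1 - z) / 2) ((1 + z) / 2).

Lemma circulantM x y : circulant x * circulant y = circulant (x * y).
Proof.
apply/matrixP => i j; rewrite /circulant !mxE !big_ord_recl big_ord0 !mxE /=.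
by case: i => -[|[|[]]]//= ?; case: j => -[|[|[]]]//= ?; field.
Qed.

Lemma circulant1 : circulant 1 = 1.
Proof.
apply/matrixP => i j; rewrite /circulant !mxE /=.
by case: i => -[|[|[]]]//= ?; case: j => -[|[|[]]]//= ?; rewrite /= ?subrr ?mul0r//; field.
Qed.

Lemma circulantX x (n : nat) : circulant x ^+ n = circulant (x ^+ n).
Proof. by elim: n => [|n ih]; rewrite ?circulant1// !exprS ih circulantM. Qed.

Lemma circulantV x : x != 0 -> (circulant x)^-1 = circulant x^-1.
Proof.
move=> x0; have h1 : circulant x * circulant x^-1 = 1 by rewrite circulantM divff// circulant1.
have h2 : circulant x^-1 * circulant x = 1 by rewrite circulantM mulVf// circulant1.
have u : circulant x \is a GRing.unit by apply/unitrP; exists (circulant x^-1).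
by apply: (mulrI u); rewrite divrr// h1.
Qed.

Lemma circulantXz x (n : int) : x != 0 -> circulant x ^ n = circulant (x ^ n).
Proof.
move=> x0; case: n => n; first exact: circulantX.
rewrite -[LHS]/((circulant x ^+ n.+1)^-1) -[x ^ _]/((x ^+ n.+1)^-1).
by rewrite circulantX circulantV// expf_neq0.
Qed.

Lemma circulant_unitary z : normc z = 1 -> circulant z \is unitarymx.
Proof.
move=> z1; have zz : z * Num.conj z = 1 by rewrite mulcJ z1 expr1n.
have p : Num.conj ((1 + z) / 2) = (1 + Num.conj z) / 2.
  by rewrite fmorph_div rmorphD rmorph1 rmorph_nat.
have m : Num.conj ((1 - z) / 2) = (1 - Num.conj z) / 2.
  by rewrite fmorph_div rmorphB rmorph1 rmorph_nat.
apply: unitary_mx2; rewrite p m.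
  rewrite (_ : _ + _ = (1 + z * Num.conj z) / 2); last by field.
  by rewrite zz divff// (_ : 1 + 1 = 2).
transitivity ((1 - z * Num.conj z) / 2); first by field.
by rewrite zz subrr mul0r.
Qed.

End TwoByTwo.

Section SpectralMatrices.
Variables (R : realType) (w rho : R).
Hypotheses (w0 : 0 < w) (w1 : w < 1) (rho0 : 0 < rho).
Local Notation Omega := (two_intervals w rho).
Local Notation Z := [set x : R | x \is a Num.int].
Implicit Types (l m : R) (B : 'M[R[i]]_2).

Lemma spectral_matrixP (Lambda : set R) B0 l m : orthonormal_basis Omega Lambda (@e_ R) ->
  B0 \is unitarymx ->
  (forall k, Lambda k -> B0 *m col2 1 (e_ k (w + rho)) = col2 (e_ k w) (e_ k (1 + rho))) ->
  Lambda l -> Lambda m -> e_ l (w + rho) != e_ m (w + rho) ->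
  forall B, spectral_matrix w rho Lambda B <-> B = B0.
Proof.
move=> onb BU Be Ll Lm lm B; split=> [sB|->]; last exact: (spectral_matrix_exists w0 w1 rho0 onb BU Be).
have sBe := spectral_matrix_e w0 w1 sB.
by apply: (eq_mx2_col2 lm); rewrite Be// sBe.
Qed.

Lemma spectral_matrix_integer_gap B : rho \is a Num.int ->
  spectral_matrix w rho Z B <-> B = mx2 0 1 1 0.
Proof.
move=> rZ; apply: (@spectral_matrixP _ _ 0 1 (spectrum_Z w0 w1 rho0 rZ)).
- by apply: unitary_mx2; rewrite !(rmorph0, rmorph1); ring.
- move=> k kZ; rewrite mx2_col2 !mul0r !mul1r add0r addr0 !e_DR (e_intr kZ rZ) !mulr1.
  by rewrite (_ : e_ k 1 = 1)//; exact: e_intr kZ (rpred1 _).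
- exact: rpred0.
- exact: rpred1.
(* The frequencies 0 and 1 are separated at w + rho, since otherwise w would be an integer strictly
   between 0 and 1. *)
rewrite e_0 eq_sym; apply/eqP => /e_eq1; rewrite mul1r => wr.
have : w \is a Num.int by rewrite -(addrK rho w); exact: rpredB.
move=> /intrP[n wn]; move: w0 w1; rewrite wn ltr0z (_ : 1 = 1%:~R)// ltr_int.
by case: n {wn} => [[|n]|n].
Qed.

(** The column of left boundary values of [e_ m] is (1, 1) or (1, -1), an eigenvector of the
    circulant matrix, with eigenvalue the value at w. *)
Lemma half_spectrum_eigen (l k : int) m : w = 1 / 2 -> w + rho = l%:~R / 2 -> l != 0 ->
  let r : R := (2 * k + 1)%:~R / l%:~R in half_spectrum r m ->
  (e_ m w = 1 /\ e_ m (w + rho) = 1) \/ (e_ m w = expi (pi * r) /\ e_ m (w + rho) = -1).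
Proof.
move=> wE wr l0 r; have e1 (j : int) : e_ (2 * j%:~R) w = 1 :> R[i].
  by rewrite wE; have := e_even R j 1.
have el (j : int) : e_ (2 * j%:~R) (w + rho) = 1 :> R[i] by rewrite wr; exact: e_even.
move=> /half_spectrumP[[j ->]|[j ->]]; [left|right]; first by [].
split; rewrite e_D ?e1 ?el mulr1; last by rewrite wr; exact: e_r_half.
by rewrite /e_ wE; congr expi; field.
Qed.

Lemma spectral_matrix_half_gap (l k : int) B : w = 1 / 2 -> w + rho = l%:~R / 2 -> l != 0 ->
  let r : R := (2 * k + 1)%:~R / l%:~R in
  spectral_matrix w rho (half_spectrum r) B <-> B = circulant (expi (pi * r)).
Proof.
move=> wE wr l0 r; have r0 : half_spectrum r 0.
  by apply/half_spectrumP; left; exists 0; rewrite mulr0.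
have rr : half_spectrum r r.
  by apply/half_spectrumP; right; exists 0; rewrite mulr0 addr0.
have orho : 1 + rho = w + rho + w by rewrite wE; field.
apply: (@spectral_matrixP _ _ 0 r (spectrum_half w0 w1 rho0 k wE wr l0)) => //.
- by apply: circulant_unitary; exact: normc_expi.
- move=> m /(half_spectrum_eigen wE wr l0) h; rewrite orho (e_DR m (w + rho)) mx2_col2.
  by case: h => -[-> ->]; congr col2; field.
rewrite e_0 eq_sym wr e_r_half// -subr_eq0 -opprD oppr_eq0.
by rewrite (_ : 1 + 1 = 2) ?pnatr_eq0.
Qed.

End SpectralMatrices.

(** * Local translations *)

Section PeriodicIntegral.
Variables (R : realType) (T : R) (G : R -> \bar R).
Local Notation mu := (@lebesgue_measure R).
Hypotheses (T0 : 0 < T) (mG : measurable_fun setT G) (G0 : forall x, (0 <= G x)%E).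
Hypothesis GT : forall x, G (x + T) = G x.

(** Half-open intervals concatenate without gap or overlap. *)
Let L (a b : R) : \bar R := (\int[mu]_(x in `[a, b[) G x)%E.

Lemma periodic_nat (n : nat) x : G (x + n%:R * T) = G x.
Proof.
elim: n x => [|n ih] x; first by rewrite mul0r addr0.
by rewrite -natr1 mulrDl mul1r addrA GT ih.
Qed.

Lemma periodic_int (n : int) x : G (x + n%:~R * T) = G x.
Proof.
case: n => n; first exact: periodic_nat.
by rewrite NegzE intrN -[in RHS](subrK (n.+1%:R * T) x) periodic_nat mulNr.
Qed.

Lemma integral_itv_shift c (a b : R) :
  (\int[mu]_(x in `[a, b[) G (x + c) = L (a + c) (b + c))%E.
Proof.
rewrite /L [RHS](@ge0_integral_shift _ c)//.
- have E : [set x | `[a + c, b + c[%classic (x + c)] = `[a, b[%classic.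
    by apply/seteqP; split=> x /=; rewrite !in_itv/= lerD2r ltrD2r.
  by rewrite E.
- exact: measurable_funS mG.
Qed.

Lemma integral_itv_cat (a b c : R) : a <= b -> b <= c -> L a c = (L a b + L b c)%E.
Proof.
move=> ab bc; have E : `[a, c[%classic = `[a, b[%classic `|` `[b, c[%classic :> set R.
  apply/seteqP; split=> x /=; rewrite !in_itv/=.
    by move=> /andP[ax xc]; have [xb|bx] := ltP x b; [left; rewrite ax|right].
  case=> /andP[h1 h2]; apply/andP; split => //; first exact: lt_le_trans bc.
  exact: le_trans h1.
rewrite /L E ge0_integral_setU//.
- by apply: measurable_funS mG.
- apply/disj_setPS => x []; rewrite /= !in_itv/= => /andP[_ h1] /andP[h2 _].
  by have := lt_le_trans h1 h2; rewrite ltxx.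
Qed.

Lemma integral_itv_periodic (n : int) (a b : R) : L (a + n%:~R * T) (b + n%:~R * T) = L a b.
Proof.
by rewrite -integral_itv_shift; apply: eq_integral => x _; rewrite periodic_int.
Qed.

Lemma periodic_integral_shift t :
  (\int[mu]_(x in `]0%R, T[) G (x + t) = \int[mu]_(x in `]0%R, T[) G x)%E.
Proof.
have mGt : measurable_fun setT (fun x : R => G (x + t)).
  by apply: (measurableT_comp mG); apply: measurable_funD => //; exact: measurable_cst.
rewrite -(@integral_itv_bndoo _ 0 T _ true true); last exact: measurable_funS mGt.
rewrite -(@integral_itv_bndoo _ 0 T _ true true); last exact: measurable_funS mG.
rewrite integral_itv_shift -/(L 0 T) add0r [T + t]addrC.
(* The shift is reduced to s in [0, T]; the period [s, s + T[ is then cut at T and its second piece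
   moved back by T onto [0, s[. *)
have fl := floor_itv (t / T); set n := Num.floor _ in fl.
have [s0 sT] : 0 <= t - n%:~R * T /\ t - n%:~R * T <= T.
  move: fl => /andP[]; rewrite ler_pdivlMr// ltr_pdivrMr// intrD mulrDl mul1r => h1 h2.
  by split; lra.
set s := t - n%:~R * T in s0 sT.
transitivity (L (s + n%:~R * T) (s + T + n%:~R * T)).
  by rewrite (addrAC s T) /s subrK.
rewrite integral_itv_periodic.
rewrite (integral_itv_cat sT) ?lerDr// (integral_itv_cat s0 sT) addeC; congr (_ + _)%E.
by rewrite -(integral_itv_periodic 1 0 s) mul1r add0r addrC.
Qed.

End PeriodicIntegral.

(** * Exceptional null sets and measurability of compositions *)

Section MeasurabilityTools.
Variable R : realType.
Local Notation mu := (@lebesgue_measure R).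
Implicit Types (D : set R) (f g : R -> R[i]).

Lemma ae_notin_int (a c : R) : a != 0 -> {ae mu, forall x, a * x + c \isn't a Num.int}.
Proof.
move=> a0; pose N := [set (n%:~R - c) / a | n in [set: int]].
have cN : countable N by apply: sub_countable (card_image_le _ _) _; exact: countableP.
exists N; split.
- exact: countable_measurable.
- exact: countable_lebesgue_measure0.
- move=> x /= /negP; rewrite negbK => /intrP[n nE]; exists n => //.
  by rewrite -nE addrK mulrAC divff// mul1r.
Qed.

Lemma measurable_floor : measurable_fun setT (fun x : R => (Num.floor x)%:~R : R).
Proof.
apply: nondecreasing_measurable => // x y xy.
by rewrite ler_int; apply: le_floor.
Qed.

Lemma cmeasurable_comp D g (p : R -> R) : measurable D -> cmeasurable setT g ->
  measurable_fun D p -> cmeasurable D (fun x => g (p x)).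
Proof.
by move=> mD [gr gi] mp; split; [apply: (measurableT_comp gr)|apply: (measurableT_comp gi)].
Qed.

Lemma cmeasurable_subset D E f : measurable D -> E `<=` D -> cmeasurable D f -> cmeasurable E f.
Proof. by move=> mD ED [mr mi]; split; exact: (measurable_funS mD). Qed.

Lemma cmeasurableD D f g : cmeasurable D f -> cmeasurable D g ->
  cmeasurable D (fun x => f x + g x).
Proof.
move=> [a b] [c d]; split.
  by under eq_fun do rewrite ReImE; exact: measurable_funD.
by under eq_fun do rewrite ReImE; exact: measurable_funD.
Qed.

Lemma eq_cmeasurable D f g : (forall x, D x -> f x = g x) -> cmeasurable D f ->
  cmeasurable D g.
Proof.
move=> fg [mr mi]; split.
  by apply: eq_measurable_fun mr => x /set_mem Dx; rewrite fg.
by apply: eq_measurable_fun mi => x /set_mem Dx; rewrite fg.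
Qed.

Lemma measurable_addr c : measurable_fun setT (fun x : R => x + c).
Proof. by apply: measurable_funD => //; exact: measurable_cst. Qed.

End MeasurabilityTools.

(** * Local translations for an integer gap *)

Section IntegerGap.
Variables (R : realType) (w rho : R).
Local Notation mu := (@lebesgue_measure R).
Hypotheses (w0 : 0 < w) (w1 : w < 1) (rho0 : 0 < rho) (rZ : rho \is a Num.int).
Local Notation Omega := (two_intervals w rho).
Local Notation I1 := `]0, w[%classic.
Local Notation I2 := `]w + rho, 1 + rho[%classic.
Local Notation Z := [set x : R | x \is a Num.int].
Implicit Types (f g : R -> R[i]) (x y t : R).

Let mO := @measurable_two_intervals R w rho.

(** An explicit, measurable and 1-periodic form of x mod Omega. When x or x - w is an integer its
    value is an endpoint outside Omega. *)
Definition fold x : R := let u := x - (Num.floor x)%:~R in if u < w then u else u + rho.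

Lemma frac_itv x : 0 <= x - (Num.floor x)%:~R < 1.
Proof.
by rewrite subr_ge0 floor_le ltrBlDl -[X in _ + X]/(1%:~R) -intrD floorD1_gt.
Qed.

Lemma fold_int x : x - fold x \is a Num.int.
Proof.
rewrite /fold; case: ifP => _; first by rewrite subKr intr_int.
by rewrite opprD addrA subKr rpredB// intr_int.
Qed.

Lemma fold_periodic x n : n \is a Num.int -> fold (x + n) = fold x.
Proof.
move=> nZ; rewrite /fold floorDrz// intrD (_ : x + n - _ = x - (Num.floor x)%:~R)//.
by rewrite (floorK nZ) opprD addrACA subrr addr0.
Qed.

Lemma fold_unit x : 0 <= x < 1 -> fold x = if x < w then x else x + rho.
Proof.
move=> x01; rewrite /fold (_ : Num.floor x = 0) ?subr0//.
by apply: floor_def; rewrite add0r.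
Qed.

Lemma fold_id x : Omega x -> fold x = x.
Proof.
case; rewrite /= in_itv/= => /andP[x0 xw].
  by rewrite fold_unit ?xw// (ltW x0) (lt_trans xw).
rewrite -[in LHS](subrK rho x) fold_periodic// fold_unit.
  by rewrite ltrBlDr ltNge (ltW x0)/= subrK.
by apply/andP; split; move: w0; lra.
Qed.

Lemma fold_mem x : x \isn't a Num.int -> x - w \isn't a Num.int -> Omega (fold x).
Proof.
move=> xZ xwZ; rewrite /fold; have := frac_itv x.
have xE : x = x - (Num.floor x)%:~R + (Num.floor x)%:~R by rewrite subrK.
set u := x - _ in xE *; move=> /andP[u0 u1].
have {}u0 : 0 < u.
  rewrite lt_neqAle u0 andbT; apply: contra xZ => /eqP u00.
  by rewrite xE -u00 add0r intr_int.
have [uw|wu] := ltP u w; first by left; rewrite /= in_itv/= u0.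
right; rewrite /= in_itv/= ltrD2r ltrD2r u1 andbT lt_neqAle wu andbT.
by apply: contra xwZ => /eqP uw; rewrite xE uw addrAC subrr add0r intr_int.
Qed.

(** [fold] is the identity on Omega and depends only on the class modulo Z. *)
Lemma congruent_unique x y : Omega x -> Omega y -> x - y \is a Num.int -> x = y.
Proof.
move=> Ox Oy xyZ; rewrite -(fold_id Ox) -(fold_id Oy).
by rewrite -[in LHS](subrK y x) addrC fold_periodic.
Qed.

Lemma mod_set_fold x : x \isn't a Num.int -> x - w \isn't a Num.int ->
  mod_set Omega x = fold x.
Proof.
move=> xZ xwZ; rewrite /mod_set; have Of := fold_mem xZ xwZ.
apply: xget_unique; first by split=> //; exact: fold_int.
move=> y [Oy xyZ]; apply: congruent_unique => //.
by rewrite (_ : y - fold x = x - fold x - (x - y)); [apply: rpredB => //; exact: fold_int|ring].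
Qed.

Lemma ae_unfolded t : {ae mu, forall x, x + t \isn't a Num.int /\ x + t - w \isn't a Num.int}.
Proof.
have h1 := ae_notin_int t (oner_neq0 R); have h2 := ae_notin_int (t - w) (oner_neq0 R).
by apply: ae_imp2 h1 h2 => x; rewrite mul1r addrA.
Qed.

Lemma measurable_fold : measurable_fun setT fold.
Proof.
have mf : measurable_fun setT (fun x : R => x - (Num.floor x)%:~R).
  by apply: measurable_funB => //; exact: measurable_floor.
apply: measurable_fun_ifT => //.
  by apply: measurable_fun_ltr => //; exact: measurable_cst.
by apply: measurable_funD => //; exact: measurable_cst.
Qed.

Definition folded_translation t f x : R[i] := cut Omega f (fold (x + t)).

Lemma cmeasurable_folded_translation D t f : measurable D -> cmeasurable Omega f ->
  cmeasurable D (folded_translation t f).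
Proof.
move=> mD mf; apply: (cmeasurable_subset measurableT) => //.
apply: (cmeasurable_comp (g := cut Omega f)) => //; first exact: cmeasurable_cut.
apply: (measurableT_comp measurable_fold).
by apply: measurable_funD => //; exact: measurable_cst.
Qed.

Lemma folded_translation_0 f x : Omega x -> folded_translation 0 f x = f x.
Proof. by move=> Ox; rewrite /folded_translation addr0 fold_id// cutE. Qed.

Lemma normsq_folded_translation t f : cmeasurable Omega f ->
  normsq Omega (folded_translation t f) = normsq Omega f.
Proof.
move=> mf; transitivity (normsq Omega (folded_translation 0 f)); last first.
  by apply: eq_integral => x /set_mem Ox; rewrite folded_translation_0.
pose G z := ((normc (cut Omega f (fold z))) ^+ 2)%:E.
have mG : measurable_fun setT G.
  have := cmeasurable_folded_translation 0 measurableT mf.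
  move=> [mr mi]; have := measurable_normc_sqr mr mi.
  by congr measurable_fun; apply/funext => x; rewrite /folded_translation addr0.
have mGt s : measurable_fun setT (fun x : R => G (x + s)).
  by apply: (measurableT_comp mG); apply: measurable_funD => //; exact: measurable_cst.
have G0 x : (0 <= G x)%E by rewrite lee_fin sqr_ge0.
have Gn n x : n \is a Num.int -> G (x + n) = G x by move=> nZ; rewrite /G fold_periodic.
(* Moving the second interval back by the integer rho does not change the 1-periodic integrand, and
   the two pieces fill one period. *)
suff E s : normsq Omega (folded_translation s f) = (\int[mu]_(x in `]0%R, 1%R[) G (x + s)%R)%E.
  rewrite !E (periodic_integral_shift ltr01 mG G0)//; last by move=> x; exact: Gn (rpred1 _).
  by apply: eq_integral => x _; rewrite addr0.
rewrite normsq_setU//; first last.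
- exact: cmeasurable_folded_translation.
- exact: two_intervals_disjoint.
rewrite /normsq -/(G _).
transitivity (\int[mu]_(x in `]0%R, w[) G (x + s)%R + \int[mu]_(x in `]w, 1%R[) G (x + s)%R)%E.
  congr (_ + _)%E.
  rewrite (@ge0_integral_shift _ rho)//; first last.
  - by move=> x _; exact: G0.
  - exact: measurable_funS (mGt s).
  rewrite (_ : [set x | _] = `]w, 1[%classic); last first.
    by apply/seteqP; split=> x /=; rewrite !in_itv/= !ltrD2r.
  by apply: eq_integral => x _; rewrite -(Gn rho (x + s) rZ) /G /folded_translation (addrAC x rho).
rewrite -(@integral_itv_bndoo _ 0 1 _ true true); last exact: measurable_funS (mGt s).
rewrite -(@integral_itv_bndoo _ 0 w _ true true); last exact: measurable_funS (mGt s).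
rewrite -(@integral_itv_bndoo _ w 1 _ true true); last exact: measurable_funS (mGt s).
by rewrite (integral_itv_cat (mGt s) (fun x => G0 (x + s)) (ltW w0) (ltW w1)).
Qed.

Lemma isometry_folded_translation t : isometry Omega (folded_translation t).
Proof.
split=> [f Lf|a f g Lf Lg|f Lf].
- have mf := L2_cmeasurable Lf; have [mr mi] := cmeasurable_folded_translation t mO mf.
  by split=> //; rewrite normsq_folded_translation//; case: Lf.
- apply: ae_all => x _; rewrite /folded_translation /cut; case: ifP => //; rewrite mulr0 addr0//.
- by rewrite /nsq normsq_folded_translation//; exact: L2_cmeasurable Lf.
Qed.

Lemma folded_translation_e l t : Z l ->
  folded_translation t (e_ l) = (fun x => e_ l t * e_ l x) %[ae mu in Omega].
Proof.
move=> lZ; apply: ae_imp (ae_unfolded t) => x [xZ xwZ] _.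
rewrite /folded_translation cutE; last exact: fold_mem.
rewrite -e_DR [t + x]addrC -[X in _ = e_ l X](subrK (fold (x + t))) e_DR.
by rewrite (e_intr lZ (fold_int _)) mul1r.
Qed.

Lemma local_translations_integer_gap :
  (exists U, local_translations Omega Z U) /\
  forall U, local_translations Omega Z U -> forall f t, L2 Omega f ->
    {ae mu, forall x, Omega x -> U t f x = f (mod_set Omega (x + t))}.
Proof.
have onb := spectrum_Z w0 w1 rho0 rZ; have fO := two_intervals_fin w0 w1 rho0.
have Ve l t : Z l -> folded_translation t (e_ l) = (fun x => e_ l t * e_ l x) %[ae mu in Omega].
  exact: folded_translation_e.
split.
  exists folded_translation.
  exact: (isometry_local_translations mO fO onb isometry_folded_translation).
move=> U lU f t Lf.
have := local_translations_unique mO onb isometry_folded_translation Ve lU t Lf.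
move=> h; apply: ae_imp2 h (ae_unfolded t) => x Ux [xZ xwZ] Ox.
by rewrite Ux// mod_set_fold// /folded_translation cutE//; exact: fold_mem.
Qed.

Lemma ae_unique_representative :
  {ae mu, forall x : R, exists! y, Omega y /\ x - y \is a Num.int}.
Proof.
apply: ae_imp (ae_unfolded 0) => x; rewrite addr0 => -[xZ xwZ].
exists (fold x); split; first by split; [exact: fold_mem|exact: fold_int].
move=> y [Oy xyZ]; apply: congruent_unique => //; first exact: fold_mem.
by rewrite (_ : fold x - y = x - y - (x - fold x)); [apply: rpredB => //; exact: fold_int|ring].
Qed.

End IntegerGap.

(** * Tiling *)

Section Partitions.
Variable R : realType.
Local Notation mu := (@lebesgue_measure R).

Lemma translateE (A : set R) c : translate A c = [set x | A (x + - c)].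
Proof.
apply/seteqP; split=> [_ [y Ay <-]|x Ax]; first by rewrite /= addrK.
by exists (x - c); rewrite ?subrK.
Qed.

Lemma measurable_translate (A : set R) c : measurable A -> measurable (translate A c).
Proof. by rewrite translateE; exact: measurable_shift. Qed.

Lemma ae_partition_of_disjoint (I : countType) (P : I -> set R) (X : set R) :
  measurable X -> (forall i, measurable (P i)) -> (forall i j x, P i x -> P j x -> i = j) ->
  (forall i, P i `<=` X) -> {ae mu, forall x, X x -> exists i, P i x} -> ae_partition P X.
Proof.
move=> mX mP dP PX aeP; have mU : measurable (\bigcup_i P i).
  by apply: countable_bigcupT_measurable => //; exact: countableP.
split=> //.
- move=> i j ij; rewrite (_ : _ `&` _ = set0) ?measure0//.
  by apply/seteqP; split=> x // [xi xj]; apply: ij; exact: dP xi xj.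
- rewrite (_ : _ `\` _ = set0) ?measure0//.
  by apply/seteqP; split=> x // [[i _ xi] nX]; apply: nX; exact: PX xi.
- apply: measure_negligible; first exact: measurableD.
  have [N [mN N0 sN]] := aeP; exists N; split=> // x [Xx nU]; apply: sN => /= h.
  by apply: nU; have [i xi] := h Xx; exists i.
Qed.

End Partitions.

(** * The integer gap: tiling and translation congruence *)

Section Tiling.
Variables (R : realType) (w rho : R).
Local Notation mu := (@lebesgue_measure R).
Hypotheses (w0 : 0 < w) (w1 : w < 1) (rho0 : 0 < rho) (rZ : rho \is a Num.int).
Local Notation Omega := (two_intervals w rho).
Local Notation I1 := `]0, w[%classic.
Local Notation I2 := `]w + rho, 1 + rho[%classic.

Lemma tiles_integer_gap : tiles_by_Z Omega.
Proof.
apply: ae_partition_of_disjoint => //.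
- by move=> k; apply: measurable_translate; exact: measurable_two_intervals.
- move=> i j x; rewrite !translateE /= => Oi Oj.
  have ij : x - i%:~R - (x - j%:~R) = (j - i)%:~R by rewrite intrB; ring.
  have := congruent_unique w0 w1 rZ Oi Oj; rewrite ij intr_int => /(_ isT)/addrI/oppr_inj/eqP.
  by rewrite eqr_int => /eqP.
- apply: ae_imp (ae_unique_representative w0 w1 rZ) => x [y [[Oy xyZ] _]] _.
  by have /intrP[k kE] := xyZ; exists k; exists y => //; rewrite -kE addrC subrK.
Qed.

Lemma Z_congruent_integer_gap : Z_congruent_to_unit_interval Omega.
Proof.
have /intrP[m mE] := rZ.
(* Only two pieces matter; the remaining indices carry the empty set, and only the second interval
   is moved, by - rho. *)
pose P (i : nat) : set R := match i with 0%N => I1 | 1%N => I2 | _ => set0 end.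
pose n (i : nat) : int := if i == 1%N then - m else 0.
have mP i : measurable (P i).
  by case: i => [|[|i]] /=; [exact: measurable_itv|exact: measurable_itv|exact: measurable0].
have tE i x : translate (P i) (n i)%:~R x <->
    match i with 0%N => 0 < x < w | 1%N => w < x < 1 | _ => false end.
  case: i => [|[|i]]; rewrite translateE /n /=.
  - by rewrite subr0 in_itv.
  - by rewrite intrN opprK -mE in_itv /= !ltrD2r.
  - by [].
exists P, n; split; apply: ae_partition_of_disjoint.
- exact: measurable_two_intervals.
- exact: mP.
- move=> [|[|i]] [|[|j]] x //=; rewrite !in_itv/= => /andP[h1 h2] /andP[h3 h4];
    by exfalso; move: w0 rho0; lra.
- by move=> [|[|i]] x //= h; [left|right].
- by apply: ae_all => x [h|h]; [exists 0%N|exists 1%N].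
- exact: measurable_itv.
- by move=> i; apply: measurable_translate; exact: mP.
- move=> i j x /tE hi /tE hj; move: i j hi hj => [|[|i]] [|[|j]]//= /andP[h1 h2] /andP[h3 h4];
    by exfalso; lra.
- move=> i x /tE; rewrite /= in_itv/=; case: i => [|[|i]] // /andP[h1 h2].
    by rewrite h1 (lt_trans h2).
  by rewrite h2 (lt_trans w0).
- have xw : {ae mu, forall x : R, x != w}.
    exists [set w]; split => //; first exact: lebesgue_measure_set1.
    by move=> x /= /negP; rewrite negbK => /eqP.
  apply: ae_imp xw => x xw; rewrite /= in_itv/= => /andP[x0 x1].
  move: xw; rewrite neq_lt => /orP[h|h]; [exists 0%N|exists 1%N]; apply/tE => /=.
    by rewrite x0.
  by rewrite h.
Qed.

End Tiling.

Lemma e_mul_int (R : realType) (l x : R) (n : int) : e_ l (n%:~R * x) = e_ l x ^ n.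
Proof.
have posn (m : nat) : e_ l (m%:R * x) = e_ l x ^+ m.
  elim: m => [|m ih]; first by rewrite mul0r e_x0.
  by rewrite -natr1 mulrDl mul1r e_DR ih exprSr.
case: n => n; first exact: posn.
rewrite NegzE intrN mulNr -[RHS]/((e_ l x ^+ n.+1)^-1) -posn.
apply: (mulIf (e_neq0 l (n.+1%:R * x))); rewrite mulVf ?e_neq0//.
by rewrite -e_DR addNr e_x0.
Qed.

Lemma expi_pi_e (R : realType) (x : R) : expi (pi * x) = e_ x (1 / 2).
Proof. by rewrite /e_; congr expi; field. Qed.

Lemma ae_shift (R : realType) (P : R -> Prop) (c : R) :
  {ae @lebesgue_measure R, forall x, P x} -> {ae @lebesgue_measure R, forall x, P (x + c)}.
Proof.
move=> [N [mN N0 sN]]; exists [set x | N (x + c)]; split.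
- exact: measurable_shift.
- by have := lebesgue_measure_shift c mN; rewrite N0 => <-.
- by move=> x /= nP; apply: sN.
Qed.

(** * Local translations for w = 1/2 *)

Section HalfGap.
Variables (R : realType) (w rho : R) (l k : int).
Local Notation mu := (@lebesgue_measure R).
Hypotheses (w0 : 0 < w) (w1 : w < 1) (rho0 : 0 < rho).
Hypotheses (wE : w = 1 / 2) (wr : w + rho = l%:~R / 2) (l0 : l != 0).
Local Notation Omega := (two_intervals w rho).
Local Notation I1 := `]0, w[%classic.
Local Notation I2 := `]w + rho, 1 + rho[%classic.
Local Notation h := (l%:~R / 2 : R).
Local Notation r := ((2 * k + 1)%:~R / l%:~R : R).
Local Notation xi := (expi (pi * r)).
Implicit Types (f g : R -> R[i]) (x y z t : R).

Let mO := @measurable_two_intervals R w rho.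

Lemma half_rem_itv x : 0 <= half_rem x < 1 / 2.
Proof.
have /andP[] := frac_itv (2 * x); rewrite /half_rem /half_index.
by move: (_%:~R) => n h1 h2; apply/andP; split; lra.
Qed.

Lemma half_remK x : x = (half_index x)%:~R * (1 / 2) + half_rem x.
Proof. by rewrite /half_rem; ring. Qed.

Lemma half_rem_periodic x : half_rem (x + 1 / 2) = half_rem x.
Proof.
rewrite /half_rem /half_index (_ : 2 * (x + 1 / 2) = 2 * x + 1); last by field.
by rewrite floorDrz ?rpred1// floor1 intrD; field.
Qed.

Lemma half_index_0 x : 0 <= x < 1 / 2 -> half_index x = 0 /\ half_rem x = x.
Proof.
move=> /andP[x0 x1]; have h0 : half_index x = 0.
  by apply: floor_def; rewrite add0r; apply/andP; split; [lra|rewrite (_ : 1%:~R = 1)//; lra].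
by split=> //; rewrite /half_rem h0 mul0r subr0.
Qed.

Lemma half_rem_gt0 x : 2 * x \isn't a Num.int -> 0 < half_rem x.
Proof.
move=> xZ; have /andP[+ _] := half_rem_itv x; rewrite le_eqVlt => /predU1P[h0|//].
have xE : 2 * x = (half_index x)%:~R.
  by have := half_remK x; rewrite -h0 => {1}->; field.
by move: xZ; rewrite xE intr_int.
Qed.

Lemma I2_half x : I2 x <-> I1 (x - h).
Proof.
have oE : 1 + rho = h + 1 / 2 by rewrite -wr wE; field.
by rewrite /= !in_itv/= wr oE wE subr_gt0 ltrBlDl.
Qed.

Lemma Omega_half y : 0 < y < 1 / 2 -> Omega y /\ Omega (y + h).
Proof.
move=> y0; have Iy : I1 y by rewrite /= in_itv/= wE.
by split; [left|right; apply/I2_half; rewrite addrK].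
Qed.

(** Writing the integer power as an exponential makes its modulus and its measurability in x
    evident. *)
Lemma xi_e x : xi ^ half_index x = e_ r (x - half_rem x).
Proof.
have -> : x - half_rem x = (half_index x)%:~R * (1 / 2) by rewrite {1}[x]half_remK addrK.
by rewrite e_mul_int expi_pi_e.
Qed.

(** With [half_bot], the two entries of B^a applied to the values of f at y and y + l/2, where z =
    a/2 + y. The argument stands for x + t with x in the first interval. *)
Definition half_top f z : R[i] := (1 + xi ^ half_index z) / 2 * cut Omega f (half_rem z) +
  (1 - xi ^ half_index z) / 2 * cut Omega f (half_rem z + h).

Definition half_bot f z : R[i] := (1 - xi ^ half_index z) / 2 * cut Omega f (half_rem z) +
  (1 + xi ^ half_index z) / 2 * cut Omega f (half_rem z + h).

Definition half_translation t f x : R[i] :=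
  if x < w then half_top f (x + t) else half_bot f (x - h + t).

Lemma half_translation_I1 t f x : I1 x -> half_translation t f x = half_top f (x + t).
Proof. by rewrite /= in_itv/= /half_translation => /andP[_ ->]. Qed.

Lemma half_translation_I2 t f x : I2 x -> half_translation t f x = half_bot f (x - h + t).
Proof.
rewrite /= in_itv/= /half_translation => /andP[xw _]; rewrite ltNge.
by rewrite (le_trans _ (ltW xw))// lerDl ltW.
Qed.

Lemma half_translation_0 f x : Omega x -> half_translation 0 f x = f x.
Proof.
move=> Ox; have halves (u v : R[i]) : (1 + 1) / 2 * u + (1 - 1) / 2 * v = u by field.
have halves' (u v : R[i]) : (1 - 1) / 2 * u + (1 + 1) / 2 * v = v by field.
case: (Ox) => xI; [rewrite half_translation_I1// addr0|rewrite half_translation_I2// addr0].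
  have [a0 y0] : half_index x = 0 /\ half_rem x = x.
    by apply: half_index_0; move: xI; rewrite /= in_itv/= wE => /andP[/ltW-> ->].
  by rewrite /half_top a0 y0 expr0z halves cutE.
have [a0 y0] : half_index (x - h) = 0 /\ half_rem (x - h) = x - h.
  by apply: half_index_0; move: xI => /I2_half; rewrite /= in_itv/= wE => /andP[/ltW-> ->].
by rewrite /half_bot a0 y0 expr0z halves' subrK cutE.
Qed.

(** Unitarity of B^a. The right-hand side depends only on the remainder, so the sum has period 1/2
    although the power of xi does not. *)
Lemma normc_half f z : normc (half_top f z) ^+ 2 + normc (half_bot f z) ^+ 2 =
  normc (cut Omega f (half_rem z)) ^+ 2 + normc (cut Omega f (half_rem z + h)) ^+ 2.
Proof.
set u := xi ^ half_index z; set a := cut Omega f _; set b := cut Omega f _.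
have u1 : normc u = 1 by rewrite /u xi_e normc_e.
have e1 : circulant u *m col2 a b = col2 (half_top f z) (half_bot f z) by rewrite mx2_col2.
have := unitary_col2 (circulant_unitary u1) e1 e1.
by rewrite !mulcJ -!rmorphD => /complexI.
Qed.

Lemma measurable_half_rem : measurable_fun setT (@half_rem R).
Proof.
apply: measurable_funB => //; apply: measurable_funM; last exact: measurable_cst.
apply: (measurableT_comp (@measurable_floor R)).
by apply: measurable_funM => //; exact: measurable_cst.
Qed.

(** Both entries at once: c = 1 for the top one, c = -1 for the bottom one. *)
Lemma cmeasurable_half_comb (c : R[i]) f : cmeasurable Omega f -> cmeasurable setT
  (fun z => (1 + c * xi ^ half_index z) / 2 * cut Omega f (half_rem z) +
            (1 - c * xi ^ half_index z) / 2 * cut Omega f (half_rem z + h)).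
Proof.
move=> mf; have mc : cmeasurable setT (cut Omega f) by exact: cmeasurable_cut.
have mcst (a : R[i]) : cmeasurable setT (fun=> a) by split; exact: measurable_cst.
have mx : cmeasurable setT (fun z => xi ^ half_index z).
  rewrite (_ : (fun z => _) = fun z => e_ r (z - half_rem z)); last by apply/funext => z; rewrite xi_e.
  apply: cmeasurable_comp => //; first exact: cmeasurable_e.
  by apply: measurable_funB => //; exact: measurable_half_rem.
have mh : measurable_fun setT (fun z : R => half_rem z + h).
  by apply: measurable_funD; [exact: measurable_half_rem|exact: measurable_cst].
have m1 a : cmeasurable setT (fun z => (1 + a * xi ^ half_index z) * 2^-1).
  apply: cmeasurableM => //; apply: cmeasurableD => //; exact: cmeasurableM.
apply: cmeasurableD; apply: cmeasurableM.
- exact: m1.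
- by apply: (cmeasurable_comp measurableT mc); exact: measurable_half_rem.
- by have := m1 (- c); congr cmeasurable; apply/funext => z; rewrite mulNr.
- exact: (cmeasurable_comp measurableT mc).
Qed.

Lemma cmeasurable_half_top f : cmeasurable Omega f -> cmeasurable setT (half_top f).
Proof.
move=> /(cmeasurable_half_comb 1); congr cmeasurable; apply/funext => z.
by rewrite mul1r.
Qed.

Lemma cmeasurable_half_bot f : cmeasurable Omega f -> cmeasurable setT (half_bot f).
Proof.
move=> /(cmeasurable_half_comb (-1)); congr cmeasurable; apply/funext => z.
by rewrite mulN1r opprK.
Qed.

Lemma cmeasurable_half_translation t f : cmeasurable Omega f ->
  cmeasurable Omega (half_translation t f).
Proof.
move=> mf; have mI1 : measurable I1 by exact: measurable_itv.
have mI2 : measurable I2 by exact: measurable_itv.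
have [r1 i1] : cmeasurable I1 (half_translation t f).
  apply: (eq_cmeasurable (f := fun x => half_top f (x + t))).
    by move=> x xI; rewrite half_translation_I1.
  have mc := cmeasurable_comp measurableT (cmeasurable_half_top mf) (measurable_addr t).
  exact: (cmeasurable_subset measurableT (@subsetT _ _) mc).
have [r2 i2] : cmeasurable I2 (half_translation t f).
  apply: (eq_cmeasurable (f := fun x => half_bot f (x + (- h + t)))).
    by move=> x xI; rewrite half_translation_I2// addrA.
  have mc := cmeasurable_comp measurableT (cmeasurable_half_bot mf) (measurable_addr (- h + t)).
  exact: (cmeasurable_subset measurableT (@subsetT _ _) mc).
by split; apply/(measurable_funU _ mI1 mI2).
Qed.

Lemma normsq_half_translation t f : cmeasurable Omega f ->
  normsq Omega (half_translation t f) = normsq Omega f.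
Proof.
move=> mf; transitivity (normsq Omega (half_translation 0 f)); last first.
  by apply: eq_integral => x /set_mem Ox; rewrite half_translation_0.
pose N g z := ((normc (g z)) ^+ 2)%:E.
have mtop := cmeasurable_half_top mf; have mbot := cmeasurable_half_bot mf.
have mN g s : cmeasurable setT g -> measurable_fun setT (fun x : R => N g (x + s)).
  move=> mg; have [mr mi] := cmeasurable_comp measurableT mg (measurable_addr s).
  exact: measurable_normc_sqr mr mi.
pose G z := (N (half_top f) z + N (half_bot f) z)%E.
have mG : measurable_fun setT G.
  by have := emeasurable_funD (mN _ 0 mtop) (mN _ 0 mbot); congr measurable_fun;
    apply/funext => x; rewrite addr0.
have G0 x : (0 <= G x)%E by rewrite /G -EFinD lee_fin addr_ge0// sqr_ge0.
have GT x : G (x + w) = G x.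
  by rewrite /G /N -!EFinD !normc_half wE half_rem_periodic.
(* Moving the second interval onto the first one adds the two squared moduli into the periodic
   function G. *)
suff E s : normsq Omega (half_translation s f) = (\int[mu]_(x in `]0%R, w[) G (x + s)%R)%E.
  rewrite !E (periodic_integral_shift w0 mG G0 GT).
  by apply: eq_integral => x _; rewrite addr0.
have mI1 : measurable I1 by exact: measurable_itv.
have mI2 : measurable I2 by exact: measurable_itv.
rewrite (normsq_setU mI1 mI2 (two_intervals_disjoint w0 rho0) (cmeasurable_half_translation s mf)).
have mV := cmeasurable_half_translation s mf.
have mV2 : cmeasurable I2 (half_translation s f).
  exact: (cmeasurable_subset mO (@subsetUr _ I1 I2) mV).
rewrite (normsq_shift h mI2 mV2).
have -> : [set x | I2 (x + h)] = I1.
  apply/seteqP; split=> x xI; first by have /I2_half : I2 (x + h) := xI; rewrite addrK.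
  by apply: (I2_half (x + h)).2; rewrite addrK.
rewrite /G ge0_integralD//.
- congr (_ + _)%E; apply: eq_integral => x /set_mem xI.
    by rewrite half_translation_I1.
  by rewrite half_translation_I2 ?addrK//; apply/I2_half; rewrite addrK.
- by move=> x _; rewrite lee_fin sqr_ge0.
- exact: measurable_funS (mN _ s mtop).
- by move=> x _; rewrite lee_fin sqr_ge0.
- exact: measurable_funS (mN _ s mbot).
Qed.

Lemma isometry_half_translation t : isometry Omega (half_translation t).
Proof.
split=> [f Lf|a f g Lf Lg|f Lf].
- have mf := L2_cmeasurable Lf; have [mr mi] := cmeasurable_half_translation t mf.
  by split=> //; rewrite normsq_half_translation//; case: Lf.
- have cut_lin x : cut Omega (fun x => a * f x + g x) x = a * cut Omega f x + cut Omega g x.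
    by rewrite /cut; case: ifP => // _; rewrite mulr0 addr0.
  apply: ae_all => x _; rewrite /half_translation /half_top /half_bot !cut_lin.
  by case: ifP => _; ring.
- by rewrite /nsq normsq_half_translation//; exact: L2_cmeasurable Lf.
Qed.

(** The values of [e_ m] at y and y + l/2 form a multiple of an eigenvector of B with eigenvalue
    [e_ m (1 / 2)], so B^a multiplies them by the value of [e_ m] at a/2. *)
Lemma half_e m z : half_spectrum r m -> 2 * z \isn't a Num.int ->
  half_top (e_ m) z = e_ m z /\ half_bot (e_ m) z = e_ m (z + h).
Proof.
move=> mr zZ; have y0 : 0 < half_rem z < 1 / 2.
  by rewrite half_rem_gt0//=; have /andP[] := half_rem_itv z.
have [Oy Oyh] := Omega_half y0.
have zE : e_ m z = e_ m (1 / 2) ^ half_index z * e_ m (half_rem z).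
  by rewrite {1}[z]half_remK e_DR e_mul_int.
rewrite /half_top /half_bot !cutE// e_DR zE.
have := half_spectrum_eigen wE wr l0 mr; rewrite wr wE (e_DR m z) zE.
by case=> -[-> ->]; rewrite ?exp1rz; split; field.
Qed.

Lemma half_translation_e m t : half_spectrum r m ->
  half_translation t (e_ m) = (fun x => e_ m t * e_ m x) %[ae mu in Omega].
Proof.
move=> mr; have n2 : (2 : R) != 0 by rewrite pnatr_eq0.
have h1 := ae_notin_int (2 * t) n2; have h2 := ae_notin_int (2 * (t - h)) n2.
apply: ae_imp2 h1 h2 => x x1 x2 [xI|xI].
  rewrite half_translation_I1// (half_e mr _).1 ?mulrDr//.
  by rewrite e_DR mulrC.
rewrite half_translation_I2// (half_e mr _).2; last first.
    by rewrite (_ : 2 * (x - h + t) = 2 * x + 2 * (t - h))//; ring.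
by rewrite addrAC subrK e_DR mulrC.
Qed.

Lemma local_translations_half_gap :
  (exists U, local_translations Omega (half_spectrum r) U) /\
  forall U, local_translations Omega (half_spectrum r) U -> forall f t, L2 Omega f ->
  {ae mu, forall x : R, 0 <= x < 1 / 2 ->
    let a := half_index (x + t) in
    let y := half_rem (x + t) in
    let y' := y + l%:~R / 2 in
    let x' := x + l%:~R / 2 in
    [/\ U t f x = (1 + xi ^ a) / 2 * f y + (1 - xi ^ a) / 2 * f y',
        U t f x' = (1 - xi ^ a) / 2 * f y + (1 + xi ^ a) / 2 * f y' &
        col2 (U t f x) (U t f x') = circulant xi ^ a *m col2 (f y) (f y')]}.
Proof.
have onb := spectrum_half w0 w1 rho0 k wE wr l0; have fO := two_intervals_fin w0 w1 rho0.
have Ve m t : half_spectrum r m ->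
  half_translation t (e_ m) = (fun x => e_ m t * e_ m x) %[ae mu in Omega].
  exact: half_translation_e.
split.
  exists half_translation.
  exact: (isometry_local_translations mO fO onb isometry_half_translation).
move=> U lU f t Lf; have n2 : (2 : R) != 0 by rewrite pnatr_eq0.
have h1 := local_translations_unique mO onb isometry_half_translation Ve lU t Lf.
have h2 := ae_notin_int (2 * t) n2; have h3 := ae_notin_int 0 (oner_neq0 R).
(* The a.e. identity is used at x and, translated, at x + l/2. [h2] keeps the remainder of x + t
   away from 0, and [h3] removes x = 0, which the half-open range admits but Omega does not. *)
apply: ae_imp2 (ae_and h1 (ae_shift h h1)) (ae_and h2 h3) => x [Ux Uxh] [xt x0].
move=> /andP[x00 x12]; set a := half_index (x + t); set y := half_rem (x + t).
set y' := y + h; set x' := x + h.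
have xpos : 0 < x < 1 / 2.
  rewrite x12 andbT lt_neqAle x00 andbT; apply: contra x0 => /eqP <-.
  by rewrite mulr0 addr0 rpred0.
have [Ox Oxh] := Omega_half xpos.
have y0 : 0 < half_rem (x + t) < 1 / 2.
  by rewrite half_rem_gt0 ?mulrDr//=; have /andP[] := half_rem_itv (x + t).
have [Oy Oyh] := Omega_half y0.
have xI1 : I1 x by rewrite /= in_itv/= wE.
have xI2 : I2 x' by apply/I2_half; rewrite /x' addrK.
have E1 : U t f x = (1 + xi ^ a) / 2 * f y + (1 - xi ^ a) / 2 * f y'.
  by rewrite Ux// half_translation_I1// /half_top !cutE.
have E2 : U t f x' = (1 - xi ^ a) / 2 * f y + (1 + xi ^ a) / 2 * f y'.
  by rewrite Uxh// half_translation_I2// /x' addrK /half_bot !cutE.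
split=> //; rewrite circulantXz ?mx2_col2 ?E1 ?E2//; exact: expi_neq0.
Qed.

End HalfGap.

Theorem theorem5p1 (R : realType) (w rho : R)
    (w_gt0 : 0 < w) (w_lt1 : w < 1) (rho_gt0 : 0 < rho) :
  let mu := @lebesgue_measure R in
  let Omega := two_intervals w rho in
  let Z := [set x : R | x \is a Num.int] in
  let case_i := rho \is a Num.int /\ w <> 1 / 2 in
  let case_ii (l : int) :=
    [/\ w = 1 / 2, w + rho = l%:~R / 2 & 1 + rho = (l + 1)%:~R / 2] in
  [/\ spectral Omega <-> case_i \/ (exists l : int, case_ii l),
      case_i ->
        [/\ forall Lambda, is_spectrum Omega Lambda /\ Lambda 0 <-> Lambda = Z,
            Z_congruent_to_unit_interval Omega /\ tiles_by_Z Omega,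
            forall B, spectral_matrix w rho Z B <-> B = mx2 0 1 1 0,
            {ae mu, forall x : R,
              exists! y, Omega y /\ x - y \is a Num.int} &
            (exists U, local_translations Omega Z U) /\
            forall U, local_translations Omega Z U ->
              forall f (t : R), L2 Omega f ->
                {ae mu, forall x : R,
                  Omega x -> U t f x = f (mod_set Omega (x + t))}] &
      forall l : int, case_ii l ->
      forall Lambda, is_spectrum Omega Lambda -> Lambda 0 ->
      exists2 k : int, 0 <= k < l &
        let r : R := (2 * k + 1)%:~R / l%:~R in
        let xi := expi (pi * r) in
        let B := mx2 ((1 + xi) / 2) ((1 - xi) / 2)
                     ((1 - xi) / 2) ((1 + xi) / 2) in
        [/\ Lambda = [set s + 2 * j%:~R | s in [set 0; r] & j in [set: int]],
            forall B', spectral_matrix w rho Lambda B' <-> B' = B,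
            exists U, local_translations Omega Lambda U &
            forall U, local_translations Omega Lambda U ->
              forall f (t : R), L2 Omega f ->
              {ae mu, forall x : R, 0 <= x < 1 / 2 ->
                let a := half_index (x + t) in
                let y := half_rem (x + t) in
                let y' := y + l%:~R / 2 in
                let x' := x + l%:~R / 2 in
                [/\ U t f x =
                      (1 + xi ^ a) / 2 * f y + (1 - xi ^ a) / 2 * f y',
                    U t f x' =
                      (1 - xi ^ a) / 2 * f y + (1 + xi ^ a) / 2 * f y' &
                    col2 (U t f x) (U t f x') = B ^ a *m col2 (f y) (f y')]}]].
Proof.
move=> mu Omega Z case_i case_ii; split.
- exact: (spectralP w_gt0 w_lt1 rho_gt0).
- move=> [rZ wE]; split.
  + by move=> Lambda; exact: (spectrum_integer_gap w_gt0 w_lt1 rho_gt0).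
  + by split; [exact: Z_congruent_integer_gap|exact: tiles_integer_gap].
  + by move=> B; exact: (spectral_matrix_integer_gap w_gt0 w_lt1 rho_gt0).
  + exact: (ae_unique_representative w_gt0 w_lt1 rZ).
  + exact: (local_translations_integer_gap w_gt0 w_lt1 rho_gt0 rZ).
- move=> l [wE wr _] Lambda /(is_spectrum_onb w_gt0 w_lt1 rho_gt0) onb L0.
  have [_ l1] := half_endpoints rho_gt0 wE wr.
  have l0 : l != 0 by rewrite gt_eqF// (lt_trans ltr01).
  have [k kl LE] := spectrum_half_gap w_gt0 w_lt1 rho_gt0 wE wr onb L0.
  exists k => // r xi B; rewrite LE.
  have [exU allU] := local_translations_half_gap k w_gt0 w_lt1 rho_gt0 wE wr l0.
  split=> //.
  by move=> B'; exact: (spectral_matrix_half_gap w_gt0 w_lt1 rho_gt0 k B' wE wr l0).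
Qed.
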